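(* Let $f,g\colon(\mathbb{R}^2,0)\to(\mathbb{R},0)$ be nonzero real analytic function germs, both regular in $x$, such that $0\in\{f=0\}\subset\{g=0\}$ (as germs at the origin). Let $\beta_1,\dots,\beta_k$ be the common real Newton--Puiseux roots of $f$ and $g$, and let $m_j$, $n_j$ be the multiplicities of $\beta_j$ as a root of $f$ and of $g$ respectively. Define $$\mathscr{L}^+_g(f):=\max\left\{\ell(\gamma),\ \frac{m_j}{n_j}\ \Big|\ \gamma\in\mathcal V_{\mathbb R}(f),\ j=1,\dots,k\right\},\qquad \mathscr{L}^-_g(f):=\mathscr{L}^+_{\bar g}(\bar f),$$ where $\bar f(x,y):=f(x,-y)$ and $\bar g(x,y):=g(x,-y)$. Then $$\mathscr{L}_g(f)=\max\{\mathscr{L}^+_g(f),\ \mathscr{L}^-_g(f)\}.$$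
   Context: A germ $f(x,y)=f_m(x,y)+f_{m+1}(x,y)+\cdots$ (with $f_k$ homogeneous of degree $k$, $f_m\not\equiv0$) is regular in $x$ if $f_m(1,0)\neq0$. The Łojasiewicz exponent $\mathscr{L}_g(f)$ of $f$ with respect to $g$ is the infimum of all $\alpha>0$ for which there exist $C,r>0$ with $|f(x,y)|\ge C|g(x,y)|^\alpha$ for $|(x,y)|\le r$. A Puiseux series is an element $\phi(y)=\sum_i a_i y^{\alpha_i}\in\mathbb{C}\{y^{1/N}\}$ (some $N\ge1$, positive rational exponents $\alpha_1<\alpha_2<\cdots$); it is real if all coefficients are real. A Newton--Puiseux root of $f$ is a Puiseux series $\phi$ with $f(\phi(y),y)\equiv0$; its multiplicity is the largest $m$ with $f(x,y)=(x-\phi(y))^m h(x,y)$, $h(\phi(y),y)\not\equiv0$. For a Puiseux series $\phi(y)=\sum_i a_iy^{\alpha_i}$ and $\rho>0$, the $\rho$-approximation of $\phi$ is $\sum_{\alpha_i<\rho}a_iy^{\alpha_i}+cy^\rho$ with $c$ a generic real number. The real approximation of $\phi$ is its $\rho$-approximation where $\rho$ is the smallest exponent of $\phi$ with non-real coefficient. $\mathcal V_{\mathbb R}(f)$ is the set of real approximations of all non-real Newton--Puiseux roots of $f$. For a Puiseux series $\phi$ (evaluated at real $y>0$) with $g(\phi(y),y)\not\equiv0$, $\ell(\phi):=\dfrac{\mathrm{ord}_y f(\phi(y),y)}{\mathrm{ord}_y g(\phi(y),y)}$. *)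

(* Defs.v *)
From Stdlib Require Import Reals List Arith.
From Coquelicot Require Import Coquelicot.
Open Scope R_scope.

Fixpoint cpow (z : C) (n : nat) : C :=
  match n with O => RtoC 1 | S n => Cmult z (cpow z n) end.
Fixpoint csum (u : nat -> C) (n : nat) : C :=
  match n with O => u O | S n => Cplus (csum u n) (u (S n)) end.
(* sum of a complex series, componentwise (correct for convergent series) *)
Definition CSeries (u : nat -> C) : C :=
  (Series (fun n => fst (u n)), Series (fun n => snd (u n))).

(* Cauchy-type estimate: coefficients of a convergent power series in two variables *)
Definition conv2 {T : Type} (nrm : T -> R) (a : nat -> nat -> T) : Prop :=
  exists r M, 0 < r /\ forall i j, nrm (a i j) * r ^ (i + j) <= M.
Definition conv1 (c : nat -> C) : Prop :=
  exists r M, 0 < r /\ forall k, Cmod (c k) * r ^ k <= M.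

Definition eval2 (c : nat -> nat -> C) (x t : C) : C :=
  CSeries (fun n => csum (fun i => Cmult (c i (n - i)%nat)
                                   (Cmult (cpow x i) (cpow t (n - i)%nat))) n).

Definition germ_val (a : nat -> nat -> R) (x : C) (y : R) : C :=
  eval2 (fun i j => RtoC (a i j)) x (RtoC y).
Definition rval (a : nat -> nat -> R) (x y : R) : R := fst (germ_val a (RtoC x) y).

(* f regular in x: lowest homogeneous part f_m satisfies f_m(1,0) = a_{m0} <> 0 *)
Definition regular_x (a : nat -> nat -> R) : Prop :=
  exists m : nat, a m O <> 0 /\ forall i j, (i + j < m)%nat -> a i j = 0.

(* fbar(x,y) = f(x,-y) *)
Definition bar (a : nat -> nat -> R) : nat -> nat -> R := fun i j => (-1) ^ j * a i j.

(* phi(y) = sum_k c_k y^(k/N) *)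
Record puiseux := Puis { pN : nat; pc : nat -> C }.
Definition is_puiseux (p : puiseux) : Prop :=
  (1 <= pN p)%nat /\ pc p O = RtoC 0 (* positive exponents *) /\ conv1 (pc p).
Definition ypow (N : nat) (y : R) : R := Rpower y (/ INR N).  (* y^(1/N), y > 0 *)
Definition puis_val (p : puiseux) (y : R) : C :=
  CSeries (fun k => Cmult (pc p k) (RtoC (ypow (pN p) y ^ k))).
Definition is_real_puis (p : puiseux) : Prop := forall k, snd (pc p k) = 0.

Definition near0 (P : R -> Prop) : Prop := exists r, 0 < r /\ forall y, 0 < y < r -> P y.

Definition is_root (a : nat -> nat -> R) (p : puiseux) : Prop :=
  is_puiseux p /\ near0 (fun y => germ_val a (puis_val p y) y = RtoC 0).

Definition mult (a : nat -> nat -> R) (p : puiseux) (m : nat) : Prop :=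
  is_root a p /\
  exists (M : nat) (hc : nat -> nat -> C),
    (1 <= M)%nat /\ conv2 Cmod hc /\
    (exists r, 0 < r /\ forall (y : R) (x : C), 0 < y < r -> Cmod x < r ->
       germ_val a x y = Cmult (cpow (Cminus x (puis_val p y)) m)
                              (eval2 hc x (RtoC (ypow M y)))) /\
    ~ near0 (fun y => eval2 hc (puis_val p y) (RtoC (ypow M y)) = RtoC 0).

Definition has_ord (h : R -> C) (q : R) : Prop :=
  exists (N : nat) (d : nat -> C),
    (1 <= N)%nat /\ conv1 d /\
    near0 (fun y => h y = CSeries (fun k => Cmult (d k) (RtoC (ypow N y ^ k)))) /\
    exists k0 : nat, d k0 <> RtoC 0 /\ (forall k, (k < k0)%nat -> d k = RtoC 0) /\
                     q = INR k0 / INR N.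

(* ell(phi) = ord f(phi(y),y) / ord g(phi(y),y)  (requires g(phi(y),y) not = 0) *)
Definition ell (a b : nat -> nat -> R) (p : puiseux) (l : R) : Prop :=
  exists q1 q2, has_ord (fun y => germ_val a (puis_val p y) y) q1 /\
                has_ord (fun y => germ_val b (puis_val p y) y) q2 /\ l = q1 / q2.

Definition first_nonreal (p : puiseux) (k0 : nat) : Prop :=
  snd (pc p k0) <> 0 /\ forall k, (k < k0)%nat -> snd (pc p k) = 0.

Definition real_approx (p : puiseux) (k0 : nat) (c : R) : puiseux :=
  Puis (pN p) (fun k => if Nat.ltb k k0 then pc p k
                        else if Nat.eqb k k0 then RtoC c else RtoC 0).

(* the set whose maximum is L^+_g(f):
   ell(gamma) for gamma in V_R(f) (value for generic c = all c outside a finite set),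
   and m_j/n_j for common real roots *)
Definition Lplus_set (a b : nat -> nat -> R) (l : R) : Prop :=
  (exists p k0, is_root a p /\ first_nonreal p k0 /\
     exists F : list R, forall c, ~ In c F -> ell a b (real_approx p k0 c) l)
  \/ (exists p m n, is_real_puis p /\ mult a p m /\ mult b p n /\ l = INR m / INR n).

Definition Lminus_set (a b : nat -> nat -> R) (l : R) : Prop :=
  Lplus_set (bar a) (bar b) l.

Definition rpow0 (x al : R) : R := if Req_EM_T x 0 then 0 else Rpower x al.
Definition loj_adm (a b : nat -> nat -> R) (al : R) : Prop :=
  0 < al /\ exists Cc r, 0 < Cc /\ 0 < r /\
    forall x y, sqrt (x ^ 2 + y ^ 2) <= r ->
      Rabs (rval a x y) >= Cc * rpow0 (Rabs (rval b x y)) al.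
Definition is_inf (P : R -> Prop) (L : R) : Prop :=
  (forall al, P al -> L <= al) /\
  (forall L', (forall al, P al -> L' <= al) -> L' <= L).

(* Main.v *)
(** By Hensel's lemma with geometric bounds for the coefficients, a monic polynomial over the
    convergent power series in [t] splits into linear factors after [t] is replaced by a power
    of [t] (Newton-Puiseux).  With the preparation theorem, a germ regular in [x] is, on a half
    plane [y > 0], a unit times a finite product of factors [x - phi(y)] over its roots [phi].

    Lower bound: a test arc [x = gamma(y)] forces [ell(gamma) <= alpha], and [x -> beta_j(y)] for
    fixed [y] forces [m_j / n_j <= alpha].

    Upper bound: let [lam] be the largest element of [L^+].  The real truncations of the roots
    of [f] and [g] form a tree.  To a node [p], a truncation at order [k], we attach the height
    [ord f - lam * ord g] along the generic arc that starts with [p].  A node of positive height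
    at which [f] has more than [lam] times as many roots as [g] has a child with the same
    properties, and so have the children of that child, up to a node all of whose roots agree;
    this contradicts [m_j <= lam * n_j], and shows that all relevant heights are at most [0].
    The inequality [|f| >= C |g|^lam] then follows by induction from the leaves of the tree to
    its root: in the region near a node but away from its children both sides are monomials in
    [t] and in the distance to the arc. *)

Require Import Defs.
From HB Require Import structures.
From mathcomp Require all_boot all_order all_algebra boolp complex Rstruct zify ring lra.
From Stdlib Require Reals Lra Lia List ClassicalEpsilon Classical Arith.
From Coquelicot Require Coquelicot.

Module PowerSeries.

Import all_boot all_order all_algebra boolp complex mathcomp.zify.zify mathcomp.algebra_tactics.ring mathcomp.algebra_tactics.lra.
Import Order.TTheory GRing.Theory Num.Theory.
Set Implicit Arguments. Unset Strict Implicit. Unset Printing Implicit Defensive.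
Local Open Scope ring_scope.
#[local] Arguments ComplexField.Normc.normc : simpl never.

(** * The ring of formal power series *)

(** The substitution [x = z * y] turns preparation into a case of Hensel's lemma: the homogeneous
    parts of the germ become polynomials in [z] of growing degree, by regularity the lowest one has
    full degree, and it is lifted against a constant. The roots found are values of [z], so the
    roots in [x] are divisible by [y] and have positive exponents.

    The obstacle in the upper bound is that [L^+] speaks only of nodes where a root of [f] leaves
    the real tree and of leaves with a root of [f]; where real roots separate nothing is given. The
    height settles these nodes because it grows from a node to a child by the number of roots of [f]
    through the child minus [lam] times that of [g]: a first positive height comes from a positive
    increment, which is the excess of roots that can be followed upwards.

    [lam] is the maximum of one candidate for each root of [f], not of all of [L^+]. That it bounds
    the other elements follows at the end from the lower bound, because the larger of the two
    half-plane values is itself an admissible exponent. *)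

Record fps (V : Type) := Fps { fcoef :> nat -> V }.

Section FpsRing.
Variable V : comNzRingType.
Implicit Types u v w : fps V.

HB.instance Definition _ := gen_eqMixin (fps V).
HB.instance Definition _ := gen_choiceMixin (fps V).

Lemma fpsP u v : (forall k, u k = v k) -> u = v.
Proof. by case: u v => u [v] /= H; congr Fps; apply/funext. Qed.

Definition fps0 : fps V := Fps (fun _ => 0).
Definition fpsC (c : V) : fps V := Fps (fun k => if k is 0%N then c else 0).
Definition fps_opp u : fps V := Fps (fun k => - u k).
Definition fps_add u v : fps V := Fps (fun k => u k + v k).
Definition fps_mul u v : fps V := Fps (fun k => \sum_(i < k.+1) u i * v (k - i)%N).
Definition fps_trunc n u : {poly V} := \poly_(i < n.+1) u i.

Lemma coef_fps_trunc n u k : (k <= n)%N -> (fps_trunc n u)`_k = u k.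
Proof. by move=> le_kn; rewrite coef_poly ltnS le_kn. Qed.

(** Coefficients up to [n] of a product only see the truncations, so the ring laws are inherited
    from [{poly V}] instead of being checked on double sums. *)
Lemma fps_mul_trunc n u v k : (k <= n)%N ->
  fps_mul u v k = (fps_trunc n u * fps_trunc n v)`_k.
Proof.
move=> le_kn; rewrite coefM; apply: eq_bigr => i _.
by rewrite !coef_fps_trunc //; move: (ltn_ord i); lia.
Qed.

Lemma fps_addA : associative fps_add.
Proof. by move=> u v w; apply: fpsP => k /=; rewrite addrA. Qed.
Lemma fps_addC : commutative fps_add.
Proof. by move=> u v; apply: fpsP => k /=; rewrite addrC. Qed.
Lemma fps_add0 : left_id fps0 fps_add.
Proof. by move=> u; apply: fpsP => k /=; rewrite add0r. Qed.
Lemma fps_addN : left_inverse fps0 fps_opp fps_add.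
Proof. by move=> u; apply: fpsP => k /=; rewrite addNr. Qed.
HB.instance Definition _ :=
  GRing.isZmodule.Build (fps V) fps_addA fps_addC fps_add0 fps_addN.

Lemma fps_mulC : commutative fps_mul.
Proof. by move=> u v; apply: fpsP => k; rewrite !(fps_mul_trunc _ _ (leqnn k)) mulrC. Qed.
Lemma fps_mulA : associative fps_mul.
Proof.
move=> u v w; apply: fpsP => k.
transitivity ((fps_trunc k u * (fps_trunc k v * fps_trunc k w))`_k).
  rewrite coefM; apply: eq_bigr => i _; congr (_ * _).
    by rewrite coef_fps_trunc // -ltnS.
  by rewrite (@fps_mul_trunc k) ?leq_subr.
rewrite mulrA coefM; apply: eq_bigr => i _; congr (_ * _).
  by rewrite (@fps_mul_trunc k) // -ltnS.
by rewrite coef_fps_trunc ?leq_subr.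
Qed.
Lemma fps_mul1 : left_id (fpsC 1) fps_mul.
Proof.
move=> u; apply: fpsP => k /=; rewrite big_ord_recl /= subn0 mul1r big1 ?addr0 //.
by move=> i _; rewrite mul0r.
Qed.
Lemma fps_mulDl : left_distributive fps_mul fps_add.
Proof.
move=> u v w; apply: fpsP => k /=; rewrite -big_split /=.
by apply: eq_bigr => i _; rewrite mulrDl.
Qed.
Lemma fps_1neq0 : fpsC 1 != fps0.
Proof. by apply/eqP => /(congr1 (fun u => fcoef u 0%N)) /eqP; rewrite oner_eq0. Qed.
HB.instance Definition _ :=
  GRing.Zmodule_isComNzRing.Build (fps V) fps_mulA fps_mulC fps_mul1 fps_mulDl fps_1neq0.

Lemma fpsED u v k : (u + v) k = u k + v k. Proof. by []. Qed.
Lemma fpsEB u v k : (u - v) k = u k - v k. Proof. by []. Qed.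
Lemma fpsEM u v k : (u * v) k = \sum_(i < k.+1) u i * v (k - i)%N. Proof. by []. Qed.
Lemma fpsE1 k : (1 : fps V) k = (k == 0%N)%:R. Proof. by case: k. Qed.
Lemma fpsE_sum I (r : seq I) (P : pred I) (F : I -> fps V) k :
  (\sum_(i <- r | P i) F i) k = \sum_(i <- r | P i) F i k.
Proof. by elim/big_rec2: _ => //= i x y _ <-. Qed.
Lemma fpsEM0 u v : (u * v) 0%N = u 0%N * v 0%N.
Proof. by rewrite fpsEM big_ord1. Qed.

Lemma fpsC_is_zmod : zmod_morphism fpsC.
Proof. by move=> x y; apply: fpsP => -[|k] //=; rewrite subr0. Qed.
Lemma fpsC_is_monoid : monoid_morphism fpsC.
Proof.
split=> // x y; apply: fpsP => k; rewrite fpsEM.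
rewrite big_ord_recl /= subn0 big1 ?addr0 /=; first by case: k => //= k; rewrite mulr0.
by move=> i _; rewrite mul0r.
Qed.
HB.instance Definition _ := GRing.isZmodMorphism.Build V (fps V) fpsC fpsC_is_zmod.
HB.instance Definition _ := GRing.isMonoidMorphism.Build V (fps V) fpsC fpsC_is_monoid.

Lemma fpsECM c u k : (fpsC c * u) k = c * u k.
Proof.
rewrite fpsEM big_ord_recl /= subn0 big1 ?addr0 // => i _.
by rewrite mul0r.
Qed.

Definition ev0 u : V := u 0%N.
Lemma ev0_is_zmod : zmod_morphism ev0. Proof. by []. Qed.
Lemma ev0_is_monoid : monoid_morphism ev0.
Proof. by split => // u v; rewrite /ev0 fpsEM0. Qed.
HB.instance Definition _ := GRing.isZmodMorphism.Build (fps V) V ev0 ev0_is_zmod.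
HB.instance Definition _ := GRing.isMonoidMorphism.Build (fps V) V ev0 ev0_is_monoid.

(** The substitution of [t * T] for the variable [T], a ring morphism. Values at [t] are later taken
    as the sum of all coefficients of [scale t u], so identities between series pass to their
    values. *)
Definition scale (t : V) u : fps V := Fps (fun k => u k * t ^+ k).
Lemma scale_is_zmod t : zmod_morphism (scale t).
Proof. by move=> u v; apply: fpsP => k /=; rewrite mulrBl. Qed.
Lemma scale_is_monoid t : monoid_morphism (scale t).
Proof.
split=> [|u v]; apply: fpsP => k /=.
  by case: k => [|k] /=; rewrite ?expr0 ?mulr1 ?mul0r.
rewrite mulr_suml; apply: eq_bigr => i _.
have le_ik : (i <= k)%N by rewrite -ltnS.
have -> : t ^+ k = t ^+ i * t ^+ (k - i) by rewrite -exprD subnKC.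
ring.
Qed.
HB.instance Definition _ t :=
  GRing.isZmodMorphism.Build (fps V) (fps V) (scale t) (scale_is_zmod t).
HB.instance Definition _ t :=
  GRing.isMonoidMorphism.Build (fps V) (fps V) (scale t) (scale_is_monoid t).

(* [u(t)] becomes [u(t^(N+1))]. *)
Definition stretch (N : nat) u : fps V :=
  Fps (fun k => if (N.+1 %| k)%N then u (k %/ N.+1)%N else 0).

Lemma stretchE N u k :
  stretch N u k = if (N.+1 %| k)%N then u (k %/ N.+1)%N else 0.
Proof. by []. Qed.

(** Serves twice: for the multiplicativity of [stretch], and to see that the partial sums of a
    stretched series are those of the original one, each repeated. *)
Lemma sum_stretch N (F : nat -> V) k :
  \sum_(i < k.+1) (if (N.+1 %| i)%N then F (i %/ N.+1)%N else 0)
  = \sum_(j < (k %/ N.+1).+1) F j.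
Proof.
elim: k => [|k IH]; first by rewrite big_ord1 div0n big_ord1 dvdn0.
rewrite big_ord_recr /= IH; case: ifP => dv.
  have [q hq] := dvdnP dv; have q0 : (0 < q)%N by lia.
  have -> : (k %/ N.+1 = q.-1)%N by nia.
  by rewrite hq mulnK // -[in RHS](prednK q0) [RHS]big_ord_recr /= prednK.
rewrite addr0.
have -> : (k.+1 %/ N.+1 = k %/ N.+1)%N; last by [].
have := divn_eq k.+1 N.+1; have := ltn_pmod k.+1 (ltn0Sn N).
have : (k.+1 %% N.+1 != 0)%N by rewrite -/(dvdn _ _) dv.
by nia.
Qed.

Lemma stretch_is_zmod N : zmod_morphism (stretch N).
Proof. by move=> u v; apply: fpsP => k /=; case: ifP; rewrite ?subr0. Qed.
Lemma stretch_is_monoid N : monoid_morphism (stretch N).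
Proof.
split=> [|u v]; apply: fpsP => k /=.
  case: k => [|k]; first by rewrite dvdn0 div0n.
  by case: ifP => // /dvdnP[q E]; rewrite E mulnK //; case: q E.
case: ifP => dv.
  transitivity (\sum_(i < k.+1) if (N.+1 %| i)%N
     then u (i %/ N.+1)%N * v (k %/ N.+1 - i %/ N.+1)%N else 0).
    by rewrite (sum_stretch N (fun j => u j * v (k %/ N.+1 - j)%N)).
  apply: eq_bigr => i _; case: ifP => di; last by rewrite mul0r.
  have le_ik : (i <= k)%N by rewrite -ltnS.
  by rewrite dvdn_subr // di divnBr.
rewrite big1 // => i _; case: ifP => di; rewrite ?mul0r //.
have le_ik : (i <= k)%N by rewrite -ltnS.
by rewrite dvdn_subl // dv mulr0.
Qed.
HB.instance Definition _ N :=
  GRing.isZmodMorphism.Build (fps V) (fps V) (stretch N) (stretch_is_zmod N).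
HB.instance Definition _ N :=
  GRing.isMonoidMorphism.Build (fps V) (fps V) (stretch N) (stretch_is_monoid N).

Lemma stretch_stretch N M u : stretch M (stretch N u) = stretch (N.+1 * M.+1).-1 u.
Proof.
apply: fpsP => k; rewrite !stretchE (@prednK (N.+1 * M.+1)) //.
case: ifP => dM; last first.
  by case: ifP => // d; move: dM; rewrite (dvdn_trans _ d) // dvdn_mull.
by rewrite -dvdn_divRL // divnMA divnAC.
Qed.

Lemma scale_stretch N t u : scale t (stretch N u) = stretch N (scale (t ^+ N.+1) u).
Proof.
apply: fpsP => k /=; case: ifP => dv; last by rewrite mul0r.
by rewrite -exprM mulnC divnK.
Qed.

Definition dropu k u : fps V := Fps (fun j => u (j + k)%N).
Definition tX : fps V := Fps (fun k => (k == 1%N)%:R).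

Lemma tXM u k : (tX * u) k = if k is k'.+1 then u k' else 0.
Proof.
rewrite fpsEM; case: k => [|k]; first by rewrite big_ord1 mul0r.
rewrite big_ord_recl mul0r add0r big_ord_recl /= subn1 mul1r big1 ?addr0 //.
by move=> i _; rewrite mul0r.
Qed.

Lemma tXnM n u k : (tX ^+ n * u) k = if (k < n)%N then 0 else u (k - n)%N.
Proof.
elim: n u k => [|n IH] u k; first by rewrite mul1r subn0.
by rewrite exprS -mulrA tXM; case: k => // k; rewrite IH ltnS subSS.
Qed.

Lemma tXn n k : (tX ^+ n) k = (k == n)%:R.
Proof.
rewrite -[tX ^+ n]mulr1 tXnM fpsE1 subn_eq0.
by case: (ltngtP k n).
Qed.

Lemma dropuK k u : (forall j, (j < k)%N -> u j = 0) -> tX ^+ k * dropu k u = u.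
Proof.
move=> u0; apply: fpsP => j; rewrite tXnM; case: ltnP => [/u0 //|le_kj] /=.
by rewrite subnK.
Qed.

Lemma stretch_tX N : stretch N tX = tX ^+ N.+1.
Proof.
apply: fpsP => k; rewrite tXn /=; case: ifP => [/dvdnP[q ->]|dv].
  by rewrite mulnK // -[X in (_ * _ == X)%N]mul1n eqn_mul2r.
by case: eqP dv => // ->; rewrite dvdnn.
Qed.

End FpsRing.

(** * Convergent power series *)

Lemma exprn_split (A : pzRingType) (x : A) i k :
  (i <= k)%N -> x ^+ k = x ^+ i * x ^+ (k - i).
Proof. by move=> h; rewrite -exprD subnKC. Qed.

Lemma eq_le_r (A : numDomainType) (x y : A) : x = y -> x <= y.
Proof. by move=> ->. Qed.

Section Majorants.
Variable R : rcfType.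
Local Notation C := R[i].
Local Notation nm := (@ComplexField.Normc.normc R).

Lemma nmM x y : nm (x * y) = nm x * nm y. Proof. exact: ComplexField.Normc.normcM. Qed.
Lemma nmD x y : nm (x + y) <= nm x + nm y. Proof. exact: le_normcD. Qed.
Lemma nmN x : nm (- x) = nm x. Proof. exact: normcN. Qed.
Lemma nm0 : nm 0 = 0. Proof. exact: ComplexField.Normc.normc0. Qed.
Lemma nm1 : nm 1 = 1. Proof. exact: ComplexField.Normc.normc1. Qed.
Lemma nm_ge0 x : 0 <= nm x. Proof. by case: x => a b; exact: sqrtr_ge0. Qed.
Lemma nmX x n : nm (x ^+ n) = nm x ^+ n.
Proof. by elim: n => [|n IH]; rewrite ?expr0 ?nm1 // !exprS nmM IH. Qed.
Lemma nm_sum I (r : seq I) (P : pred I) (F : I -> C) :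
  nm (\sum_(i <- r | P i) F i) <= \sum_(i <- r | P i) nm (F i).
Proof.
elim/big_rec2: _ => [|i x y _ IH]; first by rewrite nm0.
by apply: le_trans (nmD _ _) _; rewrite lerD2l.
Qed.

Lemma sum_coefM_le (U V : {poly R}) m :
  (forall i, 0 <= U`_i) -> (forall i, 0 <= V`_i) ->
  \sum_(k < m) (U * V)`_k <= U.[1] * V.[1].
Proof.
move=> U0 V0.
have UV0 k : 0 <= (U * V)`_k by rewrite coefM; apply: sumr_ge0 => i _; rewrite mulr_ge0.
rewrite -hornerM (@horner_coef_wide _ (m + size (U * V))) ?leq_addl //.
rewrite big_split_ord /= -[X in X <= _]addr0; apply: lerD.
  by apply: ler_sum => i _; rewrite expr1n mulr1.
by apply: sumr_ge0 => i _; rewrite expr1n mulr1.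
Qed.

Lemma horner1_poly n (u : nat -> R) : (\poly_(i < n) u i).[1] = \sum_(i < n) u i.
Proof. by rewrite horner_poly; apply: eq_bigr => i _; rewrite expr1n mulr1. Qed.

Lemma sum_conv_le (u v : nat -> R) n :
  (forall i, 0 <= u i) -> (forall i, 0 <= v i) ->
  \sum_(k < n) \sum_(i < k.+1) u i * v (k - i)%N
  <= (\sum_(k < n) u k) * (\sum_(k < n) v k).
Proof.
move=> u0 v0; rewrite -!horner1_poly.
have P0 w : (forall i, 0 <= w i) -> forall i, 0 <= (\poly_(i < n) w i : {poly R})`_i.
  by move=> w0 i; rewrite coef_poly; case: ifP.
apply: le_trans (sum_coefM_le n (P0 _ u0) (P0 _ v0)).
apply: ler_sum => k _; rewrite coefM; apply: ler_sum => i _.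
rewrite !coef_poly; move: (ltn_ord k) (ltn_ord i) => hk hi.
have -> : (i < n)%N by lia.
by have -> : (k - i < n)%N by lia.
Qed.

Lemma sum_geom_half (x : R) n : 0 <= x -> x <= 2^-1 -> \sum_(k < n) x ^+ k.+1 <= 2 * x.
Proof.
move=> x0 xh; suff : \sum_(k < n) x ^+ k.+1 + 2 * x ^+ n.+1 <= 2 * x.
  by apply: le_trans; rewrite lerDl mulr_ge0 // exprn_ge0.
elim: n => [|n IH]; first by rewrite big_ord0 add0r expr1.
rewrite big_ord_recr /=; apply: le_trans IH; rewrite -addrA lerD2l.
have : 0 <= x ^+ n.+1 by rewrite exprn_ge0.
rewrite (exprS x n.+1); move: (x ^+ n.+1) => y; nra.
Qed.

(* Partial sums satisfy [S_(n+1) <= K m + K S_n^2], where [m] is small for small [tau];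
   hence they stay below [2 K m]. *)
Lemma quadratic_majorant (e : nat -> R) (K M rho : R) :
  0 <= K -> 0 <= M -> 0 <= rho -> e 0%N = 0 -> (forall k, 0 <= e k) ->
  (forall k, e k.+1 <= K * (M * rho ^+ k.+1 + \sum_(i < k.+2) e i * e (k.+1 - i)%N)) ->
  exists A B, [/\ 0 <= A, 0 <= B & forall k, e k <= A * B ^+ k].
Proof.
move=> K0 M0 r0 e0 ege He.
(* For [tau = 1 / D] the summands of [D] give [4 * K^2 * m <= 1], so that
   [K * m + K * (2 * K * m)^2 <= 2 * K * m], and [rho * tau <= 1/2], so that the geometric sum is at
   most twice its first term; the last summand makes [D] positive. *)
set D := 8 * K ^+ 2 * M * rho + 2 * rho + 1.
have D1 : 1 <= D.
  by rewrite /D lerDr addr_ge0 // ?mulr_ge0 // ?exprn_ge0.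
have D0 : 0 < D by apply: lt_le_trans D1.
pose tau := D^-1.
have t0 : 0 < tau by rewrite invr_gt0.
have rt0 : 0 <= rho * tau by rewrite mulr_ge0 // ltW.
have rth : rho * tau <= 2^-1.
  rewrite /tau ler_pdivrMr // /D.
  have : 0 <= 8 * K ^+ 2 * M * rho by rewrite !mulr_ge0 // ?exprn_ge0.
  by move: (8 * _) => z; nra.
pose m := 2 * M * (rho * tau).
have m0 : 0 <= m by rewrite /m !mulr_ge0 // ltW.
have Km : 4 * K ^+ 2 * m <= 1.
  have -> : 4 * K ^+ 2 * m = (8 * K ^+ 2 * M * rho) / D by rewrite /m /tau; ring.
  by rewrite ler_pdivrMr // mul1r /D -addrA lerDl addr_ge0 // mulr_ge0.
pose S n := \sum_(k < n) e k * tau ^+ k.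
have S0 n : 0 <= S n by apply: sumr_ge0 => i _; rewrite mulr_ge0 // exprn_ge0 // ltW.
have Srec n : S n.+1 <= K * m + K * S n ^+ 2.
  rewrite /S big_ord_recl e0 mul0r add0r.
  pose U : {poly R} := \poly_(i < n) (e i * tau ^+ i).
  have U0 i : 0 <= U`_i.
    by rewrite coef_poly; case: ifP => // _; rewrite mulr_ge0 // exprn_ge0 // ltW.
  apply: (@le_trans _ _ (\sum_(k < n) (K * M * (rho * tau) ^+ k.+1 + K * (U * U)`_k.+1))).
    apply: ler_sum => k _ /=.
    apply: (@le_trans _ _ (K * (M * rho ^+ k.+1 + \sum_(i < k.+2) e i * e (k.+1 - i)%N) * tau ^+ k.+1)).
      by rewrite ler_wpM2r // exprn_ge0 // ltW.
    rewrite mulrDr mulrDl exprMn !mulrA lerD2l -mulrA ler_wpM2l // coefM mulr_suml.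
    apply: ler_sum => i _; rewrite !coef_poly.
    have [i0|i0] := posnP i; first by rewrite i0 e0 !mul0r; case: ifP => _; rewrite mul0r.
    have [ik|ik] := eqVneq (i : nat) k.+1.
      by rewrite ik subnn e0 mulr0 mul0r /=; case: (0 < n)%N; rewrite ?mul0r ?mulr0.
    have h1 : (i <= k.+1)%N by rewrite -ltnS.
    have -> : (i < n)%N by move: (ltn_ord k); lia.
    have -> : (k.+1 - i < n)%N by move: (ltn_ord k); lia.
    by rewrite (exprn_split tau h1); apply: eq_le_r; ring.
  rewrite big_split /= -!mulr_sumr; apply: lerD.
    rewrite -mulrA ler_wpM2l //.
    apply: (@le_trans _ _ (M * (2 * (rho * tau)))).
      by rewrite ler_wpM2l // sum_geom_half.
    by rewrite /m; apply: eq_le_r; ring.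
  have -> : \sum_(i < n) e i * tau ^+ i = U.[1] by rewrite horner1_poly.
  rewrite ler_wpM2l // expr2.
  apply: le_trans (sum_coefM_le n.+1 U0 U0).
  rewrite big_ord_recl lerDr coefM sumr_ge0 // => i _.
  by rewrite mulr_ge0.
have Sb n : S n <= 2 * K * m.
  elim: n => [|n IH]; first by rewrite /S big_ord0; apply: mulr_ge0 => //; apply: mulr_ge0.
  apply: le_trans (Srec n) _.
  have h0 : 0 <= 2 * K * m by apply: mulr_ge0 => //; apply: mulr_ge0.
  have : S n ^+ 2 <= (2 * K * m) ^+ 2 by apply: lerXn2r; rewrite ?nnegrE ?S0.
  move=> /(ler_wpM2l K0) h; apply: le_trans (lerD (lexx _) h) _.
  have -> : K * m + K * (2 * K * m) ^+ 2 = K * m * (1 + 4 * K ^+ 2 * m) by ring.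
  have : 0 <= K * m by apply: mulr_ge0.
  by rewrite -(mulrA 2); move: (4 * _ * m) Km => z hz; move: (K * m) => w; nra.
exists (2 * K * m), D; split; [by apply: mulr_ge0 => //; apply: mulr_ge0|exact: ltW|move=> k].
have h : e k * tau ^+ k <= 2 * K * m.
  apply: le_trans (Sb k.+1); rewrite /S big_ord_recr /= lerDr.
  exact: S0.
rewrite -[D]invrK -/tau exprVn -ler_pdivrMr ?invr_gt0 ?exprn_gt0 // invrK.
exact: h.
Qed.

(** The l1-norm of the coefficients with weight [rho^i], which is submultiplicative. The weight is
    left free because division with bounds works when the leading term of the divisor dominates,
    that is for large [rho]. *)
Definition pnw (rho : R) (p : {poly C}) : R := \sum_(i < size p) nm p`_i * rho ^+ i.

Lemma pnw_widen rho (p : {poly C}) n : (size p <= n)%N ->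
  pnw rho p = \sum_(i < n) nm p`_i * rho ^+ i.
Proof.
move=> le_pn; rewrite /pnw (big_ord_widen _ (fun i => nm p`_i * rho ^+ i) le_pn).
rewrite big_mkcond /=; apply: eq_bigr => i _; case: ltnP => // h.
by rewrite nth_default // nm0 mul0r.
Qed.

Section Weighted.
Variable rho : R.
Hypothesis rho0 : 0 <= rho.
Local Notation N := (pnw rho).
Implicit Types p q : {poly C}.

Lemma pnw_ge0 p : 0 <= N p.
Proof. by apply: sumr_ge0 => i _; rewrite mulr_ge0 ?nm_ge0 ?exprn_ge0. Qed.
Lemma pnw0 : N 0 = 0. Proof. by rewrite /pnw size_poly0 big_ord0. Qed.
Lemma pnwN p : N (- p) = N p.
Proof. by rewrite /pnw size_polyN; apply: eq_bigr => i _; rewrite coefN nmN. Qed.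
Lemma pnwD p q : N (p + q) <= N p + N q.
Proof.
set n := (size p + size q + size (p + q)%R)%N.
rewrite !(@pnw_widen rho _ n) /n; try lia.
rewrite -big_split /=; apply: ler_sum => i _.
by rewrite -mulrDl ler_wpM2r ?exprn_ge0 // coefD nmD.
Qed.
Lemma pnw_sum I (r : seq I) (P : pred I) (F : I -> {poly C}) :
  N (\sum_(i <- r | P i) F i) <= \sum_(i <- r | P i) N (F i).
Proof.
elim/big_rec2: _ => [|i x y _ IH]; first by rewrite pnw0.
by apply: le_trans (pnwD _ _) _; rewrite lerD2l.
Qed.
Lemma pnwM p q : N (p * q) <= N p * N q.
Proof.
set n := (size p + size q + size (p * q)%R)%N.
rewrite !(@pnw_widen rho _ n) /n; try lia.
rewrite -/n.
apply: le_trans (sum_conv_le (u := fun i => nm p`_i * rho ^+ i) (v := fun i => nm q`_i * rho ^+ i) n _ _).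
- apply: ler_sum => k _; rewrite coefM.
  apply: le_trans (ler_wpM2r _ (nm_sum _ _ _)) _; first exact: exprn_ge0.
  rewrite mulr_suml; apply: ler_sum => i _.
  have h1 : (i <= k)%N by rewrite -ltnS.
  by rewrite (exprn_split rho h1) nmM; apply: eq_le_r; ring.
- by move=> i; rewrite mulr_ge0 ?nm_ge0 ?exprn_ge0.
- by move=> i; rewrite mulr_ge0 ?nm_ge0 ?exprn_ge0.
Qed.
Lemma nm_coef_pnw p i : nm p`_i * rho ^+ i <= N p.
Proof.
rewrite (@pnw_widen _ _ (i.+1 + size p)) ?leq_addl //.
rewrite (bigD1 (Ordinal (leq_addr (size p) i.+1))) //= lerDl sumr_ge0 // => j _.
by rewrite mulr_ge0 ?nm_ge0 ?exprn_ge0.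
Qed.
Lemma nm_horner_pnw p (x : C) : nm x <= rho -> nm p.[x] <= N p.
Proof.
move=> hx; rewrite horner_coef; apply: le_trans (nm_sum _ _ _) _.
apply: ler_sum => i _; rewrite nmM nmX ler_wpM2l ?nm_ge0 //.
by rewrite lerXn2r ?nnegrE ?nm_ge0.
Qed.
Lemma pnwZ c p : N (c *: p) = nm c * N p.
Proof.
rewrite (@pnw_widen _ _ (size p)) ?size_scale_leq // /pnw mulr_sumr.
by apply: eq_bigr => i _; rewrite coefZ nmM mulrA.
Qed.
End Weighted.

Definition geo (T : Type) (N : T -> R) (u : nat -> T) : Prop :=
  exists M rho, [/\ 0 <= M, 0 <= rho & forall k, N (u k) <= M * rho ^+ k].

Definition convP (u : fps C) : Prop := geo nm u.

Lemma geo_le (T : Type) (N : T -> R) (u : nat -> T) M rho M' rho' :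
  0 <= M -> 0 <= rho -> M <= M' -> rho <= rho' ->
  (forall k, N (u k) <= M * rho ^+ k) -> (forall k, N (u k) <= M' * rho' ^+ k).
Proof.
move=> M0 r0 MM rr H k; apply: le_trans (H k) _; apply: ler_pM => //; first exact: exprn_ge0.
by rewrite lerXn2r ?nnegrE // (le_trans r0).
Qed.

Definition convs : {pred fps C} := [pred u | `[< convP u >]].
Lemma convsP u : reflect (convP u) (u \in convs). Proof. exact: asboolP. Qed.

Lemma convs_const c : fpsC c \in convs.
Proof.
apply/convsP; exists (nm c), 1; split; rewrite ?nm_ge0 // => -[|k] /=.
  by rewrite mulr1.
by rewrite nm0 mulr_ge0 ?nm_ge0 ?exprn_ge0.
Qed.

Lemma convs_subring : subring_closed convs.
Proof.
split.
- exact: convs_const.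
- move=> u v /convsP[M [r [M0 r0 H]]] /convsP[M' [r' [M0' r0' H']]].
  apply/convsP; exists (M + M'), (r + r'); split; rewrite ?addr_ge0 // => k.
  rewrite fpsEB; apply: le_trans (nmD _ _) _; rewrite nmN mulrDl; apply: lerD.
    by apply: (geo_le M0 r0 _ _ H) => //; rewrite lerDl.
  by apply: (geo_le M0' r0' _ _ H') => //; rewrite lerDr.
- move=> u v /convsP[M [r [M0 r0 H]]] /convsP[M' [r' [M0' r0' H']]].
  (* The factor 2 pays for the [k + 1] products in coefficient [k], since [k + 1 <= 2^k]. *)
  apply/convsP; exists (M * M'), (2 * (r + r')); split; rewrite ?mulr_ge0 ?addr_ge0 // => k.
  rewrite fpsEM; apply: le_trans (nm_sum _ _ _) _.
  apply: (@le_trans _ _ (\sum_(i < k.+1) M * M' * (r + r') ^+ k)).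
    apply: ler_sum => i _; rewrite nmM.
    have h1 : (i <= k)%N by rewrite -ltnS.
    rewrite (exprn_split (r + r') h1).
    have := geo_le M0 r0 (lexx _) (_ : r <= r + r') H i; rewrite lerDl => /(_ r0') h.
    have := geo_le M0' r0' (lexx _) (_ : r' <= r + r') H' (k - i)%N; rewrite lerDr => /(_ r0) h'.
    by apply: le_trans (ler_pM (nm_ge0 _) (nm_ge0 _) h h') _; apply: eq_le_r; ring.
  rewrite sumr_const card_ord exprMn -mulrA -[X in X <= _]mulr_natr -!mulrA.
  do 2 (apply: ler_wpM2l => //).
  rewrite mulrC; apply: ler_wpM2r; first by rewrite exprn_ge0 // addr_ge0.
  by rewrite -natrX ler_nat ltn_expl.
Qed.
HB.instance Definition _ := GRing.isSubringClosed.Build (fps C) convs convs_subring.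

Lemma convs_stretch N u : u \in convs -> stretch N u \in convs.
Proof.
move=> /convsP[M [r [M0 r0 H]]]; apply/convsP; exists M, (r + 1); split; rewrite ?addr_ge0 // => k.
rewrite stretchE; case: ifP => dv; last by rewrite nm0 mulr_ge0 // exprn_ge0 // addr_ge0.
apply: (@le_trans _ _ (M * (r + 1) ^+ (k %/ N.+1))).
  by apply: (geo_le M0 r0 _ _ H) => //; rewrite lerDl.
by rewrite ler_wpM2l // ler_weXn2l ?lerDr // leq_div.
Qed.

Lemma convs_dropu n u : u \in convs -> dropu n u \in convs.
Proof.
move=> /convsP[M [r [M0 r0 H]]]; apply/convsP; exists (M * r ^+ n), r; split; rewrite ?mulr_ge0 ?exprn_ge0 // => k.
by rewrite -mulrA -exprD addnC; exact: H.
Qed.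

Lemma convs_tX : @tX C \in convs.
Proof.
apply/convsP; exists 1, 1; split => // k; rewrite expr1n mulr1 /=.
by case: eqP; rewrite ?nm1 ?nm0.
Qed.

End Majorants.

(** * Hensel's lemma *)

Section Hensel.
Variable R : rcfType.
Local Notation C := R[i].
Local Notation nm := (@ComplexField.Normc.normc R).

(** [build n] is a table whose entries up to [n] never change later, so its diagonal satisfies the
    recursion; the hypothesis on [step] says that it reads only entries already fixed. *)
Lemma course_of_values (T : Type) (x0 : T) (step : nat -> (nat -> T) -> T) :
  (forall k u v, (forall i, (i <= k)%N -> u i = v i) -> step k u = step k v) ->
  exists u : nat -> T, u 0%N = x0 /\ forall k, u k.+1 = step k u.
Proof.
move=> stepE.
pose fix build (n : nat) : nat -> T := match n with
  | 0 => fun _ => x0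
  | n'.+1 => fun i => if (i <= n')%N then build n' i else step n' (build n')
  end.
have buildS n i : (i <= n)%N -> build n.+1 i = build n i by move=> h /=; rewrite h.
have buildD d n i : (i <= n)%N -> build (n + d)%N i = build n i.
  move=> h; elim: d => [|d IH]; first by rewrite addn0.
  by rewrite addnS buildS // (leq_trans h) // leq_addr.
exists (fun n => build n n); split=> // k /=; rewrite ltnn.
by apply: stepE => i le_ik; rewrite -{1}(subnKC le_ik) buildD.
Qed.

Lemma sum_conv_ends (A : pzRingType) (u v : nat -> A) k :
  \sum_(i < k.+2) u i * v (k.+1 - i)%N =
  u 0%N * v k.+1 + \sum_(i < k) u i.+1 * v (k - i)%N + u k.+1 * v 0%N.
Proof.
rewrite big_ord_recr big_ord_recl /= subnn subn0; congr (_ + _ + _).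
Qed.

(** Comparing coefficients of [t^(k+1)] in [F = p * q] leaves a linear equation for [p_(k+1)] and
    [q_(k+1)] whose right-hand side contains only earlier coefficients. Its solvability, with bounds
    on degrees and norms, is a hypothesis, so that the lemma covers preparation, where the degree
    bounds [b] and [c] grow with [k], as well as coprime factors, where they are constant. The
    condition on [a], [b], [c] keeps the products of earlier coefficients within the degree allowed
    for the right-hand side. *)
Lemma hensel_lift (rho K : R) (F : nat -> {poly C}) (p0 q0 : {poly C})
    (a : nat) (b c : nat -> nat) :
  0 <= rho -> 0 <= K -> F 0%N = p0 * q0 -> geo (pnw rho) F ->
  (forall k, (size (F k.+1) <= c k.+1)%N) ->
  (forall i j, (a + b j.+1 <= (c (i + j).+2).+1)%N) ->
  (forall k (r : {poly C}), (size r <= c k.+1)%N -> exists p q : {poly C},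
     [/\ p * q0 + p0 * q = r, (size p <= a)%N, (size q <= b k.+1)%N,
         pnw rho p <= K * pnw rho r & pnw rho q <= K * pnw rho r]) ->
  exists p q : nat -> {poly C},
    [/\ p 0%N = p0 /\ q 0%N = q0, forall k, F k = \sum_(i < k.+1) p i * q (k - i)%N,
        forall k, (size (p k.+1) <= a)%N /\ (size (q k.+1) <= b k.+1)%N,
        geo (pnw rho) p & geo (pnw rho) q].
Proof.
move=> rho0 K0 F0 [M [r0 [M0 r00 HF]]] Fc abc solve.
have /choice[S HS] : forall kr : nat * {poly C}, exists pq : {poly C} * {poly C},
    (size kr.2 <= c kr.1.+1)%N ->
    [/\ pq.1 * q0 + p0 * pq.2 = kr.2, (size pq.1 <= a)%N, (size pq.2 <= b kr.1.+1)%N,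
         pnw rho pq.1 <= K * pnw rho kr.2 & pnw rho pq.2 <= K * pnw rho kr.2].
  move=> [k r] /=; have [h|h] := boolP (size r <= c k.+1)%N.
    by have [p [q H]] := solve k r h; exists (p, q).
  by exists (0, 0) => h'; case/negP: h.
pose rem k (u : nat -> {poly C} * {poly C}) :=
  F k.+1 - \sum_(i < k) (u i.+1).1 * (u (k - i)%N).2.
have stepE k u v : (forall i, (i <= k)%N -> u i = v i) -> S (k, rem k u) = S (k, rem k v).
  move=> E; congr (S (_, _)); rewrite /rem; congr (_ - _).
  by apply: eq_bigr => i _; rewrite !E // ?leq_subr.
have [u [u0 uS]] := course_of_values (p0, q0) stepE.
have sz : forall k, (size (u k.+1).1 <= a)%N /\ (size (u k.+1).2 <= b k.+1)%N /\
   (size (rem k u) <= c k.+1)%N.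
  elim/ltn_ind => k IH.
  have szr : (size (rem k u) <= c k.+1)%N.
    rewrite /rem; apply: leq_trans (size_polyD _ _) _; rewrite geq_max Fc /= size_polyN.
    apply: leq_trans (size_sum _ _ _) _; apply/bigmax_leqP => i _.
    apply: leq_trans (size_polyMleq _ _) _.
    have [j Ej] : exists j, (k - i = j.+1)%N by exists (k - i).-1; move: (ltn_ord i); lia.
    have [h1 _] := IH i (ltn_ord i).
    have [_ [h2 _]] : (size (u j.+1).1 <= a)%N /\ (size (u j.+1).2 <= b j.+1)%N /\
        (size (rem j u) <= c j.+1)%N by apply: IH; lia.
    have := abc i j; have -> : (i + j).+2 = k.+1 by move: (ltn_ord i); lia.
    rewrite Ej => h3; rewrite -subn1 leq_subLR add1n; apply: leq_trans h3.
    exact: leq_add.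
  by rewrite uS; have [_ ? ? _ _] := HS (k, rem k u) szr.
have szrem k : (size (rem k u) <= c k.+1)%N by have [_ [_ ?]] := sz k.
have HSk k := HS (k, rem k u) (szrem k).
(* [e 0 = 0] although [p0] and [q0] are not small: the two end terms of the convolution carry the
   unknowns of the linear equation, so only indices from 1 on enter the recursion. *)
pose e k : R := if k is _.+1 then pnw rho (u k).1 + pnw rho (u k).2 else 0.
have e0 k : 0 <= e k by case: k => [|k] //=; rewrite addr_ge0 // pnw_ge0.
have [A [B [A0 B0 HAB]]] : exists A B, [/\ 0 <= A, 0 <= B & forall k, e k <= A * B ^+ k].
  apply: (@quadratic_majorant _ e (K *+ 2) M r0) => //; first by rewrite mulrn_wge0.
  move=> k; rewrite sum_conv_ends /= !mul0r mulr0 add0r addr0.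
  have [_ _ _ h1 h2] := HSk k; rewrite -uS /= in h1 h2.
  apply: le_trans (lerD h1 h2) _; rewrite -mulr2n -mulrnAl ler_wpM2l ?mulrn_wge0 //.
  rewrite /rem; apply: le_trans (pnwD rho0 _ _) _; apply: lerD => //.
  rewrite pnwN; apply: le_trans (pnw_sum rho0 _ _ _) _; apply: ler_sum => i _.
  apply: le_trans (pnwM rho0 _ _) _; have := ltn_ord i.
  case Ej : (k - i)%N => [|j] hi; first lia.
  by apply: ler_pM; rewrite ?pnw_ge0 //= ?lerDl ?lerDr ?pnw_ge0.
exists (fun k => (u k).1), (fun k => (u k).2); split.
- by rewrite u0.
- case=> [|k]; first by rewrite big_ord1 /= u0.
  rewrite (sum_conv_ends (fun i => (u i).1) (fun i => (u i).2)) u0 /=.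
  have [h _ _ _ _] := HSk k; rewrite -uS /= in h.
  by rewrite [X in X + _]addrC -addrA [X in _ + X]addrC h /rem addrC subrK.
- by move=> k; have [? [? _]] := sz k.
- exists (A + pnw rho p0), B; split; rewrite ?addr_ge0 ?pnw_ge0 // => -[|k].
    by rewrite u0 /= mulr1 lerDr.
  rewrite mulrDl; apply: ler_wpDr; first by rewrite mulr_ge0 ?pnw_ge0 ?exprn_ge0.
  by apply: le_trans (HAB k.+1); rewrite /= lerDl pnw_ge0.
- exists (A + pnw rho q0), B; split; rewrite ?addr_ge0 ?pnw_ge0 // => -[|k].
    by rewrite u0 /= mulr1 lerDr.
  rewrite mulrDl; apply: ler_wpDr; first by rewrite mulr_ge0 ?pnw_ge0 ?exprn_ge0.
  by apply: le_trans (HAB k.+1); rewrite /= lerDr pnw_ge0.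
Qed.

End Hensel.

(** * Preparation *)

Section Factorizations.
Variable R : rcfType.
Local Notation C := R[i].
Local Notation nm := (@ComplexField.Normc.normc R).

Lemma pnw_take_drop rho m (r : {poly C}) :
  pnw rho r = pnw rho (take_poly m r) + rho ^+ m * pnw rho (drop_poly m r).
Proof.
rewrite (@pnw_widen _ rho r (m + size r)) ?leq_addl //.
rewrite (@pnw_widen _ _ (take_poly m r) m) ?size_take_poly //.
rewrite (@pnw_widen _ _ (drop_poly m r) (size r)) ?size_drop_poly ?leq_subr //.
rewrite big_split_ord /=; congr (_ + _).
  by apply: eq_bigr => i _; rewrite coef_take_poly ltn_ord.
rewrite mulr_sumr; apply: eq_bigr => i _.
by rewrite coef_drop_poly addnC exprD; ring.
Qed.

(** Divides by ['X^m] instead and corrects: if [r = t + d * 'X^m], the new dividend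
    [t - (p0 - 'X^m) * d] has smaller size. Of the norm [rho^m * N d] of the split-off part, one
    half bounds the correction and the other half pays for [d] in the quotient. *)
Lemma weighted_division rho m (p0 : {poly C}) : 0 <= rho ->
  p0 \is monic -> size p0 = m.+1 -> pnw rho (p0 - 'X^m) <= rho ^+ m / 2 ->
  forall r : {poly C}, exists p q : {poly C},
    [/\ r = p + p0 * q, (size p <= m)%N, (size q <= size r - m)%N
      & pnw rho p + rho ^+ m / 2 * pnw rho q <= pnw rho r].
Proof.
move=> rho0 p0m sp0 small r.
have [n] := ubnP (size r); elim: n r => // n IH r; rewrite ltnS => szr.
have [le_rm|lt_mr] := leqP (size r) m.
  exists r, 0; split; rewrite ?mulr0 ?addr0 ?size_poly0 //.
  by rewrite pnw0 mulr0 addr0.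
set t := take_poly m r; set d := drop_poly m r.
have Er : r = t + d * 'X^m by rewrite poly_take_drop.
set r1 := t - (p0 - 'X^m) * d.
have sd : (size d <= size r - m)%N by rewrite size_drop_poly.
have sX : (size (p0 - 'X^m)%R <= m)%N.
  apply/leq_sizeP => j hj; rewrite coefB coefXn.
  move: hj; rewrite leq_eqVlt => /orP[/eqP <-|hj].
    by rewrite eqxx; move/monicP: p0m; rewrite lead_coefE sp0 /= => ->; rewrite subrr.
  by rewrite nth_default ?sp0 // gtn_eqF // subrr.
have sr1 : (size r1 < size r)%N.
  apply: leq_ltn_trans (size_polyD _ _) _; rewrite gtn_max size_polyN.
  apply/andP; split; first by apply: leq_ltn_trans (size_take_poly _ _) _.
  apply: leq_ltn_trans (size_polyMleq _ _) _.
  by move: sX sd lt_mr; move: (size _) (size _) (size _) => a b c; lia.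
have [p [q [E1 sp sq N1]]] := IH r1 (leq_trans sr1 szr).
exists p, (q + d); split => //.
- by rewrite mulrDr addrA -E1 {1}Er /r1; ring.
- apply: leq_trans (size_polyD _ _) _; rewrite geq_max sd andbT.
  apply: leq_trans sq _; lia.
have rm0 : 0 <= rho ^+ m / 2 by rewrite divr_ge0 // exprn_ge0.
apply: le_trans (lerD (lexx _) (ler_wpM2l rm0 (pnwD rho0 _ _))) _.
rewrite mulrDr addrA; apply: le_trans (lerD N1 (lexx _)) _.
rewrite (pnw_take_drop rho m r) -/t -/d.
have h1 : pnw rho r1 <= pnw rho t + rho ^+ m / 2 * pnw rho d.
  apply: le_trans (pnwD rho0 _ _) _; rewrite lerD2l pnwN.
  apply: le_trans (pnwM rho0 _ _) _.
  by rewrite ler_wpM2r // pnw_ge0.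
apply: le_trans (lerD h1 (lexx _)) _.
rewrite -addrA lerD2l -mulrDl -splitr //.
Qed.

Lemma pnw_le_pnw1 rho (p : {poly C}) n : 1 <= rho -> (size p <= n.+1)%N ->
  pnw rho p <= rho ^+ n * pnw 1 p.
Proof.
move=> r1 sp; rewrite /pnw mulr_sumr; apply: ler_sum => i _.
rewrite expr1n mulr1 mulrC ler_wpM2r ?nm_ge0 // ler_weXn2l //.
by rewrite -ltnS; apply: leq_trans sp; apply: ltn_ord.
Qed.

Lemma pnw1_le_pnw rho (p : {poly C}) : 1 <= rho -> pnw 1 p <= pnw rho p.
Proof.
move=> r1; rewrite /pnw; apply: ler_sum => i _.
by rewrite expr1n ler_wpM2l ?nm_ge0 // exprn_ege1.
Qed.

Lemma monic_subXn_size (A : nzRingType) (p0 : {poly A}) m :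
  p0 \is monic -> size p0 = m.+1 -> (size (p0 - 'X^m)%R <= m)%N.
Proof.
move=> p0m sp0; apply/leq_sizeP => j hj; rewrite coefB coefXn.
move: hj; rewrite leq_eqVlt => /orP[/eqP <-|hj].
  by rewrite eqxx; move/monicP: p0m; rewrite lead_coefE sp0 /= => ->; rewrite subrr.
by rewrite nth_default ?sp0 // gtn_eqF // subrr.
Qed.

(** Passing to a larger weight multiplies the norm of [F k] by at most [rho^(m + k)]; as the degree
    grows only linearly in [k], geometric bounds survive. *)
Lemma geo_pnw_widen rho (F : nat -> {poly C}) m : 1 <= rho ->
  (forall k, (size (F k) <= (m + k).+1)%N) -> geo (pnw 1) F -> geo (pnw rho) F.
Proof.
move=> r1 sF [M [r [M0 r0 HF]]].
have rho0 : 0 <= rho by apply: le_trans r1.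
exists (rho ^+ m * M), (rho * r); split; rewrite ?mulr_ge0 ?exprn_ge0 // => k.
apply: le_trans (pnw_le_pnw1 r1 (sF k)) _.
rewrite exprD -!mulrA ler_wpM2l ?exprn_ge0 // exprMn mulrCA.
by rewrite ler_wpM2l ?exprn_ge0.
Qed.

Lemma geo_pnw1 rho (F : nat -> {poly C}) : 1 <= rho -> geo (pnw rho) F -> geo (pnw 1) F.
Proof.
move=> r1 [M [r [M0 r0 HF]]]; exists M, r; split => // k.
exact: le_trans (pnw1_le_pnw _ r1) (HF k).
Qed.

(** One factor of [F 0] is the constant [lc], so the linear equation of [hensel_lift] is division
    with remainder by [p0]. With [F k] the part of degree [m + 1 + k] of a germ, written in
    [z = x / y], this is Weierstrass preparation: [p] is a monic polynomial in [z] and [q] the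
    unit. *)
Lemma preparation (F : nat -> {poly C}) m :
  size (F 0%N) = m.+2 -> (forall k, (size (F k) <= (m.+1 + k).+1)%N) -> geo (pnw 1) F ->
  exists p q : nat -> {poly C},
    [/\ p 0%N \is monic /\ size (p 0%N) = m.+2,
        exists2 c, c != 0 & q 0%N = c%:P,
        forall k, F k = \sum_(i < k.+1) p i * q (k - i)%N,
        forall k, (size (p k.+1) <= m.+1)%N /\ (size (q k) <= k.+1)%N &
        geo (pnw 1) p /\ geo (pnw 1) q].
Proof.
move=> sF0 sF HF.
set lc := lead_coef (F 0%N).
have lc0 : lc != 0 by rewrite lead_coef_eq0 -size_poly_eq0 sF0.
pose p0 : {poly C} := lc^-1 *: F 0%N.
have sp0 : size p0 = m.+2 by rewrite size_scale ?invr_eq0.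
have p0m : p0 \is monic by rewrite monicE lead_coefZ mulVf.
have F0E : F 0%N = p0 * lc%:P.
  by rewrite mulrC mul_polyC scalerA divff // scale1r.
(* Large enough that ['X^(m+1)] has at least twice the weighted norm of the other terms of [p0]. *)
pose rho := 2 * pnw 1 (p0 - 'X^(m.+1))%R + 1.
have N0 : 0 <= pnw 1 (p0 - 'X^(m.+1))%R by rewrite pnw_ge0 ?ler01.
have rho1 : 1 <= rho by rewrite /rho lerDr mulr_ge0.
have rho0 : 0 <= rho by apply: le_trans rho1.
have small : pnw rho (p0 - 'X^(m.+1))%R <= rho ^+ m.+1 / 2.
  apply: le_trans (pnw_le_pnw1 rho1 (monic_subXn_size p0m sp0)) _.
  have -> : rho ^+ m.+1 / 2 = rho ^+ m * (rho / 2) by rewrite exprSr mulrA.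
  by rewrite ler_wpM2l ?exprn_ge0 // /rho; lra.
(* [nm lc^-1] serves [p], where the remainder is divided by [lc]; the 2 serves [q], since
   [rho^(m+1) / 2 >= 1/2]. *)
pose K := nm lc^-1 + 2.
have K0 : 0 <= K by rewrite addr_ge0 ?nm_ge0.
have abc i j : (m.+1 + j.+2 <= (m.+1 + (i + j).+2).+2)%N by lia.
have sol k (r : {poly C}) : (size r <= (m.+1 + k.+1).+1)%N -> exists p q : {poly C},
    [/\ p * lc%:P + p0 * q = r, (size p <= m.+1)%N, (size q <= k.+2)%N,
        pnw rho p <= K * pnw rho r & pnw rho q <= K * pnw rho r].
  move=> sr; have [r' [q [Er sr' sq Nq]]] := weighted_division rho0 p0m sp0 small r.
  have Nr' : pnw rho r' <= pnw rho r.
    apply: le_trans Nq; rewrite lerDl mulr_ge0 ?pnw_ge0 // divr_ge0 ?exprn_ge0 //.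
  have Nq' : pnw rho q <= 2 * pnw rho r.
    have h1 : 2^-1 * pnw rho q <= pnw rho r.
      apply: le_trans Nq; rewrite -[X in X <= _]add0r; apply: lerD; first exact: pnw_ge0.
      rewrite ler_wpM2r ?pnw_ge0 //.
      by have : 1 <= rho ^+ m.+1 by [rewrite exprn_ege1]; lra.
    by have := pnw_ge0 rho0 q; lra.
  exists (lc^-1 *: r'), q; split.
  + by rewrite mulrC mul_polyC scalerA divff // scale1r Er.
  + by rewrite size_scale ?invr_eq0.
  + by apply: leq_trans sq _; rewrite leq_subLR; apply: leq_trans sr _; lia.
  + rewrite pnwZ // /K mulrDl; apply: ler_wpDr; first by rewrite mulr_ge0 ?pnw_ge0.
    by rewrite ler_wpM2l ?nm_ge0.
  + rewrite /K mulrDl; apply: ler_wpDl; first by rewrite mulr_ge0 ?pnw_ge0 ?nm_ge0.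
    exact: Nq'.
have [p [q [[Ep Eq] EF sz gp gq]]] := @hensel_lift _ rho K F p0 lc%:P m.+1 (fun k => k.+1)
  (fun k => (m.+1 + k).+1) rho0 K0 F0E (geo_pnw_widen rho1 sF HF) (fun k => sF k.+1) abc sol.
exists p, q; split.
- by rewrite Ep.
- by exists lc.
- exact: EF.
- move=> k; have [h1 _] := sz k; split=> //; case: k {h1} => [|k].
    by rewrite Eq size_polyC; case: eqP.
  by have [_ h] := sz k; apply: leq_trans h _; lia.
- by split; apply: (geo_pnw1 rho1).
Qed.

End Factorizations.

(** * Tschirnhaus transformation and scaling of the roots *)

Section Puiseux.
Variable R : rcfType.
Local Notation C := R[i].
Local Notation nm := (@ComplexField.Normc.normc R).

(** Bezout and reduction modulo [p0] give a solution of the right degrees but no bound on its norm.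
    Fixing solutions for the finitely many monomials ['X^i] and extending linearly yields a constant
    [K] independent of [r]. *)
Lemma coprime_solver (p0 q0 : {poly C}) m n :
  size p0 = m.+1 -> size q0 = n.+1 -> coprimep p0 q0 ->
  exists2 K : R, 0 <= K &
  forall r : {poly C}, (size r <= m + n)%N -> exists p q : {poly C},
     [/\ p * q0 + p0 * q = r, (size p <= m)%N, (size q <= n)%N,
         pnw 1 p <= K * pnw 1 r & pnw 1 q <= K * pnw 1 r].
Proof.
move=> sp0 sq0 /Bezout_eq1_coprimepP[[u v] /= uv].
have p00 : p0 != 0 by rewrite -size_poly_eq0 sp0.
have q00 : q0 != 0 by rewrite -size_poly_eq0 sq0.
have sol1 (r : {poly C}) : (size r <= m + n)%N -> exists p q : {poly C},
     [/\ p * q0 + p0 * q = r, (size p <= m)%N & (size q <= n)%N].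
  move=> sr; pose p := (r * v) %% p0; pose q := r * u + (r * v) %/ p0 * q0.
  have E : p * q0 + p0 * q = r.
    transitivity (r * (u * p0 + v * q0)); last by rewrite uv mulr1.
    have := divp_eq (r * v) p0; rewrite -/p /q; move: p (_ %/ _) => p d D.
    have -> : r * (u * p0 + v * q0) = r * u * p0 + (r * v) * q0 by ring.
    by rewrite D; ring.
  have sp : (size p <= m)%N by rewrite -ltnS -sp0 ltn_modp.
  exists p, q; split => //.
  have [->|q_neq0] := eqVneq q 0; first by rewrite size_poly0.
  have : (size (p0 * q)%R <= m + n)%N.
    have -> : p0 * q = r - p * q0 by rewrite -E addrC addKr.
    apply: leq_trans (size_polyD _ _) _; rewrite geq_max sr size_polyN.
    apply: leq_trans (size_polyMleq _ _) _; rewrite sq0 addnS /=.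
    by rewrite leq_add2r.
  by rewrite size_mul // sp0 addSn /= leq_add2l.
have /choice[s Hs] : forall i, exists s : {poly C} * {poly C}, (i < m + n)%N ->
   [/\ s.1 * q0 + p0 * s.2 = 'X^i, (size s.1 <= m)%N & (size s.2 <= n)%N].
  move=> i; have [lt_i|ge_i] := ltnP i (m + n); last by exists (0, 0).
  by have [|p [q H]] := sol1 'X^i; [rewrite size_polyXn|exists (p, q)].
exists (\sum_(i < m + n) (pnw 1 (s i).1 + pnw 1 (s i).2)).
  by apply: sumr_ge0 => i _; rewrite addr_ge0 ?pnw_ge0.
move=> r sr.
exists (\sum_(i < m + n) r`_i *: (s i).1), (\sum_(i < m + n) r`_i *: (s i).2).
have bound (g : {poly C} * {poly C} -> {poly C}) :
   (forall i, pnw 1 (g (s i)) <= pnw 1 (s i).1 + pnw 1 (s i).2) ->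
   pnw 1 (\sum_(i < m + n) r`_i *: g (s i)) <=
   (\sum_(i < m + n) (pnw 1 (s i).1 + pnw 1 (s i).2)) * pnw 1 r.
  move=> Hg; apply: le_trans (pnw_sum ler01 _ _ _) _; rewrite mulr_suml.
  apply: ler_sum => i _; rewrite pnwZ ?ler01 // mulrC.
  apply: ler_pM; rewrite ?pnw_ge0 ?nm_ge0 ?ler01 //.
  by have := nm_coef_pnw ler01 r i; rewrite expr1n mulr1.
split.
- rewrite mulr_suml mulr_sumr -big_split /=.
  rewrite -[r in RHS]coefK (poly_def _ _); rewrite (big_ord_widen _ (fun i => r`_i *: 'X^i) sr).
  rewrite [in RHS]big_mkcond /=; apply: eq_bigr => i _.
  have [Ei _ _] := Hs i (ltn_ord i).
  rewrite -scalerAl -scalerAr -scalerDr Ei; case: ltnP => // h.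
  by rewrite nth_default // scale0r.
- apply: leq_trans (size_sum _ _ _) _; apply/bigmax_leqP => i _.
  by apply: leq_trans (size_scale_leq _ _) _; have [_ ? _] := Hs i (ltn_ord i).
- apply: leq_trans (size_sum _ _ _) _; apply/bigmax_leqP => i _.
  by apply: leq_trans (size_scale_leq _ _) _; have [_ _ ?] := Hs i (ltn_ord i).
- by apply: (bound fst) => i /=; rewrite lerDl pnw_ge0 ?ler01.
- by apply: (bound snd) => i /=; rewrite lerDr pnw_ge0 ?ler01.
Qed.

(** The passage between polynomials in [x] over series in [t] and series in [t] of polynomials in
    [x]; [hensel_lift] works with the second form. *)
Definition slice (P : {poly fps C}) (k : nat) : {poly C} := \poly_(j < size P) P`_j k.
Definition unslice (d : nat) (p : nat -> {poly C}) : {poly fps C} :=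
  \poly_(j < d) Fps (fun k => (p k)`_j).

Lemma coef_slice P k j : (slice P k)`_j = P`_j k.
Proof. by rewrite coef_poly; case: ltnP => // h; rewrite nth_default. Qed.

Lemma coef_unslice d (p : nat -> {poly C}) j k : (forall i, (size (p i) <= d)%N) ->
  (unslice d p)`_j k = (p k)`_j.
Proof.
move=> sp; rewrite coef_poly; case: ltnP => // h.
by rewrite nth_default // (leq_trans (sp k)).
Qed.

Lemma slice0 P : slice P 0 = map_poly (@ev0 C) P.
Proof. by apply/polyP => j; rewrite coef_slice. Qed.

Lemma geo_slice P : P \is a polyOver (@convs R) -> geo (pnw 1) (slice P).
Proof.
move=> /polyOverP cP.
suff H n : exists M r, [/\ 0 <= M, 0 <= r & forall k, \sum_(j < n) nm (P`_j k) <= M * r ^+ k].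
  have [M [r [M0 r0 H1]]] := H (size P); exists M, r; split => // k.
  rewrite (@pnw_widen _ _ _ (size P)) ?size_poly //; apply: le_trans (H1 k).
  by apply: ler_sum => j _; rewrite coef_slice expr1n mulr1.
elim: n => [|n [M [r [M0 r0 IH]]]].
  by exists 0, 0; split => // k; rewrite big_ord0 mul0r.
have /convsP[M' [r' [M0' r0' H']]] := cP n.
exists (M + M'), (r + r'); split; rewrite ?addr_ge0 // => k.
rewrite big_ord_recr /= mulrDl; apply: lerD.
  by apply: (geo_le (N := id) M0 r0 _ _ IH) => //; rewrite lerDl.
by apply: (geo_le M0' r0' _ _ H') => //; rewrite lerDr.
Qed.

Lemma unslice_conv d (p : nat -> {poly C}) : geo (pnw 1) p -> unslice d p \is a polyOver (@convs R).
Proof.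
move=> [M [r [M0 r0 H]]]; apply/polyOverP => j; rewrite coef_poly.
case: ifP => _; last by rewrite rpred0.
apply/convsP; exists M, r; split => // k /=.
by apply: le_trans (H k); have := nm_coef_pnw ler01 (p k) j; rewrite expr1n mulr1.
Qed.

Lemma unslice_monic (p : nat -> {poly C}) m :
  p 0%N \is monic -> size (p 0%N) = m.+1 -> (forall k, (size (p k.+1) <= m)%N) ->
  unslice m.+1 p \is monic /\ size (unslice m.+1 p) = m.+1.
Proof.
move=> p0m sp0 sp.
have sp' i : (size (p i) <= m.+1)%N by case: i => [|i]; rewrite ?sp0 // (leq_trans (sp i)).
have top : (unslice m.+1 p)`_m = 1.
  apply: fpsP => -[|k]; rewrite coef_unslice // fpsE1 /=.
    by move/monicP: p0m; rewrite lead_coefE sp0.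
  by rewrite nth_default.
have sz : size (unslice m.+1 p) = m.+1.
  apply/eqP; rewrite eqn_leq size_poly /=; rewrite ltnNge; apply/negP => h.
  have := oner_neq0 (fps C); rewrite -top nth_default ?eqxx //.
by split=> //; rewrite monicE lead_coefE sz top.
Qed.

Lemma hensel_coprime (P : {poly fps C}) (p0 q0 : {poly C}) :
  P \is monic -> P \is a polyOver (@convs R) -> map_poly (@ev0 C) P = p0 * q0 ->
  p0 \is monic -> q0 \is monic -> coprimep p0 q0 ->
  exists A B : {poly fps C},
    [/\ P = A * B, A \is monic /\ B \is monic,
        A \is a polyOver (@convs R) /\ B \is a polyOver (@convs R),
        size A = size p0 & size B = size q0].
Proof.
move=> Pm cP EP p0m q0m cop.
have [m sp0] : exists m, size p0 = m.+1.
  by exists (size p0).-1; rewrite prednK // size_poly_gt0 monic_neq0.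
have [n sq0] : exists n, size q0 = n.+1.
  by exists (size q0).-1; rewrite prednK // size_poly_gt0 monic_neq0.
have sP : size P = (m + n).+1.
  have := size_map_poly_id0 (f := @ev0 C) (p := P).
  rewrite (monicP Pm) EP => <-; last exact: oner_neq0.
  by rewrite size_Mmonic // ?monic_neq0 // sp0 sq0 addnS addSn.
have [K K0 sol] := coprime_solver sp0 sq0 cop.
have F0 : slice P 0 = p0 * q0 by rewrite slice0.
have Fc k : (size (slice P k.+1) <= m + n)%N.
  apply/leq_sizeP => j; rewrite coef_slice leq_eqVlt => /orP[/eqP <-|h].
    by move/monicP: Pm; rewrite lead_coefE sP /= => ->.
  by rewrite nth_default // sP.
have abc (i j : nat) : (m + n <= (m + n).+1)%N by [].
have [p [q [[Ep Eq] EF sz gp gq]]] := @hensel_lift _ 1 K (slice P) p0 q0 m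
  (fun _ => n) (fun _ => m + n)%N ler01 K0 F0 (geo_slice cP) Fc abc (fun k => @sol).
rewrite -Ep in p0m sp0; rewrite -Eq in q0m sq0.
have [Am sA] := unslice_monic p0m sp0 (fun k => proj1 (sz k)).
have [Bm sB] := unslice_monic q0m sq0 (fun k => proj2 (sz k)).
have sp' i : (size (p i) <= m.+1)%N.
  by case: i => [|i]; rewrite ?sp0 // (leq_trans (proj1 (sz i))).
have sq' i : (size (q i) <= n.+1)%N.
  by case: i => [|i]; rewrite ?sq0 // (leq_trans (proj2 (sz i))).
exists (unslice m.+1 p), (unslice n.+1 q); split; rewrite ?sA ?sB -?Ep -?Eq //.
- apply/polyP => j; apply: fpsP => k; rewrite -coef_slice EF coef_sum coefM fpsE_sum.
  rewrite (eq_bigr (fun i : 'I_k.+1 => \sum_(l < j.+1) (p i)`_l * (q (k - i)%N)`_(j - l))); last first.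
    by move=> i _; rewrite coefM.
  rewrite exchange_big /=; apply: eq_bigr => l _.
  by apply: eq_bigr => i _; rewrite !coef_unslice.
- by split; apply: unslice_conv.
Qed.

(** Undoes the substitution [x = s * z] of the Newton polygon on the level of linear factors. No
    division by [s] occurs, so [s] may be a power of the series variable. *)
Lemma scaled_roots (A : comNzRingType) (s : A) (zs : seq A) (G Q : {poly A}) :
  G = \prod_(z <- zs) ('X - z%:P) -> (size Q <= (size zs).+1)%N ->
  (forall i, (i <= size zs)%N -> Q`_i = s ^+ (size zs - i) * G`_i) ->
  Q = \prod_(z <- zs) ('X - (s * z)%:P).
Proof.
elim: zs G Q => [|z zs IH] G Q.
  rewrite !big_nil => -> /= sQ HQ; apply/polyP => i; rewrite coef1.
  case: i => [|i]; first by rewrite HQ // coef1 expr0 mul1r.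
  by rewrite nth_default // (leq_trans sQ).
rewrite !big_cons /=; set H := \prod_(z <- zs) ('X - z%:P) => EG sQ HQ.
pose Q' : {poly A} := \poly_(i < (size zs).+1) (s ^+ (size zs - i) * H`_i).
have sH : size H = (size zs).+1 by rewrite /H size_prod_XsubC.
have <- : Q' = \prod_(z <- zs) ('X - (s * z)%:P).
  apply: (IH H) => //; first exact: size_poly.
  by move=> i hi; rewrite coef_poly ltnS hi.
apply/polyP => i; rewrite mulrBl mul_polyC coefB coefXM coefZ.
have [hi|hi] := leqP i (size zs).+1; last first.
  rewrite nth_default ?(leq_trans sQ) //; case: i hi => // i hi /=.
  rewrite !nth_default ?mulr0 ?subrr //.
    by apply: leq_trans (size_poly _ _) _; apply: ltnW.
  by apply: leq_trans (size_poly _ _) _.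
rewrite HQ // EG mulrBl mul_polyC coefB coefXM coefZ.
case: i hi => [|i] hi /=.
  by rewrite coef_poly /= subn0 !sub0r mulrN subn0 exprS; congr (- _); ring.
rewrite !coef_poly hi subSS mulrBr; congr (_ - _).
case: ltnP => h; last by rewrite nth_default ?sH // !mulr0.
have -> : (size zs - i = (size zs - i.+1).+1)%N by lia.
by rewrite exprS; ring.
Qed.

Lemma coef_exp_XsubC (A : comNzRingType) (s : A) n :
  (('X - s%:P) ^+ n.+1)`_n = - s *+ n.+1.
Proof.
have top m : (('X - s%:P) ^+ m)`_m = 1.
  have /monicP : ('X - s%:P) ^+ m \is monic by rewrite monic_exp // monicXsubC.
  by rewrite lead_coefE size_exp_XsubC.
elim: n => [|n IH]; first by rewrite expr1 coefB coefX coefC sub0r.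
by rewrite exprS mulrBl mul_polyC coefB coefXM coefZ /= IH top mulr1 [RHS]mulrSr.
Qed.

(** Centring the roots at their mean removes the second coefficient. Over the complex numbers a
    power of one linear factor with this property is a power of ['X], which the Newton polygon then
    excludes. *)
Lemma tschirnhaus (A : comNzRingType) (P : {poly A}) d (s : A) :
  P \is monic -> size P = d.+2 -> P`_d = s *+ d.+1 ->
  let Q := P \Po ('X - s%:P) in
  [/\ Q \is monic, size Q = d.+2 & Q`_d = 0].
Proof.
move=> Pm sP Pd Q.
(* [L] collects the terms of degree below [d]; they do not reach degree [d] after the shift, so only
   the two leading terms matter. *)
pose L := P - 'X^(d.+1) - P`_d *: 'X^d.
have sL : (size L <= d)%N.
  apply/leq_sizeP => j hj; rewrite !coefB coefZ !coefXn.
  have [->|jd] := eqVneq j d; first by rewrite mulr1 ltn_eqF // subr0 subrr.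
  have [->|jd'] := eqVneq j d.+1.
    by move/monicP: Pm; rewrite lead_coefE sP /= => ->; rewrite mulr0 subrr subr0.
  by rewrite nth_default ?sP ?mulr0 ?subr0 //; lia.
have EQ : Q = ('X - s%:P) ^+ d.+1 + (P`_d *: ('X - s%:P) ^+ d + (L \Po ('X - s%:P))).
  have -> : Q = ('X^(d.+1) + (P`_d *: 'X^d + L)) \Po ('X - s%:P).
    by congr (_ \Po _); rewrite /L; ring.
  by rewrite !comp_polyD comp_polyZ !comp_Xn_poly.
have sLQ : (size (L \Po ('X - s%:P)) <= d)%N.
  have [->|L0] := eqVneq L 0; first by rewrite comp_poly0 size_poly0.
  apply: leq_trans (size_comp_poly_leq _ _) _; rewrite size_XsubC muln1.
  by rewrite prednK // size_poly_gt0.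
have sX n : size (('X - s%:P) ^+ n) = n.+1 by rewrite size_exp_XsubC.
have sR : (size (P`_d *: ('X - s%:P) ^+ d + (L \Po ('X - s%:P)))%R <= d.+1)%N.
  apply: leq_trans (size_polyD _ _) _; rewrite geq_max; apply/andP; split.
    by apply: leq_trans (size_scale_leq _ _) _; rewrite sX.
  exact: leqW.
have Xm n : ('X - s%:P) ^+ n \is monic by rewrite monic_exp // monicXsubC.
split.
- by rewrite monicE EQ lead_coefDl ?sX ?ltnS // (monicP (Xm _)).
- by rewrite EQ size_polyDl ?sX ?ltnS.
- rewrite EQ !coefD coefZ coef_exp_XsubC Pd.
  have := monicP (Xm d); rewrite lead_coefE sX /= => ->.
  by rewrite mulr1 [X in _ + (_ + X)]nth_default // addr0 mulNrn addNr.
Qed.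

End Puiseux.

(** * The Newton-Puiseux theorem *)

Lemma sum_pred_size a b d : (1 < a)%N -> (a + b).-1 = d.+2 -> (a + b = d.+3)%N.
Proof. by lia. Qed.

Lemma lt_parts a b c d : (1 < a)%N -> (1 < b)%N -> (a + b = d.+3)%N -> (d.+2 <= c)%N ->
  (a < c)%N /\ (b < c)%N.
Proof. by lia. Qed.

Section Puiseux.
Variable R : rcfType.
Local Notation C := R[i].
Local Notation nm := (@ComplexField.Normc.normc R).

Lemma fps_ord (V : comNzRingType) (u : fps V) : u != 0 ->
  exists k, u k != 0 /\ forall j, (j < k)%N -> u j = 0.
Proof.
move=> u0; have ex : exists k, u k != 0.
  apply: contrapT => no; case/eqP: u0; apply: fpsP => k.
  by apply/eqP; apply: contrapT => /negP h; apply: no; exists k.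
exists (ex_minn ex); case: ex_minnP => k hk min; split => // j hj.
by apply/eqP; apply: contraLR hj => /min; rewrite -leqNgt.
Qed.

(** Splits off the full power of one root [c]. If nothing else remained, [g] would be
    [('X - c)^(d+1)]; the vanishing coefficient of degree [d] then gives [c = 0] in characteristic
    zero, and all coefficients of degree at most [d] would vanish. *)
Lemma split_coprime (g : {poly C}) d j :
  g \is monic -> size g = d.+2 -> g`_d = 0 -> (j <= d)%N -> g`_j != 0 ->
  exists p q : {poly C}, [/\ g = p * q, p \is monic /\ q \is monic, coprimep p q,
    (1 < size p)%N & (1 < size q)%N].
Proof.
move=> gm sg gd jd gj.
have [c rc] : exists c, root g c by apply/closed_rootP; rewrite sg.
have [m [q nrq Eg]] := multiplicity_XsubC g c.
have g0 : g != 0 by rewrite monic_neq0.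
rewrite g0 /= in nrq.
have pm : ('X - c%:P) ^+ m \is monic by rewrite monic_exp // monicXsubC.
have qm : q \is monic by move: gm; rewrite Eg monicMr.
have m0 : (0 < m)%N.
  by case: m Eg pm => // Eg _; move: rc; rewrite Eg expr0 mulr1 (negPf nrq).
exists q, (('X - c%:P) ^+ m); split => //.
- by rewrite coprimep_expr // coprimep_XsubC.
- rewrite ltnNge; apply/negP => sq.
  have q1 : q = 1.
    have q0 : (0 < size q)%N by rewrite size_poly_gt0 monic_neq0.
    have /size_poly1P[x _ Eq] : size q == 1%N by rewrite eqn_leq sq q0.
    by move/monicP: qm; rewrite Eq lead_coefC => ->.
  have Em : m = d.+1.
    by move: sg; rewrite Eg q1 mul1r size_exp_XsubC => -[].
  rewrite q1 mul1r Em in Eg.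
  move: gd; rewrite Eg coef_exp_XsubC mulNrn => /eqP; rewrite oppr_eq0.
  rewrite -mulr_natr mulf_eq0 pnatr_eq0 orbF => /eqP c0.
  by move: gj; rewrite Eg c0 subr0 coefXn ltn_eqF ?eqxx // ltnS.
- by rewrite size_exp_XsubC ltnS.
Qed.

(** [j] minimises the slope [v i / (d + 1 - i)], where [v i] is the order of coefficient [i]. After
    ramification by [d + 1 - j] this slope becomes the integer [k = v j], coefficient [i] is
    divisible by [t^(k * (d + 1 - i))], and at [i = j] the quotient is a unit. Thus [G] is what [Q]
    becomes under [x = t^k * z], and its reduction is not a power of ['X]. *)
Lemma newton_polygon (Q : {poly fps C}) d j0 :
  Q \is monic -> size Q = d.+2 -> Q \is a polyOver (@convs R) -> Q`_d = 0 ->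
  (j0 <= d)%N -> Q`_j0 != 0 ->
  exists N k (G : {poly fps C}) j,
  [/\ G \is monic /\ size G = d.+2, G \is a polyOver (@convs R), G`_d = 0,
      (j <= d)%N /\ G`_j 0%N != 0 &
      forall i, (i <= d.+1)%N -> stretch N Q`_i = tX C ^+ (k * (d.+1 - i)) * G`_i].
Proof.
move=> Qm sQ cQ Qd j0d Qj0.
have /choice[v Hv] : forall i, exists k, Q`_i != 0 -> Q`_i k != 0 /\ forall j, (j < k)%N -> Q`_i j = 0.
  move=> i; have [h|h] := boolP (Q`_i != 0); last by exists 0%N.
  by have [k hk] := fps_ord h; exists k.
have [j [jd Qj vmin]] : exists j : nat, [/\ (j <= d)%N, Q`_j != 0 &
   forall i, (i <= d)%N -> Q`_i != 0 -> (v j * (d.+1 - i) <= v i * (d.+1 - j))%N].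
  pose I0 : 'I_d.+1 := Ordinal (n := d.+1) (m := j0) j0d.
  case: (@Order.TotalTheory.arg_minP _ rat 'I_d.+1 I0 (fun i => Q`_i != 0)
     (fun i => (v i)%:R / (d.+1 - i)%N%:R) Qj0) => j Qj min.
  exists j; split => //; first by rewrite -ltnS.
  move=> i hi Qi; have := min (Ordinal (n := d.+1) (m := i) hi) Qi => /=.
  have hj := ltn_ord j.
  rewrite ler_pdivrMr ?ltr0n ?subn_gt0 // mulrAC ler_pdivlMr ?ltr0n ?subn_gt0 //.
  by rewrite -!natrM ler_nat.
pose N := (d.+1 - j).-1; pose k := v j.
have EN : N.+1 = (d.+1 - j)%N by rewrite prednK // subn_gt0.
pose g i := dropu (k * (d.+1 - i)) (stretch N Q`_i).
pose G : {poly fps C} := 'X^(d.+1) + \poly_(i < d.+1) g i.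
have sg : (size (\poly_(i < d.+1) g i) <= d.+1)%N by apply: size_poly.
have Gi i : (i <= d)%N -> G`_i = g i.
  by move=> hi; rewrite coefD coefXn coef_poly ltnS hi ltn_eqF ?add0r.
have gE i : (i <= d)%N -> tX C ^+ (k * (d.+1 - i)) * g i = stretch N Q`_i.
  move=> hi; apply: dropuK => m hm; rewrite stretchE; case: ifP => // dv.
  have [Qi|/negP Qi] := boolP (Q`_i == 0); first by rewrite (eqP Qi).
  have [_ low] := Hv i (introN eqP (fun E => Qi (introT eqP E))).
  apply: low; rewrite ltn_divLR // EN.
  apply: leq_trans hm _; apply: vmin => //.
  by apply/eqP => E; apply: Qi; rewrite E.
exists N, k, G, j; split.
- split; last by rewrite size_polyDl ?size_polyXn.
  by rewrite monicE lead_coefDl ?size_polyXn // lead_coefXn.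
- rewrite rpredD ?polyOverXn //; apply/polyOverP => i; rewrite coef_poly.
  case: ifP => _; last by rewrite rpred0.
  by apply: convs_dropu; apply: convs_stretch; apply/polyOverP.
- by rewrite Gi // /g Qd; apply: fpsP => m /=; case: ifP.
- split => //; rewrite Gi // /g /dropu /= add0n -EN dvdn_mull // mulnK //.
  by have [] := Hv j Qj.
- move=> i; rewrite leq_eqVlt => /orP[/eqP ->|]; last by rewrite ltnS => hi; rewrite Gi // gE.
  rewrite subnn muln0 expr0 mul1r coefD coefXn eqxx [X in _ + X]nth_default // addr0.
  by move/monicP: Qm; rewrite lead_coefE sQ /= => ->; rewrite rmorph1.
Qed.

Lemma map_stretch_stretch N M (P : {poly fps C}) :
  map_poly (stretch M) (map_poly (stretch N) P) = map_poly (stretch (N.+1 * M.+1).-1) P.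
Proof.
by apply/polyP => i; rewrite !coef_map /= stretch_stretch.
Qed.

Lemma map_prod_XsubC (A B : comNzRingType) (f : {rmorphism A -> B}) (zs : seq A) :
  map_poly f (\prod_(z <- zs) ('X - z%:P)) = \prod_(z <- map f zs) ('X - z%:P).
Proof.
by rewrite rmorph_prod big_map; apply: eq_bigr => z _; rewrite /= map_polyXsubC.
Qed.

(** The reduction of [G] at [t = 0] has a vanishing second coefficient and another nonzero one below
    the leading one, hence two coprime factors; they lift to factors of [G] of smaller degree, to
    which the induction applies. *)
Theorem newton_puiseux (P : {poly fps C}) :
  P \is monic -> P \is a polyOver (@convs R) ->
  exists N (zs : seq (fps C)), (forall z, z \in zs -> z \in @convs R) /\
    map_poly (stretch N) P = \prod_(z <- zs) ('X - z%:P).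
Proof.
have [n] := ubnP (size P); elim: n P => // n IH P; rewrite ltnS => sPn Pm cP.
case sP : (size P) => [|[|d]].
- by have := monic_neq0 Pm; rewrite -size_poly_eq0 sP.
- exists 0%N, [::]; split=> //; rewrite big_nil.
  have /size_poly1P[x _ Eq] : size P == 1%N by rewrite sP.
  by move/monicP: Pm; rewrite Eq lead_coefC => ->; rewrite rmorph1.
pose s : fps C := P`_d * fpsC (d.+1%:R^-1).
have Es : P`_d = s *+ d.+1.
  rewrite /s -mulrnAr -rmorphMn /= -mulr_natl divff ?pnatr_eq0 // rmorph1 mulr1 //.
have cs : s \in @convs R by rewrite rpredM ?convs_const //; apply/polyOverP.
have [] := tschirnhaus Pm sP Es; set Q := P \Po ('X - s%:P) => Qm sQ Qd.
have cQ : Q \is a polyOver (@convs R) by rewrite polyOver_comp // polyOverXsubC.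
have shift N (zs : seq (fps C)) : (forall z, z \in zs -> z \in @convs R) ->
   map_poly (stretch N) Q = \prod_(z <- zs) ('X - z%:P) ->
   exists N (zs : seq (fps C)), (forall z, z \in zs -> z \in @convs R) /\
    map_poly (stretch N) P = \prod_(z <- zs) ('X - z%:P).
  move=> czs EQ; exists N, [seq z - stretch N s | z <- zs]; split.
    by move=> _ /mapP[z /czs cz ->]; rewrite rpredB // convs_stretch.
  have -> : map_poly (stretch N) P = map_poly (stretch N) Q \Po ('X + (stretch N s)%:P).
    rewrite /Q map_comp_poly /= map_polyXsubC -comp_polyA comp_polyB comp_polyX comp_polyC.
    by rewrite addrK comp_polyXr.
  rewrite EQ rmorph_prod big_map; apply: eq_bigr => z _ /=.
  by rewrite comp_polyB comp_polyX comp_polyC polyCB; ring.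
(* If all lower coefficients of [Q] vanish there is no slope to choose, but then [Q] is a power of
   ['X] and all its roots are 0. *)
have [[j0 [j0d Qj0]]|noj] := EM (exists j, (j <= d)%N /\ Q`_j != 0); last first.
  apply: (shift 0%N (nseq d.+1 0)); first by move=> z /nseqP[-> _]; rewrite rpred0.
  have -> : Q = 'X^(d.+1).
    apply/polyP => i; rewrite coefXn; have [->|ne] := eqVneq i d.+1.
      by move/monicP: Qm; rewrite lead_coefE sQ.
    have [hi|hi] := leqP i d; last by rewrite nth_default // sQ; move: ne; lia.
    by apply/eqP; apply: contrapT => /negP h; apply: noj; exists i.
  by rewrite map_polyXn big_nseq subr0 -Monoid.iteropE.
have [N [k [G [j [[Gm sG] cG Gd [jd Gj] EG]]]]] := newton_polygon Qm sQ cQ Qd j0d Qj0.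
pose g := map_poly (@ev0 C) G.
have gm : g \is monic by apply: monic_map.
have sg : size g = d.+2.
  by rewrite size_map_poly_id0 // (monicP Gm) oner_neq0.
have gd : g`_d = 0 by rewrite coef_map Gd.
have gj : g`_j != 0 by rewrite coef_map.
have [p0 [q0 [Eg [p0m q0m] cop sp0 sq0]]] := split_coprime gm sg gd jd gj.
have [A [B [EAB [Am Bm] [cA cB] sA sB]]] := hensel_coprime Gm cG Eg p0m q0m cop.
rewrite sP in sPn.
have sAB : (size A + size B = d.+3)%N.
  have : (size A + size B).-1 = d.+2 by rewrite -size_Mmonic ?monic_neq0 // -EAB.
  rewrite -sA in sp0; exact: sum_pred_size.
have sA' : (1 < size A)%N by rewrite sA.
have sB' : (1 < size B)%N by rewrite sB.
have [ltA ltB] := lt_parts sA' sB' sAB sPn.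
have [N1 [zs1 [cz1 E1]]] := IH A ltA Am cA.
have [N2 [zs2 [cz2 E2]]] := IH B ltB Bm cB.
(* The two factors come with different ramifications; both are stretched to the common index
   [(N1 + 1) * (N2 + 1)], and the predecessor accounts for the offset in [stretch]. *)
pose M := (N1.+1 * N2.+1).-1.
pose zs := map (stretch N2) zs1 ++ map (stretch N1) zs2.
have czs z : z \in zs -> z \in @convs R.
  by rewrite mem_cat => /orP[] /mapP[y hy ->]; apply: convs_stretch; [exact: cz1|exact: cz2].
have EGM : map_poly (stretch M) G = \prod_(z <- zs) ('X - z%:P).
  rewrite EAB rmorphM /= big_cat -!map_prod_XsubC -E1 -E2 /= !map_stretch_stretch.
  by rewrite /M mulnC.
have szs : size zs = d.+1.
  have : size (map_poly (stretch M) G) = d.+2.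
    by rewrite size_map_poly_id0 // (monicP Gm) rmorph1 oner_neq0.
  by rewrite EGM size_prod_XsubC => -[].
(* The roots of [Q] are those of [G] times the [k]-th power of the variable, which has itself been
   ramified by [M + 1]. *)
pose t := tX C ^+ (M.+1 * k).
apply: (shift (N.+1 * M.+1).-1 [seq t * z | z <- zs]).
  move=> _ /mapP[z /czs cz ->]; rewrite rpredM // rpredX //; exact: convs_tX.
rewrite -map_stretch_stretch big_map; apply: (scaled_roots EGM).
  rewrite szs; apply: leq_trans (size_poly _ _) _; apply: leq_trans (size_poly _ _) _.
  by rewrite sQ.
move=> i; rewrite szs => hi; rewrite !coef_map /= EG // rmorphM rmorphXn /= stretch_tX.
by rewrite /t -!exprM mulnA.
Qed.

End Puiseux.

End PowerSeries.

From Stdlib Require Import Reals Lra Lia List ClassicalEpsilon Classical Arith.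
From Coquelicot Require Import Coquelicot.
Import Defs.
Open Scope R_scope.

Ltac min_le := solve [apply Rle_refl
  | eapply Rle_trans; [apply Rmin_l|min_le] | eapply Rle_trans; [apply Rmin_r|min_le]].
Ltac min_bound := match goal with
  | H : ?t <= _ |- ?t <= _ => apply (Rle_trans _ _ _ H); min_le
  | H : ?t < _ |- ?t < _ => apply (Rlt_le_trans _ _ _ H); min_le
  | |- _ => min_le
  end.

(** * Complex series *)

Definition asum (u : nat -> C) : Prop := ex_series (fun n => Cmod (u n)).

Lemma Rabs_fst_le (z : C) : Rabs (fst z) <= Cmod z.
Proof. apply Rle_trans with (2 := Rmax_Cmod z); apply Rmax_l. Qed.
Lemma Rabs_snd_le (z : C) : Rabs (snd z) <= Cmod z.
Proof. apply Rle_trans with (2 := Rmax_Cmod z); apply Rmax_r. Qed.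

Lemma ex_series_le_R (u v : nat -> R) :
  (forall n, Rabs (u n) <= v n) -> ex_series v -> ex_series u.
Proof.
intros H Hv; apply (@ex_series_le R_AbsRing R_CompleteNormedModule u v); auto.
Qed.

Lemma asum_fst u : asum u -> ex_series (fun n => Rabs (fst (u n))).
Proof.
intros H; apply ex_series_le_R with (2 := H).
intros n; rewrite Rabs_Rabsolu; apply Rabs_fst_le.
Qed.
Lemma asum_snd u : asum u -> ex_series (fun n => Rabs (snd (u n))).
Proof.
intros H; apply ex_series_le_R with (2 := H).
intros n; rewrite Rabs_Rabsolu; apply Rabs_snd_le.
Qed.

Definition is_CS (u : nat -> C) (v : C) : Prop :=
  is_series (fun n => fst (u n)) (fst v) /\ is_series (fun n => snd (u n)) (snd v).

Lemma is_CS_unique u v : is_CS u v -> CSeries u = v.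
Proof.
intros [H1 H2]; unfold CSeries.
rewrite (is_series_unique _ _ H1), (is_series_unique _ _ H2); now destruct v.
Qed.

Lemma asum_is_CS u : asum u -> is_CS u (CSeries u).
Proof.
intros H; split; simpl; apply Series_correct, ex_series_Rabs.
- now apply asum_fst.
- now apply asum_snd.
Qed.

Lemma CSeries_ext u v : (forall n, u n = v n) -> CSeries u = CSeries v.
Proof.
intros H; unfold CSeries; f_equal; apply Series_ext; intros n; now rewrite H.
Qed.

Lemma asum_ext u v : (forall n, u n = v n) -> asum u -> asum v.
Proof. intros H; apply ex_series_ext; intros n; now rewrite H. Qed.

Lemma csum_fst u n : fst (csum u n) = sum_n (fun k => fst (u k)) n.
Proof.
induction n; [now rewrite sum_O|]; rewrite sum_Sn; simpl; now rewrite IHn.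
Qed.
Lemma csum_snd u n : snd (csum u n) = sum_n (fun k => snd (u k)) n.
Proof.
induction n; [now rewrite sum_O|]; rewrite sum_Sn; simpl; now rewrite IHn.
Qed.
Lemma csum_ext u v n : (forall k, (k <= n)%nat -> u k = v k) -> csum u n = csum v n.
Proof.
induction n; intros H; simpl; [apply H; lia|].
rewrite IHn, (H (S n)); [reflexivity|lia|intros k hk; apply H; lia].
Qed.
Lemma Cmod_csum_le u n : Cmod (csum u n) <= sum_n (fun k => Cmod (u k)) n.
Proof.
induction n; [rewrite sum_O; simpl; lra|].
rewrite sum_Sn; simpl; eapply Rle_trans; [apply Cmod_triangle|].
unfold plus; simpl; lra.
Qed.
Lemma csum_mult_l c u n : csum (fun k => Cmult c (u k)) n = Cmult c (csum u n).
Proof. induction n; simpl; [reflexivity|]; rewrite IHn; ring. Qed.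
Lemma csum_plus u v n : csum (fun k => Cplus (u k) (v k)) n = Cplus (csum u n) (csum v n).
Proof. induction n; simpl; [reflexivity|]; rewrite IHn; ring. Qed.
Lemma csum_zero u n : (forall k, (k <= n)%nat -> u k = RtoC 0) -> csum u n = RtoC 0.
Proof.
induction n; intros H; simpl; [apply H; lia|].
rewrite IHn, (H (S n)); [ring|lia|intros k hk; apply H; lia].
Qed.

Definition cconv (u v : nat -> C) (n : nat) : C :=
  csum (fun i => Cmult (u i) (v (n - i)%nat)) n.

Lemma sum_n_sum_f_R0 (u : nat -> R) n : sum_n u n = sum_f_R0 u n.
Proof. apply sum_n_Reals. Qed.

Lemma CSeries_cconv u v : asum u -> asum v ->
  CSeries (cconv u v) = Cmult (CSeries u) (CSeries v).
Proof.
intros Hu Hv; apply is_CS_unique.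
pose proof (asum_is_CS _ Hu) as [u1 u2]; pose proof (asum_is_CS _ Hv) as [v1 v2].
pose proof (asum_fst _ Hu) as au1; pose proof (asum_snd _ Hu) as au2.
pose proof (asum_fst _ Hv) as av1; pose proof (asum_snd _ Hv) as av2.
pose proof (is_series_mult _ _ _ _ u1 v1 au1 av1) as H11.
pose proof (is_series_mult _ _ _ _ u2 v2 au2 av2) as H22.
pose proof (is_series_mult _ _ _ _ u1 v2 au1 av2) as H12.
pose proof (is_series_mult _ _ _ _ u2 v1 au2 av1) as H21.
split; simpl.
- pose proof (is_series_minus _ _ _ _ H11 H22) as H.
  apply is_series_ext with (2 := H); intros n; unfold cconv; rewrite csum_fst, sum_n_sum_f_R0.
  change (plus ?x (opp ?y)) with (x - y); rewrite <- minus_sum.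
  apply sum_eq; intros; simpl; ring.
- pose proof (is_series_plus _ _ _ _ H12 H21) as H.
  apply is_series_ext with (2 := H); intros n; unfold cconv; rewrite csum_snd, sum_n_sum_f_R0.
  change (plus ?x ?y) with (x + y); rewrite <- plus_sum.
  apply sum_eq; intros; simpl; ring.
Qed.

Lemma CSeries_plus u v : asum u -> asum v ->
  CSeries (fun n => Cplus (u n) (v n)) = Cplus (CSeries u) (CSeries v).
Proof.
intros Hu Hv; apply is_CS_unique.
pose proof (asum_is_CS _ Hu) as [u1 u2]; pose proof (asum_is_CS _ Hv) as [v1 v2].
split; simpl; [exact (is_series_plus _ _ _ _ u1 v1)|exact (is_series_plus _ _ _ _ u2 v2)].
Qed.

Lemma asum_plus u v : asum u -> asum v -> asum (fun n => Cplus (u n) (v n)).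
Proof.
intros Hu Hv; unfold asum.
apply ex_series_le_R with (fun n => Cmod (u n) + Cmod (v n)); [|exact (ex_series_plus _ _ Hu Hv)].
intros n.
rewrite Rabs_pos_eq by apply Cmod_ge_0; apply Cmod_triangle.
Qed.

Lemma asum_scal c u : asum u -> asum (fun n => Cmult c (u n)).
Proof.
intros [l Hu]; exists (Cmod c * l).
apply is_series_ext with (fun n => scal (Cmod c) (Cmod (u n))).
  intros n; rewrite Cmod_mult; reflexivity.
exact (is_series_scal (Cmod c) _ _ Hu).
Qed.

Lemma CSeries_scal c u : asum u -> CSeries (fun n => Cmult c (u n)) = Cmult c (CSeries u).
Proof.
intros Hu; apply is_CS_unique.
pose proof (asum_is_CS _ Hu) as [u1 u2].
split; simpl.
- pose proof (is_series_minus _ _ _ _ (is_series_scal (fst c) _ _ u1) (is_series_scal (snd c) _ _ u2)) as H.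
  exact H.
- pose proof (is_series_plus _ _ _ _ (is_series_scal (fst c) _ _ u2) (is_series_scal (snd c) _ _ u1)) as H.
  exact H.
Qed.

Lemma CSeries_zero u : (forall n, u n = RtoC 0) -> CSeries u = RtoC 0.
Proof.
intros H; apply is_CS_unique; split; simpl.
- apply is_series_ext with (fun _ => 0); [intros n; now rewrite H|].
  apply filterlim_ext with (fun _ => 0); [|apply filterlim_const].
  intros n; rewrite sum_n_const; ring.
- apply is_series_ext with (fun _ => 0); [intros n; now rewrite H|].
  apply filterlim_ext with (fun _ => 0); [|apply filterlim_const].
  intros n; rewrite sum_n_const; ring.
Qed.

Lemma CSeries_incr_n u n : asum u ->
  CSeries u = Cplus (csum u n) (CSeries (fun k => u (S n + k)%nat)).
Proof.
intros Hu; unfold CSeries.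
pose proof (asum_is_CS _ Hu) as [u1 u2].
rewrite (Series_incr_n (fun k => fst (u k)) (S n)); [|lia|eexists; exact u1].
rewrite (Series_incr_n (fun k => snd (u k)) (S n)); [|lia|eexists; exact u2].
simpl; apply injective_projections; simpl.
- now rewrite csum_fst, sum_n_sum_f_R0.
- now rewrite csum_snd, sum_n_sum_f_R0.
Qed.

(* Project onto the direction of the sum and use the Cauchy-Schwarz inequality termwise. *)
Lemma Cmod_CSeries_le u : asum u -> Cmod (CSeries u) <= Series (fun n => Cmod (u n)).
Proof.
intros Hu; destruct (Req_dec (Cmod (CSeries u)) 0) as [E|E].
  rewrite E; replace 0 with (Series (fun _ => 0)).
    apply Series_le; [|exact Hu]; intros n; split; [lra|apply Cmod_ge_0].
  apply is_series_unique.
  apply filterlim_ext with (fun _ => 0); [|apply filterlim_const].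
  intros n; rewrite sum_n_const; ring.
set (S := CSeries u) in *; set (m := Cmod S) in *.
pose proof (asum_is_CS _ Hu) as [u1 u2]; fold S in u1, u2.
assert (mp : 0 < m) by (pose proof (Cmod_ge_0 S); fold m in H; lra).
assert (m2 : m * m = fst S * fst S + snd S * snd S).
  unfold m, Cmod; rewrite sqrt_sqrt; [ring|]; nra.
pose proof (is_series_plus _ _ _ _ (is_series_scal (fst S / m) _ _ u1)
              (is_series_scal (snd S / m) _ _ u2)) as H.
change (is_series (fun n => fst S / m * fst (u n) + snd S / m * snd (u n))
          (fst S / m * fst S + snd S / m * snd S)) in H.
replace (fst S / m * fst S + snd S / m * snd S) with m in H.
  2:{ replace (fst S / m * fst S + snd S / m * snd S) with
        ((fst S * fst S + snd S * snd S) / m) by (field; lra).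
      rewrite <- m2; field; lra. }
assert (B : forall n, Rabs (fst S / m * fst (u n) + snd S / m * snd (u n)) <= Cmod (u n)).
  intros n; set (a := fst S / m); set (b := snd S / m).
  assert (ab : a * a + b * b = 1).
    unfold a, b; replace (fst S / m * (fst S / m) + snd S / m * (snd S / m)) with
        ((fst S * fst S + snd S * snd S) / (m * m)) by (field; lra).
    rewrite <- m2; field; lra.
  unfold Cmod; apply Rsqr_incr_0_var; [|apply sqrt_pos].
  rewrite Rsqr_sqrt by (apply Rplus_le_le_0_compat; apply pow2_ge_0); rewrite <- Rsqr_abs; unfold Rsqr.
  assert (E1 : forall p q, (a * p + b * q) * (a * p + b * q) + (a * q - b * p) * (a * q - b * p)
     = (a * a + b * b) * (p * p + q * q)) by (intros; ring).
  specialize (E1 (fst (u n)) (snd (u n))); rewrite ab in E1.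
  pose proof (Rle_0_sqr (a * snd (u n) - b * fst (u n))) as E2; unfold Rsqr in E2; simpl; lra.
rewrite <- (is_series_unique _ _ H).
eapply Rle_trans; [apply Rle_abs|].
eapply Rle_trans; [apply Series_Rabs|].
  apply ex_series_le_R with (2 := Hu).
  intros n; rewrite Rabs_Rabsolu; apply B.
apply Series_le; [|exact Hu].
intros n; split; [apply Rabs_pos|apply B].
Qed.

Lemma asum_bounded u B : (forall n, sum_n (fun k => Cmod (u k)) n <= B) ->
  asum u /\ Cmod (CSeries u) <= B.
Proof.
intros H.
assert (Hu : asum u).
  unfold asum, ex_series, is_series.
  assert (L : ex_finite_lim_seq (sum_n (fun k => Cmod (u k)))).
    apply ex_finite_lim_seq_incr with B; [|exact H].
    intros n; rewrite sum_Sn; unfold plus; simpl; pose proof (Cmod_ge_0 (u (S n))); lra.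
  destruct L as [l Hl]; exists l; exact Hl.
split; [exact Hu|].
eapply Rle_trans; [apply Cmod_CSeries_le, Hu|].
destruct Hu as [l Hl]; rewrite (is_series_unique _ _ Hl).
apply (is_lim_seq_le (sum_n (fun k => Cmod (u k))) (fun _ => B) l B);
  [exact H|exact Hl|apply is_lim_seq_const].
Qed.

Lemma asum_le u (v : nat -> R) : ex_series v -> (forall n, Cmod (u n) <= v n) -> asum u.
Proof.
intros Hv H; unfold asum; apply ex_series_le_R with (2 := Hv).
intros n.
rewrite Rabs_pos_eq by apply Cmod_ge_0; apply H.
Qed.

Lemma is_series_geom_M M q : Rabs q < 1 -> is_series (fun n => M * q ^ n) (M / (1 - q)).
Proof.
intros H; exact (is_series_scal M _ _ (is_series_geom q H)).
Qed.

Lemma asum_geom u M q : 0 <= q < 1 -> (forall n, Cmod (u n) <= M * q ^ n) ->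
  asum u /\ Cmod (CSeries u) <= M / (1 - q).
Proof.
intros Hq H.
assert (Hg : is_series (fun n => M * q ^ n) (M / (1 - q))) by (apply is_series_geom_M; rewrite Rabs_pos_eq; lra).
assert (Hu : asum u) by (apply asum_le with (2 := H); eexists; exact Hg).
split; [exact Hu|].
eapply Rle_trans; [apply Cmod_CSeries_le, Hu|].
rewrite <- (is_series_unique _ _ Hg).
apply Series_le; [|eexists; exact Hg].
intros n; split; [apply Cmod_ge_0|apply H].
Qed.

Lemma Cmult_opp_1_l z : Cmult (Copp (RtoC 1)) z = Copp z.
Proof. ring. Qed.

Lemma CSeries_of_csum_lim v S B : (forall L, Cmod (Cminus S (csum v L)) <= B * (/ 2) ^ L) ->
  CSeries v = S.
Proof.
intros H; apply is_CS_unique.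
assert (G : is_lim_seq (fun L => B * (/ 2) ^ L) 0).
  replace (Finite 0) with (Rbar_mult B 0) by (simpl; f_equal; ring).
  apply is_lim_seq_scal_l, is_lim_seq_geom; rewrite Rabs_pos_eq; lra.
assert (P : forall (w : nat -> R) l, (forall L, Rabs (l - w L) <= B * (/ 2) ^ L) -> is_lim_seq w l).
  intros w l Hw; apply is_lim_seq_ext with (fun n => l - (l - w n)); [intros; ring|].
  replace (Finite l) with (Finite (l - 0)) by (f_equal; ring).
  apply is_lim_seq_minus'; [apply is_lim_seq_const|].
  apply is_lim_seq_abs_0.
  apply is_lim_seq_le_le with (fun _ => 0) (fun L => B * (/ 2) ^ L);
    [intros n; split; [apply Rabs_pos|apply Hw]|apply is_lim_seq_const|exact G].
split.
- apply P; intros L; rewrite <- csum_fst.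
  eapply Rle_trans; [|apply H]; eapply Rle_trans; [|apply Rabs_fst_le]; apply Req_le; f_equal.
- apply P; intros L; rewrite <- csum_snd.
  eapply Rle_trans; [|apply H]; eapply Rle_trans; [|apply Rabs_snd_le]; apply Req_le; f_equal.
Qed.

Definition pval (phi : nat -> C) (t : R) : C :=
  CSeries (fun k => Cmult (phi k) (RtoC (t ^ k))).

Lemma CSeries_shift_zero u m : (forall n, (n < m)%nat -> u n = RtoC 0) ->
  asum (fun k => u (m + k)%nat) -> CSeries u = CSeries (fun k => u (m + k)%nat).
Proof.
intros H Ha; destruct m; [reflexivity|].
rewrite (CSeries_incr_n u m).
  rewrite csum_zero; [ring|]; intros k hk; apply H; lia.
unfold asum; apply (ex_series_incr_n (fun k => Cmod (u k)) (S m)); exact Ha.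
Qed.

Lemma Cmult_rotate (x y z : C) : Cmult x (Cmult y z) = Cmult z (Cmult x y).
Proof. ring. Qed.

(** Stretching a series inserts zeros, so its partial sums are those of the original series along a
    slowly growing index; convergence of the original is enough to compare the sums. *)
Lemma CSeries_subsequence u v (g : nat -> nat) : asum u ->
  (forall n0, exists n1, forall n, (n1 <= n)%nat -> (n0 <= g n)%nat) ->
  (forall L, csum v L = csum u (g L)) -> CSeries v = CSeries u.
Proof.
intros Hu Hg Hv; apply is_CS_unique.
assert (F : filterlim g eventually eventually).
  intros P [n0 Hn]; destruct (Hg n0) as [n1 H1]; exists n1; intros n hn; apply Hn, H1, hn.
destruct (asum_is_CS _ Hu) as [u1 u2]; split.
- apply filterlim_ext with (fun L => sum_n (fun k => fst (u k)) (g L)).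
    intros L; rewrite <- !csum_fst, Hv; reflexivity.
  eapply filterlim_comp; [exact F|exact u1].
- apply filterlim_ext with (fun L => sum_n (fun k => snd (u k)) (g L)).
    intros L; rewrite <- !csum_snd, Hv; reflexivity.
  eapply filterlim_comp; [exact F|exact u2].
Qed.

Lemma CSeries_delta1 u : (forall n, n <> 1%nat -> u n = RtoC 0) -> CSeries u = u 1%nat.
Proof.
intros H.
assert (Z : forall k, u (2 + k)%nat = RtoC 0) by (intros k; apply H; lia).
assert (A : asum u).
  unfold asum; apply (ex_series_incr_n (fun k => Cmod (u k)) 2).
  exists 0; apply is_series_ext with (fun _ => 0).
    intros n; now rewrite Z, Cmod_0.
  apply filterlim_ext with (fun _ => 0); [|apply filterlim_const].
  intros n; rewrite sum_n_const; ring.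
rewrite (CSeries_incr_n u 1 A), CSeries_zero by exact Z; simpl.
rewrite (H 0%nat) by lia; ring.
Qed.

Lemma RtoC_cpow t k : RtoC (t ^ k) = cpow (RtoC t) k.
Proof. induction k; simpl; [reflexivity|]; rewrite <- IHk, RtoC_mult; reflexivity. Qed.

Definition lprod {A : Type} (f : A -> C) (l : list A) : C :=
  fold_right (fun v z => Cmult (f v) z) (RtoC 1) l.

Lemma lprod_scale {A : Type} (w : A -> C) y z (l : list A) :
  Cmult (cpow y (length l)) (lprod (fun v => Cminus z (w v)) l) =
  lprod (fun v => Cminus (Cmult z y) (Cmult y (w v))) l.
Proof.
induction l as [|v l IH]; simpl; [ring|].
rewrite <- IH; ring.
Qed.

Module Puiseux.

Import all_boot all_order all_algebra boolp complex Rstruct mathcomp.zify.zify mathcomp.algebra_tactics.ring mathcomp.algebra_tactics.lra.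
Import Order.TTheory GRing.Theory Num.Theory.
Set Implicit Arguments. Unset Strict Implicit. Unset Printing Implicit Defensive.
Local Open Scope ring_scope.
Import PowerSeries.
#[local] Arguments ComplexField.Normc.normc : simpl never.

(** * Values of convergent power series *)

Notation RR := Rdefinitions.R.
Notation K := (complex RR).
Notation nm := (@ComplexField.Normc.normc RR).

(** The algebra takes place over the MathComp complex numbers, the germs take values in the
    Coquelicot ones; [toC] carries ring operations and modulus across. *)
Definition toC (z : K) : Complex.C := (complex.Re z, complex.Im z).
Definition ofC (z : Complex.C) : K := complex.Complex z.1 z.2.

Lemma toCK z : ofC (toC z) = z. Proof. by case: z. Qed.
Lemma ofCK z : toC (ofC z) = z. Proof. by case: z. Qed.
Lemma toC_inj : injective toC. Proof. exact: can_inj toCK. Qed.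
Lemma toC0 : toC 0 = RtoC 0. Proof. by []. Qed.
Lemma toC1 : toC 1 = RtoC 1. Proof. by []. Qed.
Lemma toCD x y : toC (x + y) = Cplus (toC x) (toC y).
Proof. by case: x y => [a b] [c d]. Qed.
Lemma toCN x : toC (- x) = Copp (toC x).
Proof. by case: x => [a b]. Qed.
Lemma toCM x y : toC (x * y) = Cmult (toC x) (toC y).
Proof. by case: x y => [a b] [c d]. Qed.
Lemma toCX x n : toC (x ^+ n) = cpow (toC x) n.
Proof. by elim: n => [|n IH] //; rewrite exprS toCM IH. Qed.
Lemma toC_sum n (F : nat -> K) : toC (\sum_(i < n.+1) F i) = csum (fun i => toC (F i)) n.
Proof.
elim: n => [|n IH]; first by rewrite big_ord1.
by rewrite big_ord_recr /= toCD IH.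
Qed.
Lemma Cmod_toC z : Cmod (toC z) = nm z.
Proof.
case: z => a b; rewrite /Cmod /= RsqrtE /ComplexField.Normc.normc; congr Num.sqrt.
by rewrite !expr2 !Rmult_1_r.
Qed.
Lemma nm_ofC z : nm (ofC z) = Cmod z.
Proof. by rewrite -Cmod_toC ofCK. Qed.

(** [CS] is the value at [T = 1]; the value at [t] is [CS (scale t u)]. The series with a bound
    [bsum] on their l1-norm form an algebra on which [CS] is multiplicative, so no radius of
    convergence has to be carried along. *)
Definition CS (u : nat -> K) : Complex.C := CSeries (fun n => toC (u n)).
Definition bsum (u : nat -> K) (B : RR) : Prop := forall n, \sum_(k < n) nm (u k) <= B.

(* [bsum u (B * B')] has to mean the MathComp product, although [R_scope] is bound to [R]. *)
Arguments bsum u%_function_scope B%_ring_scope.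

Lemma sum_n_big (F : nat -> RR) n : sum_n F n = \sum_(k < n.+1) F k.
Proof.
elim: n => [|n IH]; first by rewrite sum_O big_ord1.
by rewrite sum_Sn big_ord_recr /= IH.
Qed.

Lemma bsum_asum u B : bsum u B ->
  asum (fun n => toC (u n)) /\ Rle (Cmod (CS u)) B.
Proof.
move=> H; apply: asum_bounded => n; rewrite sum_n_big; apply/RleP.
rewrite (eq_bigr (fun k : 'I_n.+1 => nm (u k))); first exact: H.
by move=> k _; rewrite Cmod_toC.
Qed.

Lemma bsum_ge0 u B : bsum u B -> 0 <= B.
Proof. by move=> /(_ 0%N); rewrite big_ord0. Qed.

Lemma bsum_le u B B' : B <= B' -> bsum u B -> bsum u B'.
Proof. by move=> h H n; apply: le_trans (H n) h. Qed.

Lemma bsumM (u v : fps K) B B' : bsum u B -> bsum v B' -> bsum (u * v) (B * B').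
Proof.
move=> Hu Hv n.
apply: (@le_trans _ _ ((\sum_(k < n) nm (u k)) * (\sum_(k < n) nm (v k)))); last first.
  by apply: ler_pM => //; apply: sumr_ge0 => i _; apply: nm_ge0.
apply: le_trans (sum_conv_le n (fun i => nm_ge0 (u i)) (fun i => nm_ge0 (v i))).
apply: ler_sum => k _; rewrite fpsEM; apply: le_trans (nm_sum _ _ _) _.
by apply: ler_sum => i _; rewrite nmM.
Qed.

Lemma bsumD (u v : fps K) B B' : bsum u B -> bsum v B' -> bsum (u + v) (B + B').
Proof.
move=> Hu Hv n; apply: le_trans (lerD (Hu n) (Hv n)); rewrite -big_split /=.
by apply: ler_sum => i _; apply: nmD.
Qed.

Lemma bsum_sum I (r : seq I) (P : pred I) (u : I -> fps K) (B : I -> RR) :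
  (forall i, P i -> bsum (u i) (B i)) -> bsum (\sum_(i <- r | P i) u i) (\sum_(i <- r | P i) B i).
Proof.
move=> H; elim/big_rec2: _ => [|i x y Pi IH].
  by move=> n; rewrite big1 // => k _; rewrite nm0.
by apply: bsumD => //; apply: H.
Qed.

Lemma bsumN (u : fps K) B : bsum u B -> bsum (- u) B.
Proof. by move=> H n; apply: le_trans (H n); apply: ler_sum => i _; rewrite nmN. Qed.

Lemma bsumC c : bsum (fpsC c) (nm c).
Proof.
move=> [|n]; first by rewrite big_ord0 nm_ge0.
by rewrite big_ord_recl big1 ?addr0 // => i _ /=; rewrite nm0.
Qed.

Lemma bsumX (u : fps K) B n : bsum u B -> bsum (u ^+ n) (B ^+ n).
Proof.
move=> H; elim: n => [|n IH]; last by rewrite !exprS; apply: bsumM H IH.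
rewrite !expr0 -[X in bsum _ X](nm1 RR).
exact: (bsumC 1).
Qed.

Lemma CS_M (u v : fps K) B B' : bsum u B -> bsum v B' -> CS (u * v) = Cmult (CS u) (CS v).
Proof.
move=> /bsum_asum[hu _] /bsum_asum[hv _]; rewrite -CSeries_cconv //.
apply: CSeries_ext => n; rewrite fpsEM /cconv.
transitivity (csum (fun i => toC (u i * v (n - i)%N)) n); first exact: toC_sum.
by apply: csum_ext => k hk; rewrite toCM.
Qed.

Lemma CS_D (u v : fps K) B B' : bsum u B -> bsum v B' -> CS (u + v) = Cplus (CS u) (CS v).
Proof.
move=> /bsum_asum[hu _] /bsum_asum[hv _]; rewrite -CSeries_plus //.
by apply: CSeries_ext => n; rewrite fpsED toCD.
Qed.

Lemma CS_C c : CS (fpsC c) = toC c.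
Proof.
have [h _] := bsum_asum (bsumC c).
by rewrite /CS (CSeries_incr_n _ 0) //= CSeries_zero // Cplus_0_r.
Qed.

Lemma CS_N (u : fps K) B : bsum u B -> CS (- u) = Copp (CS u).
Proof.
move=> H; have -> : - u = fpsC (- 1) * u by rewrite rmorphN1 mulN1r.
by rewrite (CS_M (bsumC (-1)) H) CS_C toCN toC1 Cmult_opp_1_l.
Qed.

Lemma CS_B (u v : fps K) B B' : bsum u B -> bsum v B' -> CS (u - v) = Cminus (CS u) (CS v).
Proof. by move=> hu hv; rewrite (CS_D hu (bsumN hv)) (CS_N hv). Qed.

Lemma CS_X (u : fps K) B n : bsum u B -> CS (u ^+ n) = cpow (CS u) n.
Proof.
move=> H; elim: n => [|n IH]; first by rewrite -[u ^+ 0]/(fpsC 1) CS_C toC1.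
by rewrite exprS (CS_M H (bsumX n H)) IH.
Qed.

Lemma CS_sum n (u : nat -> fps K) (B : nat -> RR) :
  (forall i, bsum (u i) (B i)) -> CS (\sum_(i < n.+1) u i) = csum (fun i => CS (u i)) n.
Proof.
move=> H; elim: n => [|n IH]; first by rewrite big_ord1.
rewrite big_ord_recr /= -IH.
have hb : bsum (\sum_(i < n.+1) u i) (\sum_(i < n.+1) B i) by apply: bsum_sum.
exact: CS_D hb (H n.+1).
Qed.

(** * Composition *)

Lemma scale_fpsC (V : comNzRingType) (t c : V) : scale t (fpsC c) = fpsC c.
Proof. by apply: fpsP => -[|k] /=; rewrite ?expr0 ?mulr1 ?mul0r. Qed.

Lemma scale_tX (V : comNzRingType) (t : V) : scale t (tX V) = fpsC t * tX V.
Proof.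
apply: fpsP => k; rewrite fpsECM /=; case: eqP => [->|_]; rewrite ?mulr0 ?mul0r //.
by rewrite expr1 mulrC.
Qed.

Definition homog (a : nat -> nat -> K) (X Y : fps K) n : fps K :=
  \sum_(i < n.+1) fpsC (a i (n - i)%N) * (X ^+ i * Y ^+ (n - i)).

(** When [X] and [Y] have no constant term, [homog a X Y n] starts at order [n], so stopping at
    [n = k] loses nothing in coefficient [k]. *)
Definition compo a X Y : fps K := Fps (fun k => \sum_(n < k.+1) homog a X Y n k).

Lemma homog_scale a X Y n t : scale t (homog a X Y n) = homog a (scale t X) (scale t Y) n.
Proof.
rewrite /homog rmorph_sum /=; apply: eq_bigr => i _.
by rewrite !rmorphM !rmorphXn /= scale_fpsC.
Qed.

Lemma compo_scale a X Y t : scale t (compo a X Y) = compo a (scale t X) (scale t Y).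
Proof.
apply: fpsP => k /=; rewrite mulr_suml; apply: eq_bigr => n _.
by rewrite -homog_scale.
Qed.

Lemma sum_pow2V (F : rcfType) m : \sum_(n < m) (2^-1 : F) ^+ n <= 2.
Proof.
have h := @sum_geom_half F 2^-1 m; have {h} := h _ (lexx _).
rewrite invr_ge0 ler0n => /(_ isT) h.
have -> : \sum_(n < m) (2^-1 : F) ^+ n = 2 * \sum_(n < m) (2^-1 : F) ^+ n.+1.
  rewrite mulr_sumr; apply: eq_bigr => i _; rewrite exprS mulrA divff ?mul1r //.
  by rewrite pnatr_eq0.
by rewrite -[X in _ <= X]mulr1 ler_wpM2l //; apply: le_trans h _; rewrite divff // pnatr_eq0.
Qed.

(** Pays for the [n + 1] monomials of degree [n]; this is the origin of the 4 in the smallness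
    conditions below. *)
Lemma succ_mul_quarter_pow (F : rcfType) (q : F) n : 0 <= q -> 4 * q <= 1 ->
  q ^+ n *+ n.+1 <= 2^-1 ^+ n.
Proof.
move=> q0 hq; rewrite -mulr_natl; apply: (@le_trans _ _ (2 ^+ n * (4^-1) ^+ n)).
  apply: ler_pM; rewrite ?ler0n ?exprn_ge0 //; first by rewrite -natrX ler_nat ltn_expl.
  by apply: lerXn2r; rewrite ?nnegrE ?invr_ge0 //; lra.
by rewrite -exprMn; apply: eq_le_r; congr (_ ^+ _); field.
Qed.

Section Composition.
Variables (a : nat -> nat -> K) (M sigma s : RR) (X Y : fps K).
Hypotheses (M0 : 0 <= M) (sigma0 : 0 <= sigma).
Hypothesis Ha : forall i j, nm (a i j) <= M * sigma ^+ (i + j).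
Hypotheses (X0 : X 0%N = 0) (Y0 : Y 0%N = 0) (HX : bsum X s) (HY : bsum Y s).
Hypothesis small : 4 * (sigma * s) <= 1.

Local Notation T := (homog a X Y).

Lemma bsum_homog_term n (i : nat) : (i <= n)%N ->
  bsum (fpsC (a i (n - i)%N) * (X ^+ i * Y ^+ (n - i))) (M * (sigma * s) ^+ n).
Proof.
move=> hi; have s0 := bsum_ge0 HX.
apply: (bsum_le _ (bsumM (bsumC _) (bsumM (bsumX i HX) (bsumX (n - i) HY)))).
rewrite -exprD subnKC // exprMn mulrA ler_wpM2r ?exprn_ge0 //.
by have := Ha i (n - i); rewrite subnKC.
Qed.

Lemma bsum_homog n : bsum (T n) (M * 2^-1 ^+ n).
Proof.
have s0 := bsum_ge0 HX.
have h : bsum (T n) (\sum_(i < n.+1) M * (sigma * s) ^+ n).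
  by apply: bsum_sum => i _; apply: bsum_homog_term; rewrite -ltnS.
apply: bsum_le h; rewrite sumr_const card_ord -mulrnAr ler_wpM2l //.
by apply: succ_mul_quarter_pow => //; apply: mulr_ge0.
Qed.

Lemma homog_low n k : (k < n)%N -> T n k = 0.
Proof.
move=> hk; rewrite /homog fpsE_sum big1 // => i _; rewrite fpsECM.
have h1 (u : fps K) : u 0%N = 0 -> u = tX K * dropu 1 u.
  by move=> u0; rewrite -[tX K]expr1 dropuK // => -[].
have hi : (i <= n)%N by rewrite -ltnS.
have -> : X ^+ i * Y ^+ (n - i) = tX K ^+ n * (dropu 1 X ^+ i * dropu 1 Y ^+ (n - i)).
  rewrite {1}(h1 X X0) {1}(h1 Y Y0) (exprMn i) (exprMn (n - i)) mulrACA -exprD subnKC //.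
by rewrite tXnM hk mulr0.
Qed.

(** The interchange of summation behind composition: collecting by degree [n] instead of by order
    [k] leaves a tail that is geometrically small in the l1-norm, and this norm controls the
    values. *)
Lemma bsum_compo_tail L : bsum (compo a X Y - \sum_(n < L) T n) (2 * M * 2^-1 ^+ L).
Proof.
move=> m.
have E k : (k < m)%N -> (compo a X Y - \sum_(n < L) T n) k = \sum_(n < m) T (L + n)%N k.
  move=> hk; rewrite fpsEB fpsE_sum /=.
  have -> : \sum_(n < k.+1) T n k = \sum_(n < L + m) T n k.
    have hw : (k.+1 <= L + m)%N by apply: leq_trans hk _; apply: leq_addl.
    rewrite (big_ord_widen _ (fun n => T n k) hw) big_mkcond /=.
    by apply: eq_bigr => n _; case: ltnP => // hn; rewrite homog_low.
  by rewrite big_split_ord /= addrAC subrr add0r.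
apply: (@le_trans _ _ (\sum_(k < m) \sum_(n < m) nm (T (L + n)%N k))).
  by apply: ler_sum => k _; rewrite E //; apply: nm_sum.
rewrite exchange_big /=.
apply: (@le_trans _ _ (\sum_(n < m) M * 2^-1 ^+ (L + n))).
  by apply: ler_sum => n _; apply: bsum_homog.
rewrite (eq_bigr (fun n : 'I_m => M * 2^-1 ^+ L * 2^-1 ^+ n)); last first.
  by move=> n _; rewrite exprD mulrA.
rewrite -mulr_sumr -(mulrA 2) (mulrC 2); apply: ler_wpM2l; last exact: sum_pow2V.
by rewrite mulr_ge0 // exprn_ge0 // invr_ge0.
Qed.

Lemma bsum_compo : bsum (compo a X Y) (2 * M).
Proof. by have := bsum_compo_tail 0; rewrite big_ord0 subr0 expr0 mulr1. Qed.

Lemma CS_homog n : CS (T n) =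
  csum (fun i => Cmult (toC (a i (n - i)%N)) (Cmult (cpow (CS X) i) (cpow (CS Y) (n - i)%N))) n.
Proof.
rewrite /homog; set u := fun i => fpsC (a i (n - i)%N) * (X ^+ i * Y ^+ (n - i)).
rewrite (@CS_sum n u (fun i => nm (a i (n - i)%N) * (s ^+ i * s ^+ (n - i)))).
  apply: csum_ext => i _; rewrite /u.
  rewrite (CS_M (bsumC _) (bsumM (bsumX i HX) (bsumX (n - i) HY))).
  by rewrite CS_C (CS_M (bsumX i HX) (bsumX (n - i) HY)) (CS_X i HX) (CS_X (n - i) HY).
by move=> i; apply: bsumM; [apply: bsumC|apply: bsumM; apply: bsumX].
Qed.

Lemma CS_compo : CS (compo a X Y) = eval2 (fun i j => toC (a i j)) (CS X) (CS Y).
Proof.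
rewrite /eval2; symmetry.
rewrite (CSeries_ext _ (fun n => CS (T n))); last by move=> n; rewrite CS_homog.
apply: (CSeries_of_csum_lim _ _ M) => L.
have hs : bsum (\sum_(n < L.+1) T n) (\sum_(n < L.+1) M * 2^-1 ^+ n).
  by apply: bsum_sum => n _; apply: bsum_homog.
rewrite -(CS_sum L bsum_homog) -(CS_B bsum_compo hs).
have [_ h] := bsum_asum (bsum_compo_tail L.+1).
apply: Rle_trans h _; apply/RleP; rewrite RmultE RpowE RinvE exprS.
rewrite [2 * M]mulrC -!mulrA ler_wpM2l // mulrA divff ?mul1r // pnatr_eq0 //.
Qed.

End Composition.

Lemma bsum_tX : bsum (tX K) 1.
Proof.
move=> [|[|n]]; first by rewrite big_ord0.
  by rewrite big_ord1 /= nm0.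
rewrite big_ord_recl big_ord_recl /= nm0 add0r nm1 big1 ?addr0 //.
Qed.

Lemma CS_tX : CS (tX K) = RtoC 1.
Proof. by rewrite /CS CSeries_delta1 // => -[|[|n]]. Qed.

Lemma cpow1 n : cpow (RtoC 1) n = RtoC 1.
Proof. by elim: n => //= n ->; rewrite Cmult_1_l. Qed.

Lemma bsum_CtX c n : bsum (fpsC c * tX K ^+ n) (nm c).
Proof.
have := bsumM (bsumC c) (bsumX n bsum_tX); rewrite expr1n mulr1; exact.
Qed.

Lemma CS_CtX c n : CS (fpsC c * tX K ^+ n) = toC c.
Proof.
by rewrite (CS_M (bsumC c) (bsumX n bsum_tX)) CS_C (CS_X n bsum_tX) CS_tX cpow1 Cmult_1_r.
Qed.

Lemma sum_triangle (V : nmodType) (G : nat -> nat -> V) k :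
  \sum_(n < k.+1) \sum_(i < n.+1) G i (n - i)%N =
  \sum_(i < k.+1) \sum_(j < (k - i).+1) G i j.
Proof.
elim: k => [|k IH]; first by rewrite big_ord1 big_ord1 [RHS]big_ord1 [RHS]big_ord1.
have top : \sum_(j < (k.+1 - k.+1).+1) G k.+1 j = G k.+1 0%N by rewrite subnn big_ord1.
rewrite big_ord_recr IH [RHS]big_ord_recr [in RHS]/= top [X in _ + X = _]big_ord_recr /= subnn.
rewrite addrA; congr (_ + _); rewrite -big_split /=; apply: eq_bigr => i _.
have hi : (i <= k)%N by rewrite -ltnS.
by rewrite (subSn hi) [RHS]big_ord_recr.
Qed.

Definition stretch2 (V : nmodType) N (q : nat -> nat -> V) i j : V :=
  if (N.+1 %| j)%N then q i (j %/ N.+1)%N else 0.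

Lemma coef_monomial_compo (V : comNzRingType) (c x y : V) N i j k :
  (fpsC c * ((fpsC x * tX V) ^+ i * (fpsC y * tX V ^+ N.+1) ^+ j)) k =
  if k == (i + N.+1 * j)%N then c * x ^+ i * y ^+ j else 0.
Proof.
rewrite (exprMn i) (exprMn j) -(rmorphXn (@fpsC V) i x) -(rmorphXn (@fpsC V) j y) -exprM.
rewrite mulrACA -exprD -(rmorphM (@fpsC V)) fpsECM fpsECM tXn.
by case: eqP => _; rewrite ?mulr1 ?mulr0 // mulrA.
Qed.

(** Both sides are sums of the same terms, arranged by different degrees. Composition with the
    monomials [x * T] and [t^(N+1) * T^(N+1)] does the rearrangement: its total is the left side,
    and its coefficient [k] is the homogeneous part of degree [k] on the right. *)
Lemma eval2_stretch (q : nat -> nat -> K) (M sigma s : RR) N (x t : K) :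
  0 <= M -> 0 <= sigma -> (forall i j, nm (q i j) <= M * sigma ^+ (i + j)) ->
  nm x <= s -> nm (t ^+ N.+1) <= s -> 4 * (sigma * s) <= 1 ->
  eval2 (fun i j => toC (q i j)) (toC x) (toC (t ^+ N.+1)) =
  eval2 (fun i j => toC (stretch2 N q i j)) (toC x) (toC t).
Proof.
move=> M0 s0 Hq xs ts small.
pose X := fpsC x * tX K; pose Y := fpsC (t ^+ N.+1) * tX K ^+ N.+1.
have X0 : X 0%N = 0 by rewrite /X fpsECM mulr0.
have Y0 : Y 0%N = 0 by rewrite /Y fpsECM tXn mulr0.
have HX : bsum X s by apply: bsum_le xs _; rewrite /X -[tX K]expr1; apply: bsum_CtX.
have HY : bsum Y s by apply: bsum_le ts _; apply: bsum_CtX.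
have := CS_compo M0 s0 Hq X0 Y0 HX HY small.
have -> : CS X = toC x by rewrite /X -[tX K]expr1 CS_CtX.
rewrite [CS Y]CS_CtX => <-; apply: CSeries_ext => k.
transitivity (toC (\sum_(i < k.+1) stretch2 N q i (k - i) * (x ^+ i * t ^+ (k - i)))); last first.
  transitivity (csum (fun i => toC (stretch2 N q i (k - i)%N * (x ^+ i * t ^+ (k - i)))) k).
    exact: toC_sum.
  by apply: csum_ext => i _; rewrite !toCM !toCX.
congr toC; rewrite /compo /homog /=.
transitivity (\sum_(n < k.+1) \sum_(i < n.+1)
   if k == (i + N.+1 * (n - i))%N then q i (n - i)%N * x ^+ i * (t ^+ N.+1) ^+ (n - i) else 0).
  apply: eq_bigr => n _; rewrite fpsE_sum; apply: eq_bigr => i _.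
  exact: coef_monomial_compo.
rewrite (sum_triangle (fun i j => if k == (i + N.+1 * j)%N then q i j * x ^+ i * (t ^+ N.+1) ^+ j else 0)).
apply: eq_bigr => i _; have hi : (i <= k)%N by rewrite -ltnS.
have Ei j : (k == i + N.+1 * j)%N = (k - i == N.+1 * j)%N by rewrite -[RHS](eqn_add2l i) subnKC.
rewrite (eq_bigr (fun j : 'I_(k - i).+1 => if (j : nat) == ((k - i) %/ N.+1)%N then stretch2 N q i (k - i) * (x ^+ i * t ^+ (k - i)) else 0)).
  rewrite -big_mkcond /=.
  have hj : ((k - i) %/ N.+1 < (k - i).+1)%N by rewrite ltnS leq_div.
  by rewrite (big_pred1 (Ordinal hj)).
case=> j hj _; rewrite Ei /stretch2 /= {hj}.
have [E|ne] := eqVneq (k - i)%N (N.+1 * j)%N.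
  by rewrite E dvdn_mulr // mulKn // eqxx -exprM -mulrA.
case: eqP => // Ej; case: ifP; rewrite ?mul0r // => dv; case/eqP: ne.
by rewrite Ej mulnC divnK.
Qed.

(** For [F k] the part of degree [m + k] of a germ with [x = z * y], the sum of this series is the
    value of the germ divided by [y^m]. *)
Definition hat (V : comNzRingType) (z y : V) (F : nat -> {poly V}) : fps V :=
  Fps (fun k => (F k).[z] * y ^+ k).

Lemma hat_mul (V : comNzRingType) (z y : V) (F p q : nat -> {poly V}) :
  (forall k, F k = \sum_(i < k.+1) p i * q (k - i)%N) ->
  hat z y F = hat z y p * hat z y q.
Proof.
move=> HF; apply: fpsP => k; rewrite fpsEM /= HF horner_sum mulr_suml.
apply: eq_bigr => i _; have hi : (i <= k)%N by rewrite -ltnS.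
by rewrite hornerM (exprn_split y hi) mulrACA.
Qed.

Lemma scale_mul_fpsC (V : comNzRingType) (u : fps V) (y z : V) j k :
  (scale y u * fpsC z ^+ j) k = u k * z ^+ j * y ^+ k.
Proof. by rewrite -rmorphXn mulrC fpsECM /= mulrA [z ^+ j * _]mulrC. Qed.

Lemma stretch_fpsC (V : comNzRingType) N (c : V) : stretch N (fpsC c) = fpsC c.
Proof.
apply: fpsP => k; rewrite stretchE /=; case: k => [|k]; first by rewrite dvdn0 div0n.
by case: ifP => // /dvdnP[q Eq]; rewrite Eq mulnK //; case: q Eq.
Qed.

(** The formal factorization, specialised by scaling the series variable by [t] and putting the
    constant [z] for the unknown. Both are ring morphisms, so the identity holds before any sum is
    taken. *)
Lemma hat_stretch (F : rcfType) (p : nat -> {poly F[i]}) d N (zs : seq (fps F[i])) z t :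
  (forall k, (size (p k) <= d)%N) ->
  map_poly (stretch N) (unslice d p) = \prod_(zeta <- zs) ('X - zeta%:P) ->
  stretch N (hat z (t ^+ N.+1) p) = \prod_(zeta <- zs) (fpsC z - scale t zeta).
Proof.
move=> sp E.
have := congr1 (fun G => (map_poly (scale t) G).[fpsC z]) E.
rewrite rmorph_prod horner_prod /=.
under eq_bigr => i _ do rewrite map_polyXsubC hornerXsubC.
move=> <-; rewrite (@horner_coef_wide _ d); last first.
  by apply: leq_trans (size_poly _ _) _; apply: leq_trans (size_poly _ _) _; apply: size_poly.
have -> : hat z (t ^+ N.+1) p = \sum_(j < d) scale (t ^+ N.+1) (unslice d p)`_j * fpsC z ^+ j.
  apply: fpsP => k; rewrite fpsE_sum /hat [LHS]/= (horner_coef_wide _ (sp k)) mulr_suml.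
  by apply: eq_bigr => j _; rewrite scale_mul_fpsC coef_unslice.
rewrite rmorph_sum; apply: eq_bigr => j _; rewrite rmorphM rmorphXn /=.
by rewrite !coef_map /= scale_stretch stretch_fpsC.
Qed.

Lemma geo_bsum_gen (F : rcfType) (u : nat -> F) B : 0 <= B ->
  (forall k, u k <= B * 2^-1 ^+ k) -> forall n, \sum_(k < n) u k <= 2 * B.
Proof.
move=> B0 H n; apply: (@le_trans _ _ (\sum_(k < n) B * 2^-1 ^+ k)).
  by apply: ler_sum => k _; apply: H.
by rewrite -mulr_sumr mulrC; apply: ler_wpM2r => //; apply: sum_pow2V.
Qed.

Lemma geo_bsum (u : nat -> K) B : 0 <= B -> (forall k, nm (u k) <= B * 2^-1 ^+ k) ->
  bsum u (2 * B).
Proof. by move=> B0 H n; apply: (geo_bsum_gen B0 H). Qed.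

Lemma geo_half_gen (F : rcfType) (v M r s : F) k : 0 <= M -> 0 <= r -> 0 <= s ->
  v <= M * r ^+ k -> r * s <= 2^-1 -> v * s ^+ k <= M * 2^-1 ^+ k.
Proof.
move=> M0 r0 s0 h rs; apply: (@le_trans _ _ (M * r ^+ k * s ^+ k)).
  by apply: ler_wpM2r => //; apply: exprn_ge0.
rewrite -mulrA -exprMn; apply: ler_wpM2l => //; apply: lerXn2r => //; rewrite nnegrE.
  exact: mulr_ge0.
by rewrite invr_ge0.
Qed.

(** The degrees of the [p k] are bounded, so any [z] is allowed at the price of a bound that depends
    on [z]. This matters because [z = x / y] is unbounded near the origin. *)
Lemma bsum_hat_bounded (p : nat -> {poly K}) m (M r : RR) z y :
  0 <= M -> 0 <= r -> (forall k, pnw 1 (p k) <= M * r ^+ k) ->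
  (forall k, (size (p k) <= m.+1)%N) -> r * nm y <= 2^-1 ->
  exists B, bsum (hat z y p) B.
Proof.
move=> M0 r0 Hp sp ry; have y0 := nm_ge0 y.
have z1 : 1 <= 1 + nm z by rewrite lerDl nm_ge0.
have z0 : 0 <= 1 + nm z by apply: le_trans z1.
have zm : 0 <= (1 + nm z) ^+ m by apply: exprn_ge0.
exists (2 * ((1 + nm z) ^+ m * M)); apply: geo_bsum; first exact: mulr_ge0.
move=> k /=; rewrite nmM nmX; apply: (@geo_half_gen _ _ _ r) => //; first exact: mulr_ge0.
apply: le_trans (nm_horner_pnw z0 _ _) _; first by rewrite lerDr.
apply: le_trans (pnw_le_pnw1 z1 (sp k)) _.
by rewrite -mulrA; apply: ler_wpM2l.
Qed.

Lemma horner_homog (A : comNzRingType) (p : {poly A}) z y k : (size p <= k.+1)%N ->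
  p.[z] * y ^+ k = \sum_(i < k.+1) p`_i * ((z * y) ^+ i * y ^+ (k - i)).
Proof.
move=> sp; rewrite (horner_coef_wide _ sp) mulr_suml; apply: eq_bigr => i _.
have hi : (i <= k)%N by rewrite -ltnS.
by rewrite (exprn_split y hi) exprMn; ring.
Qed.

Lemma nm_homog_le (F : rcfType) (p : {poly F[i]}) k (s : F) z y :
  (size p <= k.+1)%N ->
  ComplexField.Normc.normc (z * y) <= s -> ComplexField.Normc.normc y <= s ->
  ComplexField.Normc.normc (p.[z] * y ^+ k) <= pnw 1 p * s ^+ k.
Proof.
move=> sp zs ys; have s0 := le_trans (nm_ge0 _) ys.
rewrite horner_homog // (@pnw_widen _ _ _ k.+1) // mulr_suml.
apply: le_trans (nm_sum _ _ _) _; apply: ler_sum => i _.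
have hi : (i <= k)%N by rewrite -ltnS.
rewrite expr1n mulr1 nmM; apply: ler_wpM2l; first exact: nm_ge0.
rewrite nmM !nmX (exprn_split s hi); apply: ler_pM; rewrite ?exprn_ge0 ?nm_ge0 //.
  by apply: lerXn2r; rewrite ?nnegrE ?nm_ge0.
by apply: lerXn2r; rewrite ?nnegrE ?nm_ge0.
Qed.

(** The degree of [q k] grows with [k] while [z] may be large; but [(q k).[z] * y^k] is homogeneous
    of degree [k] in [z * y] and [y], which are both small. *)
Lemma bsum_hat_graded (q : nat -> {poly K}) (M r s : RR) z y :
  0 <= M -> 0 <= r -> (forall k, pnw 1 (q k) <= M * r ^+ k) ->
  (forall k, (size (q k) <= k.+1)%N) -> nm (z * y) <= s -> nm y <= s -> r * s <= 2^-1 ->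
  bsum (hat z y q) (2 * M).
Proof.
move=> M0 r0 Hq sq zs ys rs; have s0 := le_trans (nm_ge0 _) ys.
apply: geo_bsum => // k /=.
apply: le_trans (nm_homog_le (sq k) zs ys) _.
exact: (geo_half_gen M0 r0 s0 (Hq k) rs).
Qed.

Lemma toC_monomial c x y i j :
  toC (c * (x ^+ i * y ^+ j)) = Cmult (toC c) (Cmult (cpow (toC x) i) (cpow (toC y) j)).
Proof. by rewrite 2!toCM !toCX. Qed.

Lemma CS_hat_graded (q : nat -> {poly K}) z y :
  (forall k, (size (q k) <= k.+1)%N) ->
  CS (hat z y q) = eval2 (fun i j => toC (q (i + j)%N)`_i) (toC (z * y)) (toC y).
Proof.
move=> sq; apply: CSeries_ext => k /=; rewrite horner_homog //.
transitivity (csum (fun i => toC ((q k)`_i * ((z * y) ^+ i * y ^+ (k - i)))) k).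
  exact: toC_sum.
apply: csum_ext => i /ssrnat.leP hi.
have -> : (i + Nat.sub k i = k)%N by rewrite minusE subnKC.
exact: toC_monomial.
Qed.

Lemma eval2_germ (A : nat -> nat -> K) m z y B :
  (forall i j, (i + j < m)%N -> A i j = 0) ->
  bsum (hat z y (fun k => \poly_(i < (m + k).+1) A i (m + k - i)%N)) B ->
  eval2 (fun i j => toC (A i j)) (toC (z * y)) (toC y) =
  Cmult (cpow (toC y) m) (CS (hat z y (fun k => \poly_(i < (m + k).+1) A i (m + k - i)%N))).
Proof.
set F := fun k => _; move=> A0 /bsum_asum[hF _]; rewrite /eval2.
rewrite /CS -CSeries_scal //.
have E k : csum (fun i => Cmult (toC (A i (m + k - i)%coq_nat))
     (Cmult (cpow (toC (z * y)) i) (cpow (toC y) (m + k - i)%coq_nat))) (m + k)%N =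
   Cmult (cpow (toC y) m) (toC (hat z y F k)).
  rewrite -toCX -toCM /= mulrCA -exprD horner_homog ?size_poly //.
  transitivity (csum (fun i => toC ((F k)`_i * ((z * y) ^+ i * y ^+ (m + k - i)))) (m + k)%N); last first.
    by symmetry; exact: toC_sum.
  apply: csum_ext => i /ssrnat.leP hi; rewrite coef_poly ltnS hi.
  by symmetry; exact: toC_monomial.
rewrite (CSeries_shift_zero _ m).
- by apply: CSeries_ext => k; rewrite -E plusE.
- move=> n /ssrnat.ltP hn; apply: csum_zero => i /ssrnat.leP hi.
  have E2 : (i + Nat.sub n i = n)%N by rewrite minusE subnKC.
  by rewrite A0 ?E2 // toC0 Cmult_0_l.
- apply: asum_ext (asum_scal (cpow (toC y) m) _ hF) => k.
  by rewrite -E plusE.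
Qed.

Lemma half_radius (F : rcfType) (r : F) : 0 <= r ->
  exists rho, [/\ 0 < rho, rho <= 1, r * rho <= 2^-1 & 4 * (r * rho) <= 1].
Proof.
move=> r0; have d0 : 0 < 4 * r + 1 by apply: ltr_wpDl => //; rewrite mulr_ge0.
have e : r * (4 * r + 1)^-1 = 4^-1 * (1 - (4 * r + 1)^-1) by field; rewrite gt_eqF.
exists (4 * r + 1)^-1; split.
- by rewrite invr_gt0.
- by rewrite invf_le1 // lerDr mulr_ge0.
- have : 0 < (4 * r + 1)^-1 by rewrite invr_gt0.
  by rewrite e; lra.
- have : 0 < (4 * r + 1)^-1 by rewrite invr_gt0.
  by rewrite e; lra.
Qed.

Lemma geo_half_pow (F : rcfType) (v M r s t : F) k : 0 <= M -> 0 <= r -> 0 <= t -> t <= s ->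
  v <= M * r ^+ k -> r * s <= 2^-1 -> v * t ^+ k <= M * 2^-1 ^+ k.
Proof.
move=> M0 r0 t0 ts h rs; apply: (geo_half_gen M0 r0 t0 h).
by apply: le_trans rs; apply: ler_wpM2l.
Qed.

Lemma bsum_scale_conv (u : fps K) : u \in @convs RR ->
  exists rho : RR, 0 < rho /\ forall t, nm t <= rho -> exists B, bsum (scale t u) B.
Proof.
move=> /convsP[M [r [M0 r0 H]]]; have [rho [rho0 _ h _]] := half_radius r0.
exists rho; split => // t ht; exists (2 * M); apply: geo_bsum => // k /=.
by rewrite nmM nmX; apply: (geo_half_pow M0 r0 (nm_ge0 t) ht (H k)).
Qed.

Lemma lt_min_exists (F : rcfType) (x y : F) : 0 < x -> 0 < y ->
  exists z, [/\ 0 < z, z <= x & z <= y].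
Proof.
move=> x0 y0; exists (Num.min x y); split; first by rewrite lt_min x0 y0.
  by rewrite ge_min lexx.
by rewrite ge_min lexx orbT.
Qed.

Lemma bsum_scale_convs (us : seq (fps K)) : (forall u, u \in us -> u \in @convs RR) ->
  exists rho : RR, 0 < rho /\ forall t, nm t <= rho -> forall u, u \in us -> exists B, bsum (scale t u) B.
Proof.
elim: us => [|u us IH] H; first by exists 1; split => //; exact: ltr01.
have [rho [rho0 H1]] := bsum_scale_conv (H u (mem_head _ _)).
have [|rho' [rho0' H2]] := IH _; first by move=> v hv; apply: H; rewrite in_cons hv orbT.
have [z [z0 zx zy]] := lt_min_exists rho0 rho0'.
exists z; split => // t ht v; rewrite in_cons => /orP[/eqP ->|hv].
  by apply: H1; apply: le_trans ht zx.
by apply: H2 => //; apply: le_trans ht zy.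
Qed.

Lemma CS_prod_XsubC (zs : seq (fps K)) z t :
  (forall u, u \in zs -> exists B, bsum (scale t u) B) ->
  (exists B, bsum (\prod_(u <- zs) (fpsC z - scale t u)) B) /\
  CS (\prod_(u <- zs) (fpsC z - scale t u)) = lprod (fun u => Cminus (toC z) (CS (scale t u))) zs.
Proof.
elim: zs => [|u zs IH] H.
  rewrite big_nil; split; last exact: (CS_C 1).
  by exists (nm 1); exact: (bsumC 1).
have [B HB] := H u (mem_head _ _).
have [|[B' HB'] E] := IH _; first by move=> v hv; apply: H; rewrite in_cons hv orbT.
have hb : bsum (fpsC z - scale t u) (nm z + B) by apply: bsumD (bsumC z) (bsumN HB).
rewrite big_cons; split; first by eexists; apply: bsumM hb HB'.
by rewrite (CS_M hb HB') E (CS_B (bsumC z) HB) CS_C.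
Qed.

Lemma CS_scale_tXn (u : fps K) n t B : bsum (scale t u) B ->
  CS (scale t (tX K ^+ n * u)) = Cmult (cpow (toC t) n) (CS (scale t u)).
Proof.
move=> H; rewrite rmorphM rmorphXn /= scale_tX exprMn -rmorphXn /=.
by rewrite (CS_M (bsum_CtX _ n) H) CS_CtX toCX.
Qed.

Lemma toC_real (t : RR) : toC (t%:C)%C = RtoC t. Proof. by []. Qed.

Lemma pval_CS (u : fps K) (t : RR) : pval (fun k => toC (u k)) t = CS (scale (t%:C)%C u).
Proof. by apply: CSeries_ext => k; rewrite /= toCM toCX toC_real RtoC_cpow. Qed.

Lemma pow_mul_inv_gen (F : rcfType) (v M r : F) k : 0 <= M -> 0 <= r ->
  v <= M * r ^+ k -> v * (r + 1)^-1 ^+ k <= M.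
Proof.
move=> M0 r0 h; have r1 : 0 < r + 1 by apply: ltr_wpDl.
have p0 : 0 < (r + 1) ^+ k by apply: exprn_gt0.
rewrite exprVn ler_pdivrMr //; apply: le_trans h _.
by apply: ler_wpM2l => //; apply: lerXn2r; rewrite ?nnegrE ?lerDl // ltW.
Qed.

Lemma conv1_toC (u : fps K) : u \in @convs RR -> conv1 (fun k => toC (u k)).
Proof.
move=> /convsP[M [r [M0 r0 H]]]; exists (r + 1)^-1, M; split.
  by apply/RltP; rewrite invr_gt0 ltr_wpDl.
move=> k; rewrite Cmod_toC; apply/RleP; rewrite RmultE RpowE.
exact: (pow_mul_inv_gen M0 r0 (H k)).
Qed.

Lemma conv2_toC (q : nat -> nat -> K) (M r : RR) : 0 <= M -> 0 <= r ->
  (forall i j, nm (q i j) <= M * r ^+ (i + j)) -> conv2 Cmod (fun i j => toC (q i j)).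
Proof.
move=> M0 r0 H; exists (r + 1)^-1, M; split.
  by apply/RltP; rewrite invr_gt0 ltr_wpDl.
move=> i j; rewrite Cmod_toC; apply/RleP; rewrite RmultE RpowE.
exact: (pow_mul_inv_gen M0 r0 (H i j)).
Qed.

Lemma conv2_geo (T : Type) (N : T -> RR) (a : nat -> nat -> T) : (forall x, 0 <= N x) ->
  conv2 N a -> exists M r : RR, [/\ 0 <= M, 0 <= r & forall i j, N (a i j) <= M * r ^+ (i + j)].
Proof.
move=> N0 [r [M [/RltP r0 H]]]; exists M, r^-1; split.
- apply: le_trans (N0 (a 0%N 0%N)) _; have /RleP := H 0%N 0%N.
  by rewrite RmultE RpowE expr0 mulr1.
- by rewrite invr_ge0 ltW.
- move=> i j; have /RleP := H i j; rewrite RmultE RpowE => h.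
  by rewrite exprVn ler_pdivlMr // exprn_gt0.
Qed.

Lemma geo_germ (F : rcfType) (A : nat -> nat -> F[i]) (M r : F) m : 0 <= M -> 0 <= r ->
  (forall i j, ComplexField.Normc.normc (A i j) <= M * r ^+ (i + j)) ->
  geo (pnw 1) (fun k => \poly_(i < (m + k).+1) A i (m + k - i)%N).
Proof.
move=> M0 r0 H; exists (M * (2 * r) ^+ m), (2 * r).
split; rewrite ?mulr_ge0 ?exprn_ge0 ?mulr_ge0 // => k.
rewrite -mulrA -exprD (@pnw_widen _ _ _ (m + k).+1) ?size_poly //.
apply: (@le_trans _ _ (\sum_(i < (m + k).+1) M * r ^+ (m + k))).
  apply: ler_sum => i _; rewrite coef_poly ltn_ord expr1n mulr1.
  have hi : (i <= m + k)%N by rewrite -ltnS.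
  by have := H i (m + k - i)%N; rewrite subnKC.
rewrite sumr_const card_ord -mulrnAr; apply: ler_wpM2l => //.
rewrite exprMn -mulr_natl; apply: ler_wpM2r; first exact: exprn_ge0.
by rewrite -natrX ler_nat ltn_expl.
Qed.

Lemma size_germ0 (F : idomainType) (A : nat -> nat -> F) m : A m 0%N != 0 ->
  size (\poly_(i < (m + 0).+1) A i (m + 0 - i)%N) = m.+1.
Proof. by rewrite addn0 => H; apply: size_poly_eq; rewrite /= subnn. Qed.

(** * Puiseux factorization of a real germ *)

Lemma formal_factorization (F : rcfType) (A : nat -> nat -> F[i]) (M r : F) m :
  0 <= M -> 0 <= r -> (forall i j, ComplexField.Normc.normc (A i j) <= M * r ^+ (i + j)) ->
  A m.+1 0%N != 0 ->
  exists (p q : nat -> {poly F[i]}) N0 (zs : seq (fps F[i])),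
  [/\ forall k, \poly_(i < (m.+1 + k).+1) A i (m.+1 + k - i)%N = \sum_(i < k.+1) p i * q (k - i)%N,
      (forall k, (size (p k) <= m.+2)%N /\ (size (q k) <= k.+1)%N) /\ (q 0%N)`_0 != 0,
      geo (pnw 1) p /\ geo (pnw 1) q,
      size zs = m.+1 /\ (forall z, z \in zs -> z \in @convs F) &
      map_poly (stretch N0) (unslice m.+2 p) = \prod_(z <- zs) ('X - z%:P)].
Proof.
move=> M0 r0 H Am; pose G k : {poly F[i]} := \poly_(i < (m.+1 + k).+1) A i (m.+1 + k - i)%N.
have sG k : (size (G k) <= (m.+1 + k).+1)%N by apply: size_poly.
have [p [q [[pm sp0] [c c0 q0] Epq sz [gp gq]]]] :=
  preparation (F := G) (size_germ0 Am) sG (geo_germ m.+1 M0 r0 H).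
have [Pm sP] := unslice_monic pm sp0 (fun k => proj1 (sz k)).
have [N0 [zs [czs Ezs]]] := newton_puiseux Pm (unslice_conv _ gp).
exists p, q, N0, zs; split => //.
- split; last by rewrite q0 coefC.
  by move=> k; have [h1 h2] := sz k; split => //; case: k {h1 h2} => [|k];
    [rewrite sp0|apply: leqW; have [] := sz k].
- split => //; apply: succn_inj.
  have := size_map_poly_id0 (f := stretch N0) (p := unslice m.+2 p).
  by rewrite (monicP Pm) rmorph1 oner_neq0 Ezs size_prod_XsubC sP => ->.
Qed.

Lemma lprod_map (T U : Type) (h : T -> U) (f : U -> Complex.C) (l : seq T) :
  lprod f [seq h i | i <- l] = lprod (fun v => f (h v)) l.
Proof. by elim: l => //= v l ->. Qed.

Lemma lprod_ext_in (T : eqType) (f g : T -> Complex.C) (l : seq T) :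
  (forall v, v \in l -> f v = g v) -> lprod f l = lprod g l.
Proof.
elim: l => //= v l IH H; rewrite H ?mem_head // IH // => w hw.
by apply: H; rewrite in_cons hw orbT.
Qed.

Lemma length_size (T : Type) (l : seq T) : length l = size l.
Proof. by elim: l => //= v l ->. Qed.

Lemma Forall_map_seq (T : eqType) (U : Type) (h : T -> U) (P : U -> Prop) (l : seq T) :
  (forall v, v \in l -> P (h v)) -> List.Forall P [seq h i | i <- l].
Proof.
elim: l => [|v l IH] H /=; first exact: List.Forall_nil.
apply: List.Forall_cons; first by apply: H; rewrite mem_head.
by apply: IH => w hw; apply: H; rewrite in_cons hw orbT.
Qed.

(** The factor [L + 1] in the ramification lets two germs be factored with the same parameter [t].
    The unit, at first a series in [x] and [y], is rewritten as a series in [x] and [t] by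
    [eval2_stretch]. *)
Theorem puiseux_factorization (a : nat -> nat -> RR) :
  conv2 Rabs a -> regular_x a -> a 0%N 0%N = IZR 0 ->
  exists N0 : nat, forall L : nat, let N := (N0.+1 * L.+1)%N in
  exists (Phi : list (nat -> Complex.C)) (U : nat -> nat -> Complex.C),
    Phi <> nil /\
    List.Forall (fun phi => phi 0%N = RtoC (IZR 0) /\ conv1 phi) Phi /\
    conv2 Cmod U /\ U 0%N 0%N <> RtoC (IZR 0) /\
    exists r, Rlt (IZR 0) r /\ forall x t, Rlt (Cmod x) r -> Rlt (IZR 0) t -> Rlt t r ->
      eval2 (fun i j => RtoC (a i j)) x (RtoC (pow t N)) =
      Cmult (eval2 U x (RtoC t)) (lprod (fun phi => Cminus x (pval phi t)) Phi).
Proof.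
move=> ca [m0 [am0 alow]] a00.
have [m Em] : exists m, m0 = m.+1.
  by case: m0 am0 alow => [|m] am0 _; [case: am0|exists m].
subst m0; have [M [r [M0 r0 Ha]]] := conv2_geo (fun x => introT RleP (Rabs_pos x)) ca.
pose A i j : K := (a i j)%:C%C.
have HA i j : nm (A i j) <= M * r ^+ (i + j).
  apply: le_trans (Ha i j); rewrite /A -Cmod_toC toC_real Cmod_R; exact: lexx.
have Am : A m.+1 0%N != 0 by apply/eqP => -[].
have Alow i j : (i + j < m.+1)%N -> A i j = 0.
  by move=> /ssrnat.ltP h; rewrite /A alow.
have [p [q [N0 [zs [EF [sz q00] [gp gq] [szs czs] Ezs]]]]] := formal_factorization M0 r0 HA Am.
exists N0 => L N; have [Mp [rp [Mp0 rp0 Hp]]] := gp; have [Mq [rq [Mq0 rq0 Hq]]] := gq.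
pose N' := N.-1; have EN : N'.+1 = N by rewrite /N' prednK // muln_gt0.
pose us := map (stretch L) zs.
have sus : size us = m.+1 by rewrite size_map.
have cus u : u \in us -> u \in @convs RR.
  by move=> /mapP[z hz ->]; apply: convs_stretch; apply: czs.
have Eus : map_poly (stretch N') (unslice m.+2 p) = \prod_(z <- us) ('X - z%:P).
  by rewrite -map_stretch_stretch Ezs map_prod_XsubC.
have sp k : (size (p k) <= m.+2)%N by have [] := sz k.
have sq k : (size (q k) <= k.+1)%N by have [] := sz k.
have qb i j : nm ((q (i + j)%N)`_i) <= Mq * rq ^+ (i + j).
  apply: le_trans (Hq _); have := nm_coef_pnw ler01 (q (i + j)%N) i.
  by rewrite expr1n mulr1.
pose U0 i j := stretch2 N' (fun i j => (q (i + j)%N)`_i) i j.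
(* The roots in [x = z * y] are [t^N] times the roots in [z], so their constant terms vanish. *)
exists [seq (fun k => toC ((tX K ^+ N * u) k)) | u <- us], (fun i j => toC (U0 i j)).
split; first by move: sus; case: (us).
split.
  apply: Forall_map_seq => u hu; split.
    by rewrite fpsEM0 tXn -EN mul0r.
  by apply: conv1_toC; rewrite rpredM ?rpredX ?convs_tX ?cus.
split.
  apply: (@conv2_toC _ Mq (rq + 1)) => //; first exact: addr_ge0.
  move=> i j; rewrite /U0 /stretch2; case: ifP => _; last first.
    by rewrite nm0 mulr_ge0 ?exprn_ge0 ?addr_ge0.
  apply: le_trans (qb _ _) _; apply: ler_wpM2l => //.
  apply: (@le_trans _ _ ((rq + 1) ^+ (i + j %/ N'.+1))).
    by apply: lerXn2r; rewrite ?nnegrE ?addr_ge0 // lerDl.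
  by apply: ler_weXn2l; rewrite ?lerDr // leq_add2l leq_div.
split.
  rewrite /U0 /stretch2 dvdn0 div0n => E; case/eqP: q00.
  by apply: toC_inj; rewrite E.
have [rho1 [rho10 Hus]] := bsum_scale_convs cus.
have [rho2 [rho20 rho21 h2 _]] := half_radius rp0.
have [rho3 [rho30 rho31 h3 h3']] := half_radius rq0.
have [s1 [s10 s11 s12]] := lt_min_exists rho10 rho20.
have [s [s0 ss1 ss3]] := lt_min_exists s10 rho30.
have s_1 : s <= 1 by apply: le_trans ss3 _.
have h2s : rp * s <= 2^-1 by apply: le_trans h2; apply: ler_wpM2l => //; apply: le_trans ss1 _.
have h3s : rq * s <= 2^-1 by apply: le_trans h3; apply: ler_wpM2l.
have h3s' : 4 * (rq * s) <= 1.
  by apply: le_trans h3'; apply: ler_wpM2l => //; apply: ler_wpM2l.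
exists s; split; first exact/RltP.
move=> x' t' /RltP hx /RltP t0 /RltP ts.
pose x := ofC x'; pose t : K := (t'%:C)%C; pose y := t ^+ N'.+1.
have nx : nm x <= s by rewrite nm_ofC ltW.
have nt : nm t = t' by rewrite -Cmod_toC toC_real Cmod_R Rabs_pos_eq //; apply/RleP/ltW.
have nts : nm t <= s by rewrite nt ltW.
have ny : nm y <= s.
  rewrite nmX exprS; apply: le_trans (nts); rewrite -[X in _ <= X]mulr1.
  apply: ler_wpM2l; first exact: nm_ge0.
  by apply: exprn_ile1; rewrite ?nm_ge0 //; apply: le_trans nts s_1.
have t_neq0 : t != 0 by apply/eqP => -[E]; move: t0; rewrite E ltxx.
have y0 : y != 0 by rewrite expf_neq0.
(* Dividing by [y] needs [t > 0]. On the axis [y = 0] the factorization says nothing, and the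
   inequality there is obtained by continuity. *)
pose z := x / y; have zy : z * y = x by rewrite /z divfK.
have Hus' u : u \in us -> exists B, bsum (scale t u) B.
  by apply: Hus; apply: le_trans nts (le_trans ss1 s11).
have [[B HB] Eprod] := CS_prod_XsubC z Hus'.
have Ehat := hat_stretch z t sp Eus.
have [Bp HBp] := bsum_hat_bounded z Mp0 rp0 Hp sp (le_trans (ler_wpM2l rp0 ny) h2s).
have zys : nm (z * y) <= s by rewrite zy.
have HBq := bsum_hat_graded Mq0 rq0 Hq sq zys ny h3s.
have HF := hat_mul z y EF.
have HBF := bsumM HBp HBq; rewrite -HF in HBF.
have := eval2_germ Alow HBF; rewrite zy HF (CS_M HBp HBq) (CS_hat_graded z y sq) zy.
rewrite (eval2_stretch Mq0 rq0 qb nx ny h3s').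
have -> : toC y = RtoC (pow t' N) by rewrite /y toCX toC_real RtoC_cpow EN.
rewrite [toC x]ofCK => ->.
have -> : CS (hat z y p) = lprod (fun u => Cminus (toC z) (CS (scale t u))) us.
  (* [hat z y p] proceeds by powers of [y], the product of the root factors by powers of [t]; the
     second is the stretched first and has the same sum. *)
  rewrite -Eprod -Ehat; symmetry; apply: (CSeries_subsequence _ _ (fun k => k %/ N'.+1)%N).
  - by have [] := bsum_asum HBp.
  - by move=> n0; exists (n0 * N'.+1)%N => n /ssrnat.leP hn; apply/ssrnat.leP; rewrite leq_divRL.
  move=> k; transitivity (toC (\sum_(i < k.+1) stretch N' (hat z y p) i)).
    by symmetry; exact: toC_sum.
  rewrite (sum_stretch N' (hat z y p)); exact: toC_sum.
rewrite Cmult_rotate; congr Cmult.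
rewrite lprod_map -sus -length_size.
have -> : RtoC (pow t' N) = toC y by rewrite /y toCX toC_real RtoC_cpow EN.
rewrite lprod_scale; apply: lprod_ext_in => u hu; have [B' HB'] := Hus' u hu.
rewrite pval_CS (CS_scale_tXn N HB') -toCM zy [toC x]ofCK /y EN.
by rewrite toCX.
Qed.

(** * Substitution of a Puiseux series *)

Lemma bsum_scale_unif (u : fps K) : u \in @convs RR -> u 0%N = 0 -> forall s : RR, 0 < s ->
  exists rho : RR, 0 < rho /\ forall t, nm t <= rho -> bsum (scale t u) s.
Proof.
move=> cu u0 s s0; have cd := convs_dropu 1 cu.
have /convsP[M [r [M0 r0 H]]] := cd; have [rho1 [rho10 _ h _]] := half_radius r0.
have d0 : 0 < 2 * M + 1 by apply: ltr_wpDl => //; rewrite mulr_ge0.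
have q0 : 0 < s / (2 * M + 1) by apply: divr_gt0.
have [rho [rho0 h1 h2]] := lt_min_exists rho10 q0.
exists rho; split => // t ht.
have hb : bsum (scale t (dropu 1 u)) (2 * M).
  apply: geo_bsum => // k /=.
  by rewrite nmM nmX; apply: (geo_half_pow M0 r0 (nm_ge0 t) (le_trans ht h1) (H k)).
have Eu : u = tX K * dropu 1 u by rewrite -[tX K]expr1 dropuK // => -[].
have -> : scale t u = fpsC t * tX K ^+ 1 * scale t (dropu 1 u).
  by rewrite {1}Eu -[tX K ^+ 1]/(tX K) -scale_tX; exact: rmorphM.
apply: (bsum_le _ (bsumM (bsum_CtX t 1) hb)).
apply: (@le_trans _ _ (s / (2 * M + 1) * (2 * M + 1))); last by rewrite divfK // gt_eqF.
apply: ler_pM; rewrite ?nm_ge0 ?mulr_ge0 ?lerDl //.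
exact: le_trans ht h2.
Qed.

Lemma convs_ofC (g : nat -> Complex.C) : conv1 g -> Fps (fun k => ofC (g k)) \in @convs RR.
Proof.
move=> [r [M [/RltP r0 H]]]; apply/convsP; exists M, r^-1; split.
- have := H 0%N; rewrite Rmult_1_r => h; apply/RleP; apply: Rle_trans h; exact: Cmod_ge_0.
- by rewrite invr_ge0 ltW.
- move=> k; have /RleP := H k; rewrite RmultE RpowE /= nm_ofC => h.
  by rewrite exprVn ler_pdivlMr // exprn_gt0.
Qed.

(** [has_ord] asks for a convergent expansion of the germ along an arc. It is provided here without
    formulas for the coefficients; the order is determined later from the size of the values. *)
Theorem subst_series (c : nat -> nat -> Complex.C) (N : nat) (g : nat -> Complex.C) :
  conv2 Cmod c -> conv1 g -> g 0%N = RtoC (IZR 0) -> (0 < N)%N ->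
  exists d, conv1 d /\ exists r, Rlt (IZR 0) r /\ forall t, Rlt (IZR 0) t -> Rlt t r ->
    eval2 c (pval g t) (RtoC (pow t N)) = pval d t.
Proof.
move=> cc cg g0 N0; have [M [sg [M0 sg0 Hc]]] := conv2_geo (fun x => introT RleP (Cmod_ge_0 x)) cc.
pose A i j := ofC (c i j); pose X := Fps (fun k => ofC (g k)); pose Y := tX K ^+ N.
have HA i j : nm (A i j) <= M * sg ^+ (i + j) by rewrite nm_ofC.
have [s [s0 _ _ small]] := half_radius sg0.
have X0 : X 0%N = 0 by rewrite /X /= g0.
have Y0 : Y 0%N = 0 by rewrite /Y tXn; case: (N) N0.
have cY : Y \in @convs RR by rewrite rpredX ?convs_tX.
have [r1 [r10 H1]] := bsum_scale_unif (convs_ofC cg) X0 s0.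
have [r2 [r20 H2]] := bsum_scale_unif cY Y0 s0.
have [r [r0 rr1 rr2]] := lt_min_exists r10 r20.
have X0' t : scale t X 0%N = 0 by rewrite /= g0 mul0r.
have Y0' t : scale t Y 0%N = 0 by rewrite [LHS]/= Y0 mul0r.
have nmt (t : RR) : 0 < t -> nm (t%:C)%C = t.
  by move=> t0; rewrite -Cmod_toC toC_real Cmod_R Rabs_pos_eq //; apply/RleP/ltW.
exists (fun k => toC (compo A X Y k)); split.
  exists r, (2 * M); split; first exact/RltP.
  move=> k; rewrite Cmod_toC; apply/RleP; rewrite RmultE RpowE.
  have nr : nm (r%:C)%C <= r by rewrite nmt.
  have := bsum_compo M0 sg0 HA (X0' (r%:C)%C) (Y0' (r%:C)%C) (H1 _ (le_trans nr rr1))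
    (H2 _ (le_trans nr rr2)) small.
  rewrite -compo_scale => /(_ k.+1); rewrite big_ord_recr /= nmM nmX nmt //.
  by apply: le_trans; rewrite lerDr; apply: sumr_ge0 => i _; apply: nm_ge0.
exists r; split; first exact/RltP.
move=> t /RltP t0 /RltP tr; have nt : nm (t%:C)%C <= r by rewrite nmt // ltW.
rewrite pval_CS compo_scale.
rewrite (CS_compo M0 sg0 HA (X0' _) (Y0' _) (H1 _ (le_trans nt rr1)) (H2 _ (le_trans nt rr2)) small).
have -> : CS (scale (t%:C)%C X) = pval g t.
  by rewrite -pval_CS; apply: CSeries_ext => k; rewrite ofCK.
have -> : CS (scale (t%:C)%C Y) = RtoC (pow t N).
  rewrite /Y rmorphXn /= scale_tX exprMn -rmorphXn /= CS_CtX toCX toC_real RtoC_cpow //.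
apply: CSeries_ext => n; apply: csum_ext => i _; by rewrite ofCK.
Qed.

End Puiseux.

(** * Continuity of germs *)

Lemma INR_lt_pow2 n : INR (S n) <= 2 ^ n.
Proof.
induction n; [simpl; lra|].
rewrite S_INR; replace (2 ^ S n) with (2 ^ n + 2 ^ n) by (simpl; ring).
assert (1 <= 2 ^ n) by (apply pow_R1_Rle; lra); lra.
Qed.

Lemma Cmod_cpow x n : Cmod (cpow x n) = Cmod x ^ n.
Proof. induction n; simpl; [apply Cmod_1|now rewrite Cmod_mult, IHn]. Qed.

Lemma Cmod_cpow_le x s n : Cmod x <= s -> Cmod (cpow x n) <= s ^ n.
Proof. intros H; rewrite Cmod_cpow; apply pow_incr; split; [apply Cmod_ge_0|exact H]. Qed.

Lemma cpow_diff x x' s n : Cmod x <= s -> Cmod x' <= s ->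
  s * Cmod (Cminus (cpow x n) (cpow x' n)) <= INR n * s ^ n * Cmod (Cminus x x').
Proof.
intros H H'; assert (s0 : 0 <= s) by (eapply Rle_trans; [apply Cmod_ge_0|exact H]).
induction n.
  simpl; replace (Cminus (RtoC 1) (RtoC 1)) with (RtoC 0) by ring; rewrite Cmod_0; lra.
replace (Cminus (cpow x (S n)) (cpow x' (S n))) with
  (Cplus (Cmult x (Cminus (cpow x n) (cpow x' n))) (Cmult (Cminus x x') (cpow x' n)))
  by (simpl; ring).
apply Rle_trans with (s * (s * Cmod (Cminus (cpow x n) (cpow x' n)) + Cmod (Cminus x x') * s ^ n)).
  apply Rmult_le_compat_l; [lra|].
  eapply Rle_trans; [apply Cmod_triangle|]; rewrite !Cmod_mult; apply Rplus_le_compat.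
    apply Rmult_le_compat_r; [apply Cmod_ge_0|lra].
  apply Rmult_le_compat_l; [apply Cmod_ge_0|now apply Cmod_cpow_le].
rewrite S_INR; simpl.
apply (Rmult_le_compat_l s) in IHn; [|lra]; lra.
Qed.

Definition hterm (c : nat -> nat -> C) (x t : C) (n : nat) : C :=
  csum (fun i => Cmult (c i (n - i)%nat) (Cmult (cpow x i) (cpow t (n - i)%nat))) n.

Lemma Cmod_csum_const u B n : (forall k, (k <= n)%nat -> Cmod (u k) <= B) ->
  Cmod (csum u n) <= INR (S n) * B.
Proof.
induction n; intros H.
  simpl; specialize (H 0%nat (le_n _)); lra.
change (csum u (S n)) with (Cplus (csum u n) (u (S n))).
eapply Rle_trans; [apply Cmod_triangle|].
rewrite (S_INR (S n)), Rmult_plus_distr_r, Rmult_1_l; apply Rplus_le_compat.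
  apply IHn; intros k hk; apply H; lia.
apply H; lia.
Qed.

Lemma csum_minus u v n : csum (fun k => Cminus (u k) (v k)) n = Cminus (csum u n) (csum v n).
Proof. induction n; simpl; [reflexivity|]; rewrite IHn; ring. Qed.

Lemma pow_split s i n : (i <= n)%nat -> s ^ n = s ^ i * s ^ (n - i).
Proof. intros H; rewrite <- pow_add; f_equal; lia. Qed.

(** One factor [n + 1] counts the monomials of degree [n], the other comes from the difference of
    two powers; hence the radius [r / 8] in the Lipschitz estimate. *)
Lemma pow8 n : INR (S n) * INR (S n) * (/ 8) ^ n <= (/ 2) ^ n.
Proof.
pose proof (INR_lt_pow2 n); pose proof (pos_INR (S n)).
replace ((/ 2) ^ n) with (2 ^ n * 2 ^ n * (/ 8) ^ n).
  apply Rmult_le_compat_r; [apply pow_le; lra|]; apply Rmult_le_compat; lra.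
rewrite <- !Rpow_mult_distr; f_equal; field.
Qed.

Section Eval2.
Variables (c : nat -> nat -> C) (r M : R).
Hypothesis r0 : 0 < r.
Hypothesis Hc : forall i j, Cmod (c i j) * r ^ (i + j) <= M.
Let s := r / 8.

Lemma coef_bound i n : (i <= n)%nat -> Cmod (c i (n - i)%nat) * s ^ n <= M * (/ 8) ^ n.
Proof.
intros H; unfold s, Rdiv; rewrite Rpow_mult_distr, <- Rmult_assoc.
apply Rmult_le_compat_r; [apply pow_le; lra|].
specialize (Hc i (n - i)%nat); now replace (i + (n - i))%nat with n in Hc by lia.
Qed.

Lemma eval2_M_ge0 : 0 <= M.
Proof.
eapply Rle_trans; [|apply (Hc 0 0)]; simpl; pose proof (Cmod_ge_0 (c 0%nat 0%nat)); lra.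
Qed.

Lemma hterm_bound x t n : Cmod x <= s -> Cmod t <= s ->
  Cmod (hterm c x t n) <= M * (/ 2) ^ n.
Proof.
intros Hx Ht; unfold hterm; pose proof eval2_M_ge0 as M0.
apply Rle_trans with (INR (S n) * (M * (/ 8) ^ n)).
  apply Cmod_csum_const; intros i hi; rewrite !Cmod_mult.
  eapply Rle_trans; [|apply (coef_bound i n hi)].
  apply Rmult_le_compat_l; [apply Cmod_ge_0|].
  rewrite (pow_split s i n hi); apply Rmult_le_compat; try apply Cmod_ge_0; now apply Cmod_cpow_le.
rewrite <- Rmult_assoc, (Rmult_comm _ M), Rmult_assoc; apply Rmult_le_compat_l; [lra|].
eapply Rle_trans; [|apply pow8].
apply Rmult_le_compat_r; [apply pow_le; lra|].
rewrite S_INR; pose proof (pos_INR n); nra.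
Qed.

Lemma hterm_asum x t : Cmod x <= s -> Cmod t <= s -> asum (hterm c x t).
Proof.
intros Hx Ht; apply (asum_geom _ M (/ 2)); [lra|]; intros n; now apply hterm_bound.
Qed.

Lemma hterm_diff x t x' t' n :
  Cmod x <= s -> Cmod t <= s -> Cmod x' <= s -> Cmod t' <= s ->
  s * Cmod (Cminus (hterm c x t n) (hterm c x' t' n)) <=
  M * (Cmod (Cminus x x') + Cmod (Cminus t t')) * (/ 2) ^ n.
Proof.
intros Hx Ht Hx' Ht'; pose proof eval2_M_ge0 as M0.
assert (s0 : 0 < s) by (unfold s; lra).
set (d := Cmod (Cminus x x') + Cmod (Cminus t t')).
pose proof (Cmod_ge_0 (Cminus x x')) as dx0; pose proof (Cmod_ge_0 (Cminus t t')) as dt0.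
unfold hterm; rewrite <- csum_minus.
apply Rle_trans with (s * (INR (S n) * (/ s * (INR (S n) * (M * (/ 8) ^ n) * d)))).
  apply Rmult_le_compat_l; [lra|]; apply Cmod_csum_const; intros i hi.
  replace (Cminus (Cmult (c i (n - i)%nat) (Cmult (cpow x i) (cpow t (n - i))))
    (Cmult (c i (n - i)%nat) (Cmult (cpow x' i) (cpow t' (n - i))))) with
    (Cmult (c i (n - i)%nat) (Cplus (Cmult (Cminus (cpow x i) (cpow x' i)) (cpow t (n - i)))
        (Cmult (cpow x' i) (Cminus (cpow t (n - i)) (cpow t' (n - i)))))) by ring.
  apply Rmult_le_reg_l with s; [lra|].
  replace (s * (/ s * (INR (S n) * (M * (/ 8) ^ n) * d))) with
    (INR (S n) * (M * (/ 8) ^ n) * d) by (field; lra).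
  rewrite Cmod_mult.
  apply Rle_trans with (Cmod (c i (n - i)%nat) * (INR (S n) * s ^ n * d)).
    rewrite <- Rmult_assoc, (Rmult_comm s), Rmult_assoc.
    apply Rmult_le_compat_l; [apply Cmod_ge_0|].
    eapply Rle_trans; [apply Rmult_le_compat_l; [lra|apply Cmod_triangle]|].
    rewrite !Cmod_mult, Rmult_plus_distr_l.
    pose proof (cpow_diff x x' s i Hx Hx') as D1.
    pose proof (cpow_diff t t' s (n - i) Ht Ht') as D2.
    pose proof (Cmod_cpow_le t s (n - i) Ht) as B1.
    pose proof (Cmod_cpow_le x' s i Hx') as B2.
    apply Rle_trans with (INR i * s ^ n * Cmod (Cminus x x') + INR (n - i) * s ^ n * Cmod (Cminus t t')).
      apply Rplus_le_compat.
        rewrite <- Rmult_assoc, (pow_split s i n hi).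
        replace (INR i * (s ^ i * s ^ (n - i)) * Cmod (Cminus x x')) with
          ((INR i * s ^ i * Cmod (Cminus x x')) * s ^ (n - i)) by ring.
        apply Rmult_le_compat; auto; [|apply Cmod_ge_0].
        apply Rmult_le_pos; [lra|apply Cmod_ge_0].
      replace (s * (Cmod (cpow x' i) * Cmod (Cminus (cpow t (n - i)) (cpow t' (n - i))))) with
        (Cmod (cpow x' i) * (s * Cmod (Cminus (cpow t (n - i)) (cpow t' (n - i))))) by ring.
      rewrite (pow_split s i n hi).
      replace (INR (n - i) * (s ^ i * s ^ (n - i)) * Cmod (Cminus t t')) with
        (s ^ i * (INR (n - i) * s ^ (n - i) * Cmod (Cminus t t'))) by ring.
      apply Rmult_le_compat; auto; [apply Cmod_ge_0|].
      apply Rmult_le_pos; [lra|apply Cmod_ge_0].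
    assert (I1 : INR i <= INR (S n)) by (apply le_INR; lia).
    assert (I2 : INR (n - i) <= INR (S n)) by (apply le_INR; lia).
    assert (P : 0 <= s ^ n) by (apply pow_le; lra).
    unfold d; rewrite Rmult_plus_distr_l; apply Rplus_le_compat;
      (apply Rmult_le_compat_r; [assumption|]); now apply Rmult_le_compat_r.
  replace (Cmod (c i (n - i)%nat) * (INR (S n) * s ^ n * d)) with
    (INR (S n) * (Cmod (c i (n - i)%nat) * s ^ n) * d) by ring.
  apply Rmult_le_compat_r; [unfold d; lra|].
  apply Rmult_le_compat_l; [apply pos_INR|now apply coef_bound].
replace (s * (INR (S n) * (/ s * (INR (S n) * (M * (/ 8) ^ n) * d)))) with
  (M * d * (INR (S n) * INR (S n) * (/ 8) ^ n)) by (field; lra).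
apply Rmult_le_compat_l; [apply Rmult_le_pos; [lra|unfold d; lra]|apply pow8].
Qed.

End Eval2.

Lemma CSeries_minus u v : asum u -> asum v ->
  asum (fun n => Cminus (u n) (v n)) /\
  CSeries (fun n => Cminus (u n) (v n)) = Cminus (CSeries u) (CSeries v).
Proof.
intros Hu Hv; pose proof (asum_scal (RtoC (-1)) v Hv) as Hv'.
assert (E : forall n, Cplus (u n) (Cmult (RtoC (-1)) (v n)) = Cminus (u n) (v n)).
  intros n; replace (RtoC (-1)) with (Copp (RtoC 1)) by (rewrite <- RtoC_opp; f_equal; ring); ring.
split.
  apply asum_ext with (1 := E), asum_plus; auto.
rewrite <- (CSeries_ext _ _ E), CSeries_plus, CSeries_scal; auto.
replace (RtoC (-1)) with (Copp (RtoC 1)) by (rewrite <- RtoC_opp; f_equal; ring); ring.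
Qed.

Lemma eval2_lip c : conv2 Cmod c -> exists s L, 0 < s /\ 0 <= L /\
  forall x t x' t', Cmod x <= s -> Cmod t <= s -> Cmod x' <= s -> Cmod t' <= s ->
  Cmod (Cminus (eval2 c x t) (eval2 c x' t')) <= L * (Cmod (Cminus x x') + Cmod (Cminus t t')).
Proof.
intros [r [M [r0 Hc]]]; exists (r / 8), (2 * M / (r / 8)).
assert (M0 : 0 <= M) by (apply (eval2_M_ge0 c r M); auto).
assert (s0 : 0 < r / 8) by lra.
split; [lra|]; split.
  apply Rmult_le_pos; [lra|]; left; now apply Rinv_0_lt_compat.
intros x t x' t' Hx Ht Hx' Ht'.
set (d := Cmod (Cminus x x') + Cmod (Cminus t t')).
pose proof (hterm_asum c r M Hc x t Hx Ht) as A.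
pose proof (hterm_asum c r M Hc x' t' Hx' Ht') as A'.
destruct (CSeries_minus _ _ A A') as [_ E].
change (eval2 c x t) with (CSeries (hterm c x t)).
change (eval2 c x' t') with (CSeries (hterm c x' t')).
rewrite <- E.
destruct (asum_geom (fun n => Cminus (hterm c x t n) (hterm c x' t' n)) (M * d / (r / 8)) (/ 2)) as [_ B].
- lra.
- intros n; pose proof (hterm_diff c r M r0 Hc x t x' t' n Hx Ht Hx' Ht') as D; fold d in D.
  apply Rmult_le_reg_l with (r / 8); [lra|].
  replace (r / 8 * (M * d / (r / 8) * (/ 2) ^ n)) with (M * d * (/ 2) ^ n) by (field; lra).
  exact D.
- eapply Rle_trans; [exact B|]; apply Req_le; field; lra.
Qed.

Lemma cpow_0_S n : cpow (RtoC 0) (S n) = RtoC 0.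
Proof. simpl; ring. Qed.

Lemma eval2_00 c : eval2 c (RtoC 0) (RtoC 0) = c 0%nat 0%nat.
Proof.
unfold eval2; apply is_CS_unique.
assert (Z : forall n, hterm c (RtoC 0) (RtoC 0) (S n) = RtoC 0).
  intros n; unfold hterm; apply csum_zero; intros i hi.
  destruct i; [replace (S n - 0)%nat with (S n) by lia|]; rewrite cpow_0_S; ring.
assert (P : forall (u : nat -> R), (forall n, u (S n) = 0) -> is_series u (u 0%nat)).
  intros u Hu; apply filterlim_ext with (fun _ => u 0%nat); [|apply filterlim_const].
  intros n; induction n; [now rewrite sum_O|]; rewrite sum_Sn, <- IHn, Hu.
  unfold plus; simpl; ring.
split.
- replace (fst (c 0%nat 0%nat)) with (fst (hterm c (RtoC 0) (RtoC 0) 0)).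
    apply (P (fun n => fst (hterm c (RtoC 0) (RtoC 0) n))); intros n; now rewrite Z.
  unfold hterm; simpl; ring.
- replace (snd (c 0%nat 0%nat)) with (snd (hterm c (RtoC 0) (RtoC 0) 0)).
    apply (P (fun n => snd (hterm c (RtoC 0) (RtoC 0) n))); intros n; now rewrite Z.
  unfold hterm; simpl; ring.
Qed.

Lemma conv2_RtoC a : conv2 Rabs a -> conv2 Cmod (fun i j => RtoC (a i j)).
Proof.
intros [r [M [r0 H]]]; exists r, M; split; auto; intros i j; rewrite Cmod_R; apply H.
Qed.

Lemma cpow_RtoC x n : cpow (RtoC x) n = RtoC (x ^ n).
Proof. now rewrite RtoC_cpow. Qed.

Lemma germ_val_real a x y : germ_val a (RtoC x) y = RtoC (rval a x y).
Proof.
unfold rval; apply injective_projections; [reflexivity|].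
unfold germ_val, eval2, CSeries; simpl.
apply is_series_unique, is_series_ext with (fun _ => 0).
  intros n; rewrite csum_snd; symmetry.
  transitivity (sum_n (fun _ => 0) n); [apply sum_n_ext|rewrite sum_n_const; apply Rmult_0_r].
  intros i; rewrite !cpow_RtoC, <- !RtoC_mult; reflexivity.
apply filterlim_ext with (fun _ => 0); [|apply filterlim_const].
intros n; rewrite sum_n_const; ring.
Qed.

Lemma Cmod_germ_real a x y : Cmod (germ_val a (RtoC x) y) = Rabs (rval a x y).
Proof. now rewrite germ_val_real, Cmod_R. Qed.

Lemma germ_lip a : conv2 Rabs a -> exists s L, 0 < s /\ 0 <= L /\
  forall x y x' y', Cmod x <= s -> Rabs y <= s -> Cmod x' <= s -> Rabs y' <= s ->
  Cmod (Cminus (germ_val a x y) (germ_val a x' y')) <= L * (Cmod (Cminus x x') + Rabs (y - y')).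
Proof.
intros H; destruct (eval2_lip _ (conv2_RtoC a H)) as [s [L [s0 [L0 HL]]]].
exists s, L; split; auto; split; auto; intros x y x' y' Hx Hy Hx' Hy'.
replace (Rabs (y - y')) with (Cmod (Cminus (RtoC y) (RtoC y'))).
  apply HL; auto; now rewrite Cmod_R.
now rewrite <- RtoC_minus, Cmod_R.
Qed.

(** * Expansions of Puiseux series *)

Definition sshift (k : nat) (d : nat -> C) : nat -> C := fun j => d (k + j)%nat.

Lemma conv1_geo d : conv1 d -> exists M q, 0 <= M /\ 0 < q /\ forall k, Cmod (d k) <= M * q ^ k.
Proof.
intros [r [M [r0 H]]]; exists M, (/ r); split.
  eapply Rle_trans; [|apply (H 0%nat)]; simpl; pose proof (Cmod_ge_0 (d 0%nat)); lra.
split; [now apply Rinv_0_lt_compat|]; intros k.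
rewrite pow_inv; apply Rmult_le_reg_r with (r ^ k); [now apply pow_lt|].
rewrite Rmult_assoc, Rinv_l, Rmult_1_r; [apply H|].
apply pow_nonzero; lra.
Qed.

Lemma conv1_sshift k d : conv1 d -> conv1 (sshift k d).
Proof.
intros [r [M [r0 H]]]; exists r, (M / r ^ k); split; auto; intros j; unfold sshift.
apply Rmult_le_reg_r with (r ^ k); [now apply pow_lt|].
unfold Rdiv; rewrite Rmult_assoc, <- pow_add, Rmult_assoc, Rinv_l, Rmult_1_r
  by (apply pow_nonzero; lra).
rewrite (Nat.add_comm j k); apply H.
Qed.

Lemma pval_bound d : conv1 d -> exists rho B, 0 < rho /\ 0 <= B /\
  forall t, 0 <= t <= rho -> asum (fun k => Cmult (d k) (RtoC (t ^ k))) /\ Cmod (pval d t) <= B.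
Proof.
intros H; destruct (conv1_geo d H) as [M [q [M0 [q0 Hq]]]].
exists (/ 2 * / q), (M / (1 - / 2)).
assert (iq : 0 < / q) by now apply Rinv_0_lt_compat.
split; [lra|]; split; [apply Rmult_le_pos; lra|]; intros t [t0 t1].
unfold pval; apply asum_geom; [lra|]; intros k.
rewrite Cmod_mult, Cmod_R, Rabs_pos_eq by now apply pow_le.
apply Rle_trans with (M * q ^ k * t ^ k).
  apply Rmult_le_compat_r; [now apply pow_le|apply Hq].
rewrite Rmult_assoc, <- Rpow_mult_distr; apply Rmult_le_compat_l; [lra|].
apply pow_incr; split; [apply Rmult_le_pos; lra|].
apply Rle_trans with (q * (/ 2 * / q)); [apply Rmult_le_compat_l; lra|].
right; field; lra.
Qed.

Lemma pval_sshift d k t : (forall j, (j < k)%nat -> d j = RtoC 0) ->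
  asum (fun j => Cmult (sshift k d j) (RtoC (t ^ j))) ->
  pval d t = Cmult (RtoC (t ^ k)) (pval (sshift k d) t).
Proof.
intros H Ha; unfold pval; rewrite <- CSeries_scal by exact Ha.
assert (E : forall j, Cmult (RtoC (t ^ k)) (Cmult (sshift k d j) (RtoC (t ^ j))) =
  Cmult (d (k + j)%nat) (RtoC (t ^ (k + j)))).
  intros j; rewrite pow_add, RtoC_mult; unfold sshift; ring.
rewrite (CSeries_shift_zero _ k).
- apply CSeries_ext; intros j; now rewrite E.
- intros n hn; rewrite H by exact hn; ring.
- apply asum_ext with (1 := E), asum_scal, Ha.
Qed.

Lemma pval_split d t : asum (fun k => Cmult (d k) (RtoC (t ^ k))) ->
  asum (fun k => Cmult (sshift 1 d k) (RtoC (t ^ k))) ->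
  pval d t = Cplus (d 0%nat) (Cmult (RtoC t) (pval (sshift 1 d) t)).
Proof.
intros Ha Hs; unfold pval at 1; rewrite (CSeries_incr_n _ 0) by exact Ha; simpl.
f_equal; [ring|]; unfold pval; rewrite <- CSeries_scal by exact Hs.
apply CSeries_ext; intros k; unfold sshift; simpl.
rewrite RtoC_mult; ring.
Qed.

Lemma pval_step d : conv1 d -> exists rho B, 0 < rho /\ 0 <= B /\
  forall t, 0 <= t <= rho ->
    pval d t = Cplus (d 0%nat) (Cmult (RtoC t) (pval (sshift 1 d) t)) /\
    Cmod (pval (sshift 1 d) t) <= B /\ Cmod (Cminus (pval d t) (d 0%nat)) <= B * t.
Proof.
intros H; destruct (pval_bound d H) as [r1 [B1 [r10 [B10 H1]]]].
destruct (pval_bound _ (conv1_sshift 1 d H)) as [r2 [B2 [r20 [B20 H2]]]].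
exists (Rmin r1 r2), B2; split; [now apply Rmin_pos|]; split; auto.
intros t [t0 t1].
assert (h1 : t <= r1) by min_bound.
assert (h2 : t <= r2) by min_bound.
destruct (H1 t) as [A1 _]; [lra|]; destruct (H2 t) as [A2 C2]; [lra|].
pose proof (pval_split d t A1 A2) as E; split; [exact E|]; split; [exact C2|].
rewrite E; replace (Cminus (Cplus (d 0%nat) (Cmult (RtoC t) (pval (sshift 1 d) t))) (d 0%nat))
  with (Cmult (RtoC t) (pval (sshift 1 d) t)) by ring.
rewrite Cmod_mult, Cmod_R, Rabs_pos_eq, Rmult_comm by lra.
now apply Rmult_le_compat_r.
Qed.

Lemma pval_asymp d k : conv1 d -> (forall j, (j < k)%nat -> d j = RtoC 0) -> d k <> RtoC 0 ->
  exists rho c1 c2, 0 < rho /\ 0 < c1 /\ 0 < c2 /\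
  forall t, 0 < t <= rho -> c1 * t ^ k <= Cmod (pval d t) <= c2 * t ^ k.
Proof.
intros H Hz Hk; pose proof (conv1_sshift k d H) as Hs.
destruct (pval_bound _ Hs) as [r1 [B1 [r10 [B10 H1]]]].
destruct (pval_step _ Hs) as [r2 [B2 [r20 [B20 H2]]]].
assert (dk : 0 < Cmod (d k)) by now apply Cmod_gt_0.
set (r3 := Cmod (d k) / 2 / (B2 + 1)).
assert (r30 : 0 < r3) by (unfold r3; apply Rdiv_lt_0_compat; lra).
exists (Rmin r1 (Rmin r2 r3)), (Cmod (d k) / 2), (B1 + 1).
split; [repeat apply Rmin_pos; auto|]; split; [lra|]; split; [lra|].
intros t [t0 t1].
assert (h1 : t <= r1) by min_bound.
assert (h2 : t <= r2) by min_bound.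
assert (h3 : t <= r3) by min_bound.
destruct (H1 t) as [A1 C1]; [lra|]; destruct (H2 t) as [_ [_ C2]]; [lra|].
rewrite (pval_sshift d k t Hz A1), Cmod_mult, Cmod_R.
assert (p : 0 < t ^ k) by now apply pow_lt.
rewrite Rabs_pos_eq by lra; rewrite (Rmult_comm (t ^ k)).
replace (sshift k d 0) with (d k) in C2 by (unfold sshift; f_equal; lia).
assert (L : B2 * t <= Cmod (d k) / 2).
  apply Rle_trans with ((B2 + 1) * r3).
    apply Rmult_le_compat; lra.
  unfold r3; right; field; lra.
pose proof (Cmod_triangle (pval (sshift k d) t) (Cminus (d k) (pval (sshift k d) t))) as T.
replace (Cplus (pval (sshift k d) t) (Cminus (d k) (pval (sshift k d) t))) with (d k) in T by ring.
replace (Cminus (d k) (pval (sshift k d) t)) with (Copp (Cminus (pval (sshift k d) t) (d k))) in T by ring.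
rewrite Cmod_opp in T.
split; apply Rmult_le_compat_r; lra.
Qed.

Lemma pval_to0 d eps : conv1 d -> d 0%nat = RtoC 0 -> 0 < eps ->
  exists rho, 0 < rho /\ forall t, 0 <= t <= rho -> Cmod (pval d t) <= eps.
Proof.
intros H H0 He; destruct (pval_step d H) as [r [B [r0 [B0 Hs]]]].
set (r1 := eps / (B + 1)).
assert (r10 : 0 < r1) by (apply Rdiv_lt_0_compat; lra).
exists (Rmin r r1); split; [now apply Rmin_pos|]; intros t [t0 t1].
destruct (Hs t) as [_ [_ C]]; [split; [lra|eapply Rle_trans; [exact t1|apply Rmin_l]]|].
rewrite H0 in C; replace (Cminus (pval d t) (RtoC 0)) with (pval d t) in C by ring.
assert (t <= r1) by min_bound.
eapply Rle_trans; [exact C|].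
apply Rle_trans with ((B + 1) * r1); [apply Rmult_le_compat; lra|].
unfold r1; right; field; lra.
Qed.

Lemma pval_real d t : (forall k, snd (d k) = 0) -> pval d t = RtoC (fst (pval d t)).
Proof.
intros H; apply injective_projections; [reflexivity|]; simpl.
apply is_series_unique, is_series_ext with (fun _ => 0).
  intros n; simpl; rewrite H; ring.
apply filterlim_ext with (fun _ => 0); [|apply filterlim_const].
intros n; rewrite sum_n_const; ring.
Qed.

Lemma pval_ext d d' t : (forall k, d k = d' k) -> pval d t = pval d' t.
Proof. intros H; apply CSeries_ext; intros k; now rewrite H. Qed.

Lemma INR_pos N : (1 <= N)%nat -> 0 < INR N.
Proof. intros H; apply lt_0_INR; lia. Qed.

Lemma ypow_pos N y : 0 < ypow N y.
Proof. apply exp_pos. Qed.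

Lemma ypow_pow N y : (1 <= N)%nat -> 0 < y -> ypow N y ^ N = y.
Proof.
intros HN hy; unfold ypow; rewrite <- Rpower_pow by apply exp_pos.
rewrite Rpower_mult, Rinv_l, Rpower_1; auto.
pose proof (INR_pos N HN); lra.
Qed.

Lemma ypow_lt N y r : (1 <= N)%nat -> 0 < y -> 0 < r -> y < r ^ N -> ypow N y < r.
Proof.
intros HN hy hr H; destruct (Rlt_le_dec (ypow N y) r) as [h|h]; auto.
exfalso; apply (Rlt_not_le _ _ H); rewrite <- (ypow_pow N y HN hy).
apply pow_incr; lra.
Qed.

Lemma ypow_pow_Rpower N y k : 0 < y -> ypow N y ^ k = Rpower y (INR k / INR N).
Proof.
intros hy; unfold ypow; rewrite <- Rpower_pow by apply exp_pos.
rewrite Rpower_mult; f_equal; unfold Rdiv; ring.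
Qed.

Lemma near0_ypow N (P : R -> Prop) : (1 <= N)%nat ->
  (exists rho, 0 < rho /\ forall t, 0 < t < rho -> P t) -> near0 (fun y => P (ypow N y)).
Proof.
intros HN [rho [r0 H]]; exists (rho ^ N); split; [now apply pow_lt|].
intros y [y0 y1]; apply H; split; [apply ypow_pos|now apply ypow_lt].
Qed.

Lemma near0_and P Q : near0 P -> near0 Q -> near0 (fun y => P y /\ Q y).
Proof.
intros [r [r0 H]] [r' [r0' H']]; exists (Rmin r r'); split; [now apply Rmin_pos|].
intros y [y0 y1]; split; [apply H|apply H']; split; auto.
- eapply Rlt_le_trans; [exact y1|apply Rmin_l].
- eapply Rlt_le_trans; [exact y1|apply Rmin_r].
Qed.

Lemma near0_imp (P Q : R -> Prop) : (forall y, 0 < y -> P y -> Q y) -> near0 P -> near0 Q.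
Proof. intros H [r [r0 Hr]]; exists r; split; auto; intros y hy; apply H; [lra|now apply Hr]. Qed.

Lemma near0_lt eps : 0 < eps -> near0 (fun y => y < eps).
Proof. intros H; exists eps; split; auto; intros y hy; lra. Qed.

Lemma near0_ex P : near0 P -> exists y, 0 < y /\ P y.
Proof. intros [r [r0 H]]; exists (r / 2); split; [lra|apply H; lra]. Qed.

Lemma has_ord_asymp h q : has_ord h q -> exists c1 c2, 0 < c1 /\ 0 < c2 /\
  near0 (fun y => c1 * Rpower y q <= Cmod (h y) <= c2 * Rpower y q).
Proof.
intros [N [d [HN [Hd [Hh [k [dk [dz ->]]]]]]]].
destruct (pval_asymp d k Hd dz dk) as [rho [c1 [c2 [r0 [c10 [c20 H]]]]]].
exists c1, c2; split; auto; split; auto.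
assert (G : near0 (fun y => 0 < ypow N y <= rho)).
  apply (near0_ypow N (fun t => 0 < t <= rho)); auto; exists rho; split; auto; intros; lra.
apply near0_imp with (2 := near0_and _ _ Hh G).
intros y hy [E [t0 t1]]; rewrite E, <- !ypow_pow_Rpower by auto.
apply H; auto.
Qed.

Lemma Rpower_lt_eps w eps : 0 < w -> 0 < eps -> near0 (fun y => Rpower y w < eps).
Proof.
intros hw he; exists (Rpower eps (/ w)); split; [apply exp_pos|]; intros y [y0 y1].
replace eps with (Rpower (Rpower eps (/ w)) w) at 1.
  apply Rlt_Rpower_l; auto; lra.
rewrite Rpower_mult, Rinv_l, Rpower_1; lra.
Qed.

(** Turns an inequality between powers for small [y] into one between exponents; the lower bounds
    for the exponent and the determination of orders go through it. *)
Lemma Rpower_compare A B u v : 0 < A -> 0 < B ->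
  near0 (fun y => A * Rpower y u <= B * Rpower y v) -> v <= u.
Proof.
intros hA hB H; destruct (Rle_lt_dec v u) as [h|h]; auto; exfalso.
assert (hw : 0 < v - u) by lra; assert (he : 0 < A / B) by now apply Rdiv_lt_0_compat.
destruct (near0_ex _ (near0_and _ _ H (Rpower_lt_eps _ _ hw he))) as [y [hy [H1 H2]]].
replace v with (u + (v - u)) in H1 by ring; rewrite Rpower_plus in H1.
assert (p : 0 < Rpower y u) by apply exp_pos.
assert (B * Rpower y (v - u) < A).
  apply Rlt_le_trans with (B * (A / B)); [now apply Rmult_lt_compat_l|right; field; lra].
nra.
Qed.

(** * Lower bounds of the exponent *)

Lemma fresh_real (F : list R) : exists c, ~ In c F.
Proof.
assert (H : exists B, forall x, In x F -> x <= B).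
  induction F as [|x F [B HB]]; [exists 0; intros x []|].
  exists (Rmax x B); intros z [->|hz]; [apply Rmax_l|].
  eapply Rle_trans; [now apply HB|apply Rmax_r].
destruct H as [B HB]; exists (B + 1); intros h; specialize (HB _ h); lra.
Qed.

Lemma conv1_finite d k0 : (forall k, (k0 < k)%nat -> d k = RtoC 0) -> conv1 d.
Proof.
intros H; exists 1, (sum_n (fun k => Cmod (d k)) k0); split; [lra|]; intros k.
rewrite pow1, Rmult_1_r.
assert (P : forall n, (k <= n)%nat -> Cmod (d k) <= sum_n (fun k => Cmod (d k)) n).
  intros n hn; induction hn.
    destruct k; [rewrite sum_O; lra|]; rewrite sum_Sn; unfold plus; simpl.
    assert (0 <= sum_n (fun k => Cmod (d k)) k); [|lra].
    clear; induction k; [rewrite sum_O; apply Cmod_ge_0|].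
    rewrite sum_Sn; unfold plus; simpl; pose proof (Cmod_ge_0 (d (S k))); lra.
  rewrite sum_Sn; unfold plus; simpl; pose proof (Cmod_ge_0 (d (S m))); lra.
destruct (Compare_dec.le_lt_dec k k0) as [h|h]; [now apply P|].
rewrite (H k h), Cmod_0.
eapply Rle_trans; [apply (Cmod_ge_0 (csum d k0))|apply Cmod_csum_le].
Qed.

Lemma real_approx_conv p k0 c : conv1 (pc (real_approx p k0 c)).
Proof.
apply conv1_finite with k0; intros k hk; simpl.
destruct (Nat.ltb_spec k k0); [lia|]; destruct (Nat.eqb_spec k k0); [lia|reflexivity].
Qed.

Lemma real_approx_0 p k0 c : pc p 0 = RtoC 0 -> first_nonreal p k0 ->
  pc (real_approx p k0 c) 0 = RtoC 0.
Proof.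
intros h0 [h1 _]; simpl; destruct k0; [rewrite h0 in h1; simpl in h1; lra|exact h0].
Qed.

Lemma real_approx_real p k0 c : first_nonreal p k0 ->
  forall k, snd (pc (real_approx p k0 c) k) = 0.
Proof.
intros [_ H] k; simpl; destruct (Nat.ltb_spec k k0); [now apply H|].
destruct (Nat.eqb k k0); reflexivity.
Qed.

Lemma near0_puis_small p eps : (1 <= pN p)%nat -> conv1 (pc p) -> pc p 0 = RtoC 0 -> 0 < eps ->
  near0 (fun y => Cmod (puis_val p y) <= eps).
Proof.
intros HN Hc H0 He; destruct (pval_to0 _ eps Hc H0 He) as [rho [r0 H]].
apply (near0_ypow (pN p) (fun t => Cmod (pval (pc p) t) <= eps)); auto.
exists rho; split; auto; intros t ht; apply H; lra.
Qed.

Lemma near0_germ_small a p eps : conv2 Rabs a -> a 0%nat 0%nat = 0 ->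
  (1 <= pN p)%nat -> conv1 (pc p) -> pc p 0 = RtoC 0 -> 0 < eps ->
  near0 (fun y => Cmod (germ_val a (puis_val p y) y) <= eps).
Proof.
intros Ha a0 HN Hc H0 He; destruct (germ_lip a Ha) as [s [L [s0 [L0 HL]]]].
set (e := Rmin s (eps / (2 * (L + 1)))).
assert (e0 : 0 < e) by (apply Rmin_pos; auto; apply Rdiv_lt_0_compat; lra).
apply near0_imp with (2 := near0_and _ _ (near0_puis_small p e HN Hc H0 e0) (near0_lt e e0)).
intros y hy [h1 h2].
assert (es : e <= s) by apply Rmin_l; assert (ee : e <= eps / (2 * (L + 1))) by apply Rmin_r.
assert (ay : Rabs y = y) by (apply Rabs_pos_eq; lra).
specialize (HL (puis_val p y) y (RtoC 0) 0).
rewrite Cmod_0, Rabs_R0, ay in HL.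
assert (G0 : germ_val a (RtoC 0) 0 = RtoC 0).
  unfold germ_val; rewrite eval2_00, a0; reflexivity.
rewrite G0, Rminus_0_r, ay in HL.
replace (Cminus (puis_val p y) (RtoC 0)) with (puis_val p y) in HL by ring.
replace (Cminus (germ_val a (puis_val p y) y) (RtoC 0)) with (germ_val a (puis_val p y) y) in HL by ring.
eapply Rle_trans; [apply HL; lra|].
apply Rle_trans with ((L + 1) * (eps / (2 * (L + 1)) + eps / (2 * (L + 1)))).
  pose proof (Cmod_ge_0 (puis_val p y)); apply Rmult_le_compat; lra.
right; field; lra.
Qed.

Lemma sqrt_sum_le x y : sqrt (x ^ 2 + y ^ 2) <= Rabs x + Rabs y.
Proof.
pose proof (Rabs_pos x); pose proof (Rabs_pos y).
rewrite <- (sqrt_pow2 (Rabs x + Rabs y)) by lra.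
apply sqrt_le_1_alt; rewrite <- (pow2_abs x), <- (pow2_abs y); nra.
Qed.

Lemma has_ord_nonneg h q : has_ord h q -> 0 <= q.
Proof.
intros [N [d [HN [_ [_ [k [_ [_ ->]]]]]]]]; apply Rmult_le_pos; [apply pos_INR|].
left; apply Rinv_0_lt_compat, INR_pos, HN.
Qed.

Lemma has_ord_pos h q : has_ord h q -> (forall eps, 0 < eps -> near0 (fun y => Cmod (h y) <= eps)) ->
  0 < q.
Proof.
intros H Hs; destruct (Rle_lt_or_eq_dec _ _ (has_ord_nonneg h q H)) as [|E]; auto; exfalso.
destruct (has_ord_asymp h q H) as [c1 [c2 [c10 [_ Ha]]]].
assert (he : 0 < c1 / 2) by lra.
destruct (near0_ex _ (near0_and _ _ Ha (Hs _ he))) as [y [hy [[H1 _] H2]]].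
rewrite <- E, Rpower_O in H1 by auto; lra.
Qed.

Lemma Rpower_mult_base x y al : 0 < x -> 0 < y -> Rpower (x * y) al = Rpower x al * Rpower y al.
Proof. intros; now rewrite Rpower_mult_distr. Qed.

Lemma rpow0_pos x al : 0 < x -> rpow0 x al = Rpower x al.
Proof. intros; unfold rpow0; destruct (Req_EM_T x 0); auto; lra. Qed.

Lemma lower_bound_arc a b al p q1 q2 : conv2 Rabs b -> b 0%nat 0%nat = 0 -> loj_adm a b al ->
  (1 <= pN p)%nat -> conv1 (pc p) -> pc p 0 = RtoC 0 -> is_real_puis p ->
  has_ord (fun y => germ_val a (puis_val p y) y) q1 ->
  has_ord (fun y => germ_val b (puis_val p y) y) q2 -> q1 / q2 <= al.
Proof.
intros Hb b0 [al0 [Cc [r [Cc0 [r0 Hadm]]]]] HN Hc H0 Hre O1 O2.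
(* [g] vanishes at the origin and so tends to 0 along the arc; the order must be positive for the
   claim to be multiplied by [q2]. *)
assert (q20 : 0 < q2).
  apply (has_ord_pos _ _ O2); intros eps he; now apply near0_germ_small.
destruct (has_ord_asymp _ _ O1) as [c1' [c2 [_ [c20 N1]]]].
destruct (has_ord_asymp _ _ O2) as [c1 [c2' [c10 [_ N2]]]].
assert (hr : 0 < r / 2) by lra.
pose proof (near0_and _ _ (near0_puis_small p _ HN Hc H0 hr) (near0_lt _ hr)) as N3.
apply Rmult_le_reg_r with q2; auto; unfold Rdiv; rewrite Rmult_assoc, Rinv_l, Rmult_1_r by lra.
rewrite Rmult_comm.
apply (Rpower_compare (Cc * Rpower c1 al) c2); auto.
  apply Rmult_lt_0_compat; auto; apply exp_pos.
apply near0_imp with (2 := near0_and _ _ (near0_and _ _ N1 N2) N3).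
intros y hy [[[_ h1] [h2 _]] [h3 h4]].
assert (Ex : puis_val p y = RtoC (fst (puis_val p y))) by (apply pval_real; exact Hre).
set (x := fst (puis_val p y)) in Ex.
rewrite Ex, Cmod_germ_real in h1, h2; rewrite Ex, Cmod_R in h3.
assert (g0 : 0 < Rabs (rval b x y)).
  eapply Rlt_le_trans; [|exact h2]; apply Rmult_lt_0_compat; auto; apply exp_pos.
assert (D : sqrt (x ^ 2 + y ^ 2) <= r).
  eapply Rle_trans; [apply sqrt_sum_le|]; rewrite (Rabs_pos_eq y) by lra; lra.
specialize (Hadm x y D); rewrite rpow0_pos in Hadm by auto.
apply Rle_trans with (Cc * Rpower (Rabs (rval b x y)) al); [|lra].
rewrite Rmult_assoc; apply Rmult_le_compat_l; [lra|].
rewrite <- Rpower_mult, <- Rpower_mult_base; auto; [|apply exp_pos].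
apply Rle_Rpower_l; [lra|]; split; [|lra].
apply Rmult_lt_0_compat; auto; apply exp_pos.
Qed.

Lemma Cmod_Cminus_tri x y : Cmod x <= Cmod y + Cmod (Cminus x y).
Proof.
replace x with (Cplus y (Cminus x y)) at 1 by ring; apply Cmod_triangle.
Qed.

(** With exponent 0 the cofactor would be the germ itself and vanish along the root, against the
    last clause of [mult]. *)
Lemma mult_pos b p n : mult b p n -> (1 <= n)%nat.
Proof.
intros [[[HN [H0 Hc]] Hz] [M [hc [HM [Hh [[r [r0 Hf]] Hnz]]]]]].
destruct n; [exfalso; apply Hnz|lia].
assert (hr : 0 < r / 2) by lra.
apply near0_imp with (2 := near0_and _ _ Hz (near0_and _ _ (near0_puis_small p _ HN Hc H0 hr) (near0_lt _ r0))).
intros y hy [h1 [h2 h3]]; rewrite Hf in h1; [|lra|lra].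
simpl in h1; now rewrite Cmult_1_l in h1.
Qed.

Lemma lower_bound_mult a b al p m n : loj_adm a b al ->
  is_real_puis p -> mult a p m -> mult b p n -> INR m / INR n <= al.
Proof.
intros [al0 [Cc [r [Cc0 [r0 Hadm]]]]] Hre Ma Mb.
pose proof (mult_pos b p n Mb) as n1; pose proof (INR_pos n n1) as n0.
destruct Ma as [[[HN [H0 Hc]] _] [M1 [ha [HM1 [Hha [[r1 [r10 Hfa]] _]]]]]].
destruct Mb as [_ [M2 [hb [HM2 [Hhb [[r2 [r20 Hfb]] Hnz]]]]]].
destruct (eval2_lip _ Hha) as [s1 [L1 [s10 [L10 HL1]]]].
destruct (eval2_lip _ Hhb) as [s2 [L2 [s20 [L20 HL2]]]].
assert (sm : forall M s, (1 <= M)%nat -> 0 < s -> near0 (fun y => ypow M y < s)).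
  intros M s HM hs; apply (near0_ypow M (fun t => t < s)); auto.
  exists s; split; auto; intros; lra.
set (e := Rmin (Rmin (r / 4) (Rmin r1 r2)) (Rmin s1 s2)).
assert (e0 : 0 < e) by (repeat apply Rmin_pos; lra).
assert (er : e <= r / 4) by min_bound.
assert (er1 : e <= r1) by min_bound.
assert (er2 : e <= r2) by min_bound.
assert (es1 : e <= s1) by min_bound.
assert (es2 : e <= s2) by min_bound.
assert (e20 : 0 < e / 2) by lra.
pose proof (near0_and _ _ (near0_and _ _ (near0_puis_small p _ HN Hc H0 e20) (near0_lt _ e0))
  (near0_and _ _ (sm M1 e HM1 e0) (sm M2 e HM2 e0))) as [rho [rho0 Hrho]].
(* A single [y] at which the cofactor of [g] does not vanish on the root is enough: from here on [y]
   is fixed and only [x] moves towards the root. *)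
destruct (classic (exists y, 0 < y < rho /\ eval2 hb (puis_val p y) (RtoC (ypow M2 y)) <> RtoC 0))
  as [[y [hy Hy]]|no].
2:{ exfalso; apply Hnz; exists rho; split; auto; intros y hy.
    apply NNPP; intros h; apply no; exists y; auto. }
destruct (Hrho y hy) as [[hp hye] [t1 t2]]; clear Hrho.
assert (Ex : puis_val p y = RtoC (fst (puis_val p y))) by (apply pval_real; exact Hre).
set (x0 := fst (puis_val p y)) in Ex.
rewrite Ex in hp, Hy; rewrite Cmod_R in hp.
set (w1 := RtoC (ypow M1 y)) in *; set (w2 := RtoC (ypow M2 y)) in *.
assert (W1 : Cmod w1 < e) by (unfold w1; rewrite Cmod_R, Rabs_pos_eq; [auto|left; apply ypow_pos]).
assert (W2 : Cmod w2 < e) by (unfold w2; rewrite Cmod_R, Rabs_pos_eq; [auto|left; apply ypow_pos]).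
set (g0 := Cmod (eval2 hb (RtoC x0) w2)).
assert (g00 : 0 < g0) by now apply Cmod_gt_0.
(* An upper bound for the cofactor of [f] near [x0]; the summand 1 makes it positive even if the
   cofactor vanishes there. *)
set (f0 := Cmod (eval2 ha (RtoC x0) w1) + L1 * e + 1).
assert (f00 : 0 < f0).
  unfold f0; pose proof (Cmod_ge_0 (eval2 ha (RtoC x0) w1)).
  assert (0 <= L1 * e) by (apply Rmult_le_pos; lra); lra.
apply Rmult_le_reg_r with (INR n); auto; unfold Rdiv; rewrite Rmult_assoc, Rinv_l, Rmult_1_r by lra.
rewrite Rmult_comm.
apply (Rpower_compare (Cc * Rpower (g0 / 2) al) f0); auto.
  apply Rmult_lt_0_compat; auto; apply exp_pos.
assert (d0 : 0 < g0 / 2 / (L2 + 1)) by (apply Rdiv_lt_0_compat; lra).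
apply near0_imp with (2 := near0_and _ _ (near0_lt _ e20) (near0_lt _ d0)).
intros u hu [u1 u2]; set (x := x0 + u).
assert (Hx : Rabs x < e).
  unfold x; eapply Rle_lt_trans; [apply Rabs_triang|]; rewrite (Rabs_pos_eq u); lra.
assert (D : sqrt (x ^ 2 + y ^ 2) <= r).
  eapply Rle_trans; [apply sqrt_sum_le|]; rewrite (Rabs_pos_eq y) by lra; lra.
specialize (Hadm x y D); rewrite <- !Cmod_germ_real in Hadm.
assert (Exu : Cminus (RtoC x) (puis_val p y) = RtoC u).
  rewrite Ex, <- RtoC_minus; f_equal; unfold x; ring.
assert (Exu0 : Cmod (Cminus (RtoC x) (RtoC x0)) = u).
  rewrite <- RtoC_minus, Cmod_R; unfold x; replace (x0 + u - x0) with u by ring.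
  apply Rabs_pos_eq; lra.
rewrite Hfa in Hadm by (try rewrite Cmod_R; lra).
rewrite Hfb in Hadm by (try rewrite Cmod_R; lra).
rewrite Exu, !Cmod_mult, !Cmod_cpow, !Cmod_R, (Rabs_pos_eq u) in Hadm by lra.
fold w1 w2 in Hadm.
assert (Z : forall z : C, Cmod (Cminus z z) = 0).
  intros z; replace (Cminus z z) with (RtoC 0) by ring; apply Cmod_0.
assert (B1 : Cmod (eval2 ha (RtoC x) w1) <= f0).
  eapply Rle_trans; [apply (Cmod_Cminus_tri _ (eval2 ha (RtoC x0) w1))|].
  assert (Cmod (Cminus (eval2 ha (RtoC x) w1) (eval2 ha (RtoC x0) w1)) <= L1 * e); [|unfold f0; lra].
  eapply Rle_trans; [apply HL1; try rewrite Cmod_R; lra|].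
  rewrite Exu0, Z; apply Rmult_le_compat_l; lra.
assert (B2 : g0 / 2 <= Cmod (eval2 hb (RtoC x) w2)).
  pose proof (Cmod_Cminus_tri (eval2 hb (RtoC x0) w2) (eval2 hb (RtoC x) w2)) as T; fold g0 in T.
  assert (Cmod (Cminus (eval2 hb (RtoC x0) w2) (eval2 hb (RtoC x) w2)) <= g0 / 2); [|lra].
  replace (Cminus (eval2 hb (RtoC x0) w2) (eval2 hb (RtoC x) w2)) with
    (Copp (Cminus (eval2 hb (RtoC x) w2) (eval2 hb (RtoC x0) w2))) by ring; rewrite Cmod_opp.
  eapply Rle_trans; [apply HL2; try rewrite Cmod_R; lra|].
  rewrite Exu0, Z.
  apply Rle_trans with ((L2 + 1) * (g0 / 2 / (L2 + 1))); [apply Rmult_le_compat; lra|].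
  right; field; lra.
assert (un : 0 < u ^ n) by now apply pow_lt.
assert (um : 0 < u ^ m) by now apply pow_lt.
rewrite rpow0_pos in Hadm by (apply Rmult_lt_0_compat; lra).
apply Rle_trans with (u ^ m * Cmod (eval2 ha (RtoC x) w1)).
- apply Rle_trans with (Cc * Rpower (u ^ n * Cmod (eval2 hb (RtoC x) w2)) al); [|lra].
  rewrite Rmult_assoc; apply Rmult_le_compat_l; [lra|].
  rewrite <- Rpower_mult, Rpower_pow, <- Rpower_mult_base by lra.
  apply Rle_Rpower_l; [lra|]; split; [apply Rmult_lt_0_compat; lra|].
  rewrite Rmult_comm; apply Rmult_le_compat_l; lra.
- rewrite Rpower_pow, Rmult_comm by lra; apply Rmult_le_compat_r; lra.
Qed.

Theorem lower_bound a b al l : conv2 Rabs b -> b 0%nat 0%nat = 0 ->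
  loj_adm a b al -> Lplus_set a b l -> l <= al.
Proof.
intros Hb b0 Hadm [[p [k0 [[[HN [H0 Hc]] _] [Hk0 [F HF]]]]]|[p [m [n [Hre [Ma [Mb ->]]]]]]].
- destruct (fresh_real F) as [c hc]; destruct (HF c hc) as [q1 [q2 [O1 [O2 ->]]]].
  apply (lower_bound_arc a b al (real_approx p k0 c)); auto.
  + apply real_approx_conv.
  + now apply real_approx_0.
  + intros k; now apply real_approx_real.
- now apply (lower_bound_mult a b al p).
Qed.

(** * The tree of real truncations *)

Definition agree (p : nat -> R) (k : nat) (phi : nat -> C) : Prop :=
  forall j, (j < k)%nat -> phi j = RtoC (p j).
Definition agreeb p k phi : bool :=
  if excluded_middle_informative (agree p k phi) then true else false.
Definition cnt (l : list (nat -> C)) p k : nat := length (filter (agreeb p k) l).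
(** Each root contributes the number of [j] in [1..k] such that it agrees with [p] below [j], that
    is its order of contact with [p] cut off at [k]. Summed over the roots this is the order, in
    powers of [t], along an arc that starts with [p] and has a generic coefficient at [k]. *)
Fixpoint osum (l : list (nat -> C)) p k : nat :=
  match k with O => O | S k => (osum l p k + cnt l p (S k))%nat end.
Definition upd (p : nat -> R) (k : nat) (c : R) : nat -> R :=
  fun j => if Nat.eqb j k then c else p j.
Definition height lam Phi Psi p k : R := INR (osum Phi p k) - lam * INR (osum Psi p k).

Lemma agreebP p k phi : agreeb p k phi = true <-> agree p k phi.
Proof.
unfold agreeb; destruct (excluded_middle_informative (agree p k phi)); split; auto; discriminate.
Qed.

Lemma agreeb_false p k phi : ~ agree p k phi -> agreeb p k phi = false.
Proof.
intros H; unfold agreeb; destruct (excluded_middle_informative (agree p k phi)); auto; contradiction.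
Qed.

Lemma agree_ext p q k phi : (forall j, (j < k)%nat -> p j = q j) -> agree p k phi -> agree q k phi.
Proof. intros H H' j hj; rewrite <- H; auto. Qed.

Lemma agreeb_ext p q k phi : (forall j, (j < k)%nat -> p j = q j) -> agreeb p k phi = agreeb q k phi.
Proof.
intros H; apply Bool.eq_true_iff_eq; rewrite !agreebP; split; apply agree_ext; auto.
intros; symmetry; auto.
Qed.

Lemma cnt_ext l p q k : (forall j, (j < k)%nat -> p j = q j) -> cnt l p k = cnt l q k.
Proof.
intros H; unfold cnt; f_equal; apply filter_ext; intros phi; now apply agreeb_ext.
Qed.

Lemma osum_ext l p q k : (forall j, (j < k)%nat -> p j = q j) -> osum l p k = osum l q k.
Proof.
induction k; intros H; simpl; auto.
rewrite IHk by (intros; apply H; lia); f_equal; apply cnt_ext; auto.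
Qed.

Lemma upd_lt p k c j : (j < k)%nat -> upd p k c j = p j.
Proof. intros H; unfold upd; destruct (Nat.eqb_spec j k); [lia|reflexivity]. Qed.
Lemma upd_eq p k c : upd p k c k = c.
Proof. unfold upd; now rewrite Nat.eqb_refl. Qed.

Lemma agree_upd p k c phi : agree (upd p k c) (S k) phi <-> agree p k phi /\ phi k = RtoC c.
Proof.
split.
- intros H; split.
    intros j hj; rewrite (H j) by lia; now rewrite upd_lt.
  rewrite (H k) by lia; now rewrite upd_eq.
- intros [H Hk] j hj; destruct (Nat.eq_dec j k) as [->|ne]; [now rewrite upd_eq|].
  rewrite upd_lt by lia; apply H; lia.
Qed.

Fixpoint sumcnt (l : list (nat -> C)) p k (cs : list R) : nat :=
  match cs with nil => O | c :: cs => (cnt l (upd p k c) (S k) + sumcnt l p k cs)%nat end.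

Lemma sumcnt_nil p k cs : sumcnt nil p k cs = O.
Proof. induction cs; simpl; auto. Qed.

Lemma cnt_cons phi l p k : cnt (phi :: l) p k = ((if agreeb p k phi then 1 else 0) + cnt l p k)%nat.
Proof. unfold cnt; simpl; destruct (agreeb p k phi); reflexivity. Qed.

Lemma sumcnt_cons phi l p k cs :
  sumcnt (phi :: l) p k cs =
  (length (filter (fun c => agreeb (upd p k c) (S k) phi) cs) + sumcnt l p k cs)%nat.
Proof.
induction cs; simpl; auto; rewrite IHcs, cnt_cons.
destruct (agreeb (upd p k a) (S k) phi); simpl; lia.
Qed.

Lemma RtoC_inj_fst x y : RtoC x = RtoC y -> x = y.
Proof. intros H; now injection H. Qed.

Lemma filter_one_le phi p k cs : NoDup cs ->
  (length (filter (fun c => agreeb (upd p k c) (S k) phi) cs) <= if agreeb p k phi then 1 else 0)%nat.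
Proof.
intros H; induction H as [|c cs hc H IH]; simpl; [destruct (agreeb p k phi); lia|].
destruct (agreeb (upd p k c) (S k) phi) eqn:E; auto.
apply agreebP, agree_upd in E; destruct E as [E1 E2].
assert (A : agreeb p k phi = true) by now apply agreebP.
rewrite A; simpl.
replace (filter (fun c0 => agreeb (upd p k c0) (S k) phi) cs) with (@nil R); [simpl; lia|].
symmetry; clear IH H; induction cs as [|d cs IH]; simpl; auto.
rewrite agreeb_false.
  apply IH; intros h; apply hc; now right.
intros h; apply agree_upd in h; destruct h as [_ h]; apply hc; left.
apply RtoC_inj_fst; congruence.
Qed.

Lemma filter_one_ge phi p k cs c : agree p k phi -> phi k = RtoC c -> In c cs ->
  (1 <= length (filter (fun c => agreeb (upd p k c) (S k) phi) cs))%nat.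
Proof.
intros H1 H2 H3.
assert (I : In c (filter (fun c => agreeb (upd p k c) (S k) phi) cs)).
  apply filter_In; split; auto; apply agreebP, agree_upd; auto.
destruct (filter _ cs); [destruct I|simpl; lia].
Qed.

Lemma sumcnt_le l p k cs : NoDup cs -> (sumcnt l p k cs <= cnt l p k)%nat.
Proof.
intros H; induction l as [|phi l IH]; [rewrite sumcnt_nil; lia|].
rewrite sumcnt_cons, cnt_cons; pose proof (filter_one_le phi p k cs H); lia.
Qed.

Lemma sumcnt_ge l p k cs :
  (forall phi, In phi l -> agree p k phi -> exists c, phi k = RtoC c /\ In c cs) ->
  (cnt l p k <= sumcnt l p k cs)%nat.
Proof.
intros H; induction l as [|phi l IH]; [unfold cnt; simpl; lia|].
rewrite sumcnt_cons, cnt_cons.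
assert (cnt l p k <= sumcnt l p k cs)%nat by (apply IH; intros; apply H; auto; now right).
destruct (agreeb p k phi) eqn:E; [|lia].
apply agreebP in E; destruct (H phi (or_introl eq_refl) E) as [c [h1 h2]].
pose proof (filter_one_ge phi p k cs c E h1 h2); lia.
Qed.

(** An averaging argument. As no root of [f] turns non-real here, those at [p] are distributed over
    the children listed in [cs]; roots of [g] may leave the real tree or go elsewhere, which only
    lowers their total. If no child had an excess of roots of [f], neither would [p]. *)
Lemma exists_heavy_child lam Phi Psi p k : 0 <= lam ->
  (forall phi, In phi Phi -> agree p k phi -> snd (phi k) = 0) ->
  lam * INR (cnt Psi p k) < INR (cnt Phi p k) ->
  exists c, lam * INR (cnt Psi (upd p k c) (S k)) < INR (cnt Phi (upd p k c) (S k)).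
Proof.
intros hl Hre Hlt; apply NNPP; intros no.
assert (H : forall c, INR (cnt Phi (upd p k c) (S k)) <= lam * INR (cnt Psi (upd p k c) (S k))).
  intros c; apply Rnot_lt_le; intros h; apply no; now exists c.
set (cs := nodup Req_EM_T (map (fun phi => fst (phi k)) Phi)).
assert (S1 : (cnt Phi p k <= sumcnt Phi p k cs)%nat).
  apply sumcnt_ge; intros phi h1 h2; exists (fst (phi k)); split.
    apply injective_projections; auto; simpl; auto.
  apply nodup_In, in_map_iff; exists phi; auto.
assert (S2 : (sumcnt Psi p k cs <= cnt Psi p k)%nat) by (apply sumcnt_le, NoDup_nodup).
assert (S3 : INR (sumcnt Phi p k cs) <= lam * INR (sumcnt Psi p k cs)).
  clear S1 S2; induction cs as [|c cs IH]; simpl sumcnt; [simpl; lra|].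
  rewrite !plus_INR, Rmult_plus_distr_l; pose proof (H c); lra.
apply le_INR in S1; apply le_INR in S2.
apply (Rmult_le_compat_l lam) in S2; auto; lra.
Qed.

Section Tree.
Variables (lam : R) (Phi Psi : list (nat -> C)) (K : nat).
Hypothesis lam0 : 0 < lam.
Hypothesis HnonReal : forall p k phi, In phi Phi -> agree p k phi -> snd (phi k) <> 0 ->
  height lam Phi Psi p k <= 0.
Hypothesis Hleaf : forall p, (1 <= cnt Phi p K)%nat ->
  INR (cnt Phi p K) <= lam * INR (cnt Psi p K).
Hypothesis Hsep : forall phi psi, In phi (Phi ++ Psi) -> In psi (Phi ++ Psi) ->
  (forall j, (j < K)%nat -> phi j = psi j) -> forall j, phi j = psi j.
Hypothesis Hconv : forall phi, In phi (Phi ++ Psi) -> conv1 phi.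

Local Notation height := (height lam Phi Psi).

Lemma height_S p k : height p (S k) =
  height p k + (INR (cnt Phi p (S k)) - lam * INR (cnt Psi p (S k))).
Proof. unfold height; simpl; rewrite !plus_INR; ring. Qed.

Lemma height_ext p q k : (forall j, (j < k)%nat -> p j = q j) -> height p k = height q k.
Proof. intros H; unfold height; now rewrite (osum_ext Phi p q), (osum_ext Psi p q). Qed.

Lemma height_upd p k c : height (upd p k c) (S k) =
  height p k + (INR (cnt Phi (upd p k c) (S k)) - lam * INR (cnt Psi (upd p k c) (S k))).
Proof.
rewrite height_S; f_equal; apply height_ext; intros; now apply upd_lt.
Qed.

(* A node of positive height which contains too many roots of [f] has a child with the same
   property, so one can climb up to a leaf, where this is impossible. *)
Lemma no_heavy_node n : forall p k, (k + n = K)%nat -> 0 < height p k ->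
  lam * INR (cnt Psi p k) < INR (cnt Phi p k) -> False.
Proof.
induction n; intros p k Hk H1 H2.
- replace k with K in H2 by lia.
  assert (c1 : (1 <= cnt Phi p K)%nat).
    destruct (cnt Phi p K); [|lia]; simpl in H2.
    assert (0 <= lam * INR (cnt Psi p K)) by (apply Rmult_le_pos; [lra|apply pos_INR]); lra.
  specialize (Hleaf p c1); lra.
- destruct (exists_heavy_child lam Phi Psi p k) as [c Hc]; auto; [lra| |].
    intros phi h1 h2; apply NNPP; intros h3; specialize (HnonReal p k phi h1 h2 h3); lra.
  apply (IHn (upd p k c) (S k)); [lia| |auto].
  rewrite height_upd; lra.
Qed.

(** A height that becomes positive for the first time does so by a positive increment, which is an
    excess of roots of [f] at the new node. *)
Lemma height_le0 p k : (k <= K)%nat -> height p k <= 0.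
Proof.
induction k; intros hk; [unfold height; simpl; lra|].
specialize (IHk ltac:(lia)); apply Rnot_lt_le; intros h; pose proof h as h'.
rewrite height_S in h'; apply (no_heavy_node (K - S k) p (S k)); [lia|auto|lra].
Qed.

End Tree.

(** * Estimates of root factors *)

Definition rprod {A : Type} (F : A -> R) (l : list A) : R :=
  fold_right (fun v z => F v * z) 1 l.

Lemma rprod_pos {A} (F : A -> R) l : (forall v, In v l -> 0 <= F v) -> 0 <= rprod F l.
Proof.
induction l; simpl; intros H; [lra|]; apply Rmult_le_pos; auto.
Qed.

Lemma rprod_mult {A} (F G : A -> R) l : rprod (fun v => F v * G v) l = rprod F l * rprod G l.
Proof. induction l; simpl; [ring|rewrite IHl; ring]. Qed.

Lemma rprod_ext {A} (F G : A -> R) l : (forall v, In v l -> F v = G v) -> rprod F l = rprod G l.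
Proof. induction l; simpl; intros H; auto; rewrite IHl, H; auto. Qed.

Lemma rprod_if_agree p k w l : rprod (fun phi => if agreeb p k phi then w else 1) l = w ^ cnt l p k.
Proof.
induction l; [reflexivity|]; rewrite cnt_cons; simpl rprod; rewrite IHl.
destruct (agreeb p k a); simpl; ring.
Qed.

(** One number [e] is both the size of the region and the comparison constant. The hypothesis holds
    for all smaller [e] too, so finitely many factors can share one. *)
Lemma rprod_compare {A X : Type} (l : list A) (dom : R -> X -> Prop) (F G : A -> X -> R) :
  (forall v, In v l -> exists e0, 0 < e0 /\ forall e, 0 < e <= e0 -> forall x, dom e x ->
     0 <= G v x /\ e * G v x <= F v x <= G v x / e) ->
  exists e0, 0 < e0 /\ forall e, 0 < e <= e0 -> forall x, dom e x ->
    0 <= rprod (fun v => G v x) l /\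
    e ^ length l * rprod (fun v => G v x) l <= rprod (fun v => F v x) l
      <= rprod (fun v => G v x) l / e ^ length l.
Proof.
induction l as [|v l IH]; intros H.
  exists 1; split; [lra|]; intros e he x hx; simpl; split; [lra|]; split; [lra|]; right; field.
destruct (H v (or_introl eq_refl)) as [e1 [e10 H1]].
destruct IH as [e2 [e20 H2]]; [intros w hw; apply H; now right|].
exists (Rmin e1 e2); split; [now apply Rmin_pos|]; intros e [he1 he2] x hx.
assert (a1 : e <= e1) by min_bound.
assert (a2 : e <= e2) by min_bound.
destruct (H1 e (conj he1 a1) x hx) as [g0 [b1 b2]].
destruct (H2 e (conj he1 a2) x hx) as [p0 [c1 c2]].
simpl; assert (ep : 0 < e ^ length l) by now apply pow_lt.
set (PG := rprod (fun v => G v x) l) in *; set (PF := rprod (fun v => F v x) l) in *.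
assert (F0 : 0 <= F v x) by (eapply Rle_trans; [|exact b1]; apply Rmult_le_pos; lra).
assert (PF0 : 0 <= PF) by (eapply Rle_trans; [|exact c1]; apply Rmult_le_pos; lra).
split; [now apply Rmult_le_pos|]; split.
- replace (e * e ^ length l * (G v x * PG)) with ((e * G v x) * (e ^ length l * PG)) by ring.
  apply Rmult_le_compat; auto; apply Rmult_le_pos; lra.
- replace (G v x * PG / (e * e ^ length l)) with ((G v x / e) * (PG / e ^ length l)) by (field; lra).
  apply Rmult_le_compat; auto.
Qed.

Lemma rpow0_ge0 x al : 0 <= rpow0 x al.
Proof. unfold rpow0; destruct (Req_EM_T x 0); [lra|left; apply exp_pos]. Qed.

Lemma rpow0_0 al : rpow0 0 al = 0.
Proof. unfold rpow0; destruct (Req_EM_T 0 0); auto; lra. Qed.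

Lemma rpow0_mult x y al : 0 <= x -> 0 <= y -> rpow0 (x * y) al = rpow0 x al * rpow0 y al.
Proof.
intros [hx|<-] [hy|<-]; rewrite ?Rmult_0_l, ?Rmult_0_r, ?rpow0_0; try ring.
rewrite !rpow0_pos; auto; [now apply Rpower_mult_base|now apply Rmult_lt_0_compat].
Qed.

Lemma rpow0_le x y al : 0 <= al -> 0 <= x -> x <= y -> rpow0 x al <= rpow0 y al.
Proof.
intros ha [hx|<-] hxy; [|rewrite rpow0_0; apply rpow0_ge0].
rewrite !rpow0_pos by lra; apply Rle_Rpower_l; lra.
Qed.

Lemma Rpower_le1 t u v : 0 < t <= 1 -> u <= v -> Rpower t v <= Rpower t u.
Proof.
intros [t0 t1] huv; unfold Rpower.
assert (ln t <= 0) by (rewrite <- ln_1; destruct (Req_dec t 1) as [->|ne]; [lra|left; apply ln_increasing; lra]).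
destruct (Rle_lt_or_eq_dec (v * ln t) (u * ln t)) as [h|h]; [nra|left; now apply exp_increasing|rewrite h; lra].
Qed.

Lemma Rpower_ge1 x s : 0 < x <= 1 -> s <= 0 -> 1 <= Rpower x s.
Proof. intros hx hs; rewrite <- (Rpower_O x) by lra; now apply Rpower_le1. Qed.

Lemma Rpower_le_1 x s : 0 < x <= 1 -> 0 <= s -> Rpower x s <= 1.
Proof. intros hx hs; rewrite <- (Rpower_O x) by lra; now apply Rpower_le1. Qed.

(** In the coordinate [z] at the node, where [x] is the truncation plus [t^k * z], a root through
    the node contributes its distance to [z]. A root that has left contributes a power of [t] up to
    constants; the height accounts for it, hence the value 1. *)
Definition fac (phi : nat -> C) (p : nat -> R) (k : nat) (z t : R) : R :=
  if agreeb p k phi then Cmod (Cminus (RtoC z) (pval (sshift k phi) t)) else 1.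

Lemma fac_ge0 phi p k z t : 0 <= fac phi p k z t.
Proof. unfold fac; destruct (agreeb p k phi); [apply Cmod_ge_0|lra]. Qed.

Lemma sshift_sshift k phi t : pval (sshift 1 (sshift k phi)) t = pval (sshift (S k) phi) t.
Proof. apply pval_ext; intros j; unfold sshift; f_equal; lia. Qed.

Lemma Cmod_tri_bounds x y : Cmod x - Cmod y <= Cmod (Cplus x y) <= Cmod x + Cmod y.
Proof.
split; [|apply Cmod_triangle].
pose proof (Cmod_triangle (Cplus x y) (Copp y)) as T; rewrite Cmod_opp in T.
replace (Cplus (Cplus x y) (Copp y)) with x in T by ring; lra.
Qed.

Lemma quarter_bounds D e f : 0 < D -> 0 < e -> e <= / 2 -> e <= D / 2 -> e <= / (2 * D) ->
  D - D / 2 <= f <= D + D / 2 -> e * 1 <= f <= 1 / e.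
Proof.
intros hD he h1 h2 h3 [h4 h5]; split; [lra|].
apply Rle_trans with (2 * D); [lra|].
replace (2 * D) with (1 * / / (2 * D)) by (field; lra).
unfold Rdiv; apply Rmult_le_compat_l; [lra|]; apply Rinv_le_contravar; lra.
Qed.

Lemma fac_outer phi p k c : conv1 phi ->
  exists e0, 0 < e0 /\ forall e, 0 < e <= e0 -> forall x : R * R,
    (0 < snd x < e /\ Rabs (fst x - c) < e /\ snd x / e <= Rabs (fst x - c)) ->
    0 <= (if agreeb (upd p k c) (S k) phi then Rabs (fst x - c) else 1) /\
    e * (if agreeb (upd p k c) (S k) phi then Rabs (fst x - c) else 1) <= fac phi p k (fst x) (snd x)
      <= (if agreeb (upd p k c) (S k) phi then Rabs (fst x - c) else 1) / e.
Proof.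
intros Hc; destruct (pval_step _ (conv1_sshift k phi Hc)) as [rho [B [rho0 [B0 Hs]]]].
set (D := Cmod (Cminus (RtoC c) (phi k))).
assert (D0 : 0 <= D) by apply Cmod_ge_0.
(* [D] vanishes when the root has coefficient [c] at [k]; the replacement keeps [e0] positive in
   that case. *)
set (D' := if Req_EM_T D 0 then 1 else D).
assert (D'0 : 0 < D') by (unfold D'; destruct (Req_EM_T D 0); lra).
set (e0 := Rmin (Rmin rho (/ (2 * (B + 1)))) (Rmin (Rmin (/ 2) (D' / 2 / (B + 1))) (/ (2 * D')))).
exists e0; split.
  unfold e0; repeat apply Rmin_pos; auto; try (apply Rinv_0_lt_compat; lra); try lra.
  apply Rdiv_lt_0_compat; lra.
intros e [he1 he2] [z t]; simpl; intros [[t0 t1] [w1 w2]].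
assert (a1 : e <= rho) by min_bound.
assert (a2 : e <= / (2 * (B + 1))) by min_bound.
assert (a3 : e <= / 2) by min_bound.
assert (a4 : e <= D' / 2 / (B + 1)) by min_bound.
assert (a5 : e <= / (2 * D')) by min_bound.
clearbody e0; clear he2.
unfold fac; destruct (agreeb p k phi) eqn:A.
2:{ assert (A' : agreeb (upd p k c) (S k) phi = false).
      apply agreeb_false; intros h; apply agree_upd in h; destruct h as [h _].
      apply agreebP in h; congruence.
    rewrite A'; split; [lra|]; split; [lra|].
    replace 1 with (1 * / 1) at 1 by field; unfold Rdiv.
    apply Rmult_le_compat_l; [lra|apply Rinv_le_contravar; lra]. }
destruct (Hs t) as [E [C1 _]]; [lra|].
rewrite E; replace (sshift k phi 0) with (phi k) by (unfold sshift; f_equal; lia).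
set (v := pval (sshift 1 (sshift k phi)) t) in *.
assert (TB : Cmod (Copp (Cmult (RtoC t) v)) <= t * B).
  rewrite Cmod_opp, Cmod_mult, Cmod_R, Rabs_pos_eq by lra; apply Rmult_le_compat_l; lra.
destruct (agreeb (upd p k c) (S k) phi) eqn:A'.
- apply agreebP, agree_upd in A'; destruct A' as [_ Ek]; rewrite Ek.
  replace (Cminus (RtoC z) (Cplus (RtoC c) (Cmult (RtoC t) v))) with
    (Cplus (RtoC (z - c)) (Copp (Cmult (RtoC t) v))) by (rewrite RtoC_minus; ring).
  pose proof (Cmod_tri_bounds (RtoC (z - c)) (Copp (Cmult (RtoC t) v))) as [L U].
  rewrite Cmod_R in L, U; set (w := Rabs (z - c)) in *.
  assert (w0 : 0 < w) by (eapply Rlt_le_trans; [|exact w2]; apply Rdiv_lt_0_compat; lra).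
  assert (tw : t <= w * e).
    apply Rmult_le_reg_r with (/ e); [now apply Rinv_0_lt_compat|].
    rewrite Rmult_assoc, Rinv_r, Rmult_1_r by lra; exact w2.
  assert (eB : e * (2 * (B + 1)) <= 1).
    apply Rle_trans with (/ (2 * (B + 1)) * (2 * (B + 1))); [apply Rmult_le_compat_r; lra|].
    right; field; lra.
  assert (tB : t * B <= w / 2).
    apply Rle_trans with (w * e * (B + 1)); [apply Rmult_le_compat; lra|].
    replace (w * e * (B + 1)) with (w * (e * (2 * (B + 1))) / 2) by field.
    assert (w * (e * (2 * (B + 1))) <= w * 1) by (apply Rmult_le_compat_l; lra); lra.
  split; [lra|]; split.
    assert (e * w <= / 2 * w) by (apply Rmult_le_compat_r; lra); lra.
  apply Rle_trans with (2 * w); [lra|].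
  unfold Rdiv; rewrite (Rmult_comm w); apply Rmult_le_compat_r; [lra|].
  replace 2 with (/ / 2) by field; apply Rinv_le_contravar; lra.
- split; [lra|].
  assert (ne : D <> 0).
    intros h; apply Cmod_eq_0 in h.
    assert (phi k = RtoC c).
      replace (RtoC c) with (Cplus (Cminus (RtoC c) (phi k)) (phi k)) by ring; rewrite h; ring.
    apply agreebP in A.
    assert (A'' : agreeb (upd p k c) (S k) phi = true) by (apply agreebP, agree_upd; auto).
    congruence.
  assert (ED : D' = D) by (unfold D'; destruct (Req_EM_T D 0); auto; contradiction).
  replace (Cminus (RtoC z) (Cplus (phi k) (Cmult (RtoC t) v))) with
    (Cplus (Cminus (RtoC c) (phi k)) (Cplus (RtoC (z - c)) (Copp (Cmult (RtoC t) v))))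
    by (rewrite RtoC_minus; ring).
  pose proof (Cmod_tri_bounds (Cminus (RtoC c) (phi k)) (Cplus (RtoC (z - c)) (Copp (Cmult (RtoC t) v)))) as [L U].
  pose proof (Cmod_triangle (RtoC (z - c)) (Copp (Cmult (RtoC t) v))) as T.
  rewrite Cmod_R in T; fold D in L, U; rewrite ED in a4, a5.
  assert (eB : e * (B + 1) <= D / 2).
    replace (D / 2) with (D / 2 / (B + 1) * (B + 1)) by (field; lra).
    apply Rmult_le_compat_r; lra.
  assert (t * B <= e * B) by (apply Rmult_le_compat_r; lra).
  apply (quarter_bounds D); try lra.
  assert (0 <= e * B) by (apply Rmult_le_pos; lra); lra.
Qed.

(** For [x] at [c + t * z'] with [z'] bounded, a root through the child contributes exactly [t]
    times its factor at the child, while the other roots through the node stay at a distance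
    comparable to [D]. *)
Lemma fac_inner phi p k c Q : conv1 phi -> 0 <= Q ->
  exists e0, 0 < e0 /\ forall e, 0 < e <= e0 -> forall x : R * R,
    (0 < snd x < e /\ Rabs (fst x) <= Q) ->
    0 <= (if agreeb (upd p k c) (S k) phi then snd x else 1) * fac phi (upd p k c) (S k) (fst x) (snd x) /\
    e * ((if agreeb (upd p k c) (S k) phi then snd x else 1) * fac phi (upd p k c) (S k) (fst x) (snd x))
      <= fac phi p k (c + snd x * fst x) (snd x)
      <= ((if agreeb (upd p k c) (S k) phi then snd x else 1) * fac phi (upd p k c) (S k) (fst x) (snd x)) / e.
Proof.
intros Hc Q0; destruct (pval_step _ (conv1_sshift k phi Hc)) as [rho [B [rho0 [B0 Hs]]]].
set (D := Cmod (Cminus (RtoC c) (phi k))).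
assert (D0 : 0 <= D) by apply Cmod_ge_0.
set (D' := if Req_EM_T D 0 then 1 else D).
assert (D'0 : 0 < D') by (unfold D'; destruct (Req_EM_T D 0); lra).
set (e0 := Rmin rho (Rmin (Rmin (/ 2) (D' / 2 / (B + Q + 1))) (/ (2 * D')))).
exists e0; split.
  unfold e0; repeat apply Rmin_pos; auto; try (apply Rinv_0_lt_compat; lra); try lra.
  apply Rdiv_lt_0_compat; lra.
intros e [he1 he2] [z t]; simpl; intros [[t0 t1] zQ].
assert (a1 : e <= rho) by min_bound.
assert (a3 : e <= / 2) by min_bound.
assert (a4 : e <= D' / 2 / (B + Q + 1)) by min_bound.
assert (a5 : e <= / (2 * D')) by min_bound.
clearbody e0; clear he2.
assert (triv : forall f, 0 <= f -> e * f <= f <= f / e).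
  intros f hf; split.
    replace f with (1 * f) at 2 by ring; apply Rmult_le_compat_r; lra.
  replace f with (f * / 1) at 1 by field; unfold Rdiv.
  apply Rmult_le_compat_l; [lra|apply Rinv_le_contravar; lra].
unfold fac; destruct (agreeb p k phi) eqn:A.
2:{ assert (A' : agreeb (upd p k c) (S k) phi = false).
      apply agreeb_false; intros h; apply agree_upd in h; destruct h as [h _].
      apply agreebP in h; congruence.
    rewrite A', Rmult_1_l; split; [lra|apply triv; lra]. }
destruct (Hs t) as [E [C1 _]]; [lra|].
rewrite E; replace (sshift k phi 0) with (phi k) by (unfold sshift; f_equal; lia).
rewrite sshift_sshift in *.
set (v := pval (sshift (S k) phi) t) in *.
assert (TB : Cmod (Copp (Cmult (RtoC t) v)) <= t * B).
  rewrite Cmod_opp, Cmod_mult, Cmod_R, Rabs_pos_eq by lra; apply Rmult_le_compat_l; lra.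
destruct (agreeb (upd p k c) (S k) phi) eqn:A'.
- apply agreebP, agree_upd in A'; destruct A' as [_ Ek]; rewrite Ek.
  replace (Cminus (RtoC (c + t * z)) (Cplus (RtoC c) (Cmult (RtoC t) v))) with
    (Cmult (RtoC t) (Cminus (RtoC z) v)) by (rewrite RtoC_plus, RtoC_mult; ring).
  rewrite Cmod_mult, Cmod_R, Rabs_pos_eq by lra.
  assert (0 <= t * Cmod (Cminus (RtoC z) v)) by (apply Rmult_le_pos; [lra|apply Cmod_ge_0]).
  split; auto.
- rewrite Rmult_1_l; split; [lra|].
  assert (ne : D <> 0).
    intros h; apply Cmod_eq_0 in h.
    assert (phi k = RtoC c).
      replace (RtoC c) with (Cplus (Cminus (RtoC c) (phi k)) (phi k)) by ring; rewrite h; ring.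
    apply agreebP in A.
    assert (A'' : agreeb (upd p k c) (S k) phi = true) by (apply agreebP, agree_upd; auto).
    congruence.
  assert (ED : D' = D) by (unfold D'; destruct (Req_EM_T D 0); auto; contradiction).
  replace (Cminus (RtoC (c + t * z)) (Cplus (phi k) (Cmult (RtoC t) v))) with
    (Cplus (Cminus (RtoC c) (phi k)) (Cplus (RtoC (t * z)) (Copp (Cmult (RtoC t) v))))
    by (rewrite RtoC_plus, RtoC_mult; ring).
  pose proof (Cmod_tri_bounds (Cminus (RtoC c) (phi k)) (Cplus (RtoC (t * z)) (Copp (Cmult (RtoC t) v)))) as [L U].
  pose proof (Cmod_triangle (RtoC (t * z)) (Copp (Cmult (RtoC t) v))) as T.
  rewrite Cmod_R, Rabs_mult, (Rabs_pos_eq t) in T by lra; fold D in L, U; rewrite ED in a4, a5.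
  assert (eB : e * (B + Q + 1) <= D / 2).
    replace (D / 2) with (D / 2 / (B + Q + 1) * (B + Q + 1)) by (field; lra).
    apply Rmult_le_compat_r; lra.
  assert (t * B <= e * B) by (apply Rmult_le_compat_r; lra).
  assert (t * Rabs z <= e * Q) by (apply Rmult_le_compat; try lra; apply Rabs_pos).
  assert (e * (B + Q + 1) = e * B + e * Q + e) by ring.
  assert (0 <= e * B) by (apply Rmult_le_pos; lra).
  assert (0 <= e * Q) by (apply Rmult_le_pos; lra).
  apply (quarter_bounds D); lra.
Qed.

(** * The inequality at the nodes of the tree *)

Definition prodf (l : list (nat -> C)) p k z t : R := rprod (fun phi => fac phi p k z t) l.

Lemma prodf_ge0 l p k z t : 0 <= prodf l p k z t.
Proof. apply rprod_pos; intros; apply fac_ge0. Qed.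

Lemma fac_bounded phi p k Q : conv1 phi ->
  exists rho B, 0 < rho /\ 1 <= B /\ forall t z, 0 < t <= rho -> Rabs z <= Q -> fac phi p k z t <= B.
Proof.
intros Hc; destruct (pval_bound _ (conv1_sshift k phi Hc)) as [rho [B [rho0 [B0 H]]]].
exists rho, (1 + Rabs Q + B); split; auto; split; [pose proof (Rabs_pos Q); lra|].
intros t z ht hz; unfold fac; destruct (agreeb p k phi); [|pose proof (Rabs_pos Q); lra].
destruct (H t) as [_ h]; [lra|].
eapply Rle_trans; [apply Cmod_triangle|]; rewrite Cmod_opp, Cmod_R.
assert (Rabs z <= Rabs Q) by (eapply Rle_trans; [exact hz|apply Rle_abs]); lra.
Qed.

Lemma prodf_bounded l p k Q : (forall phi, In phi l -> conv1 phi) ->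
  exists rho B, 0 < rho /\ 1 <= B /\ forall t z, 0 < t <= rho -> Rabs z <= Q -> prodf l p k z t <= B.
Proof.
induction l as [|phi l IH]; intros H.
  exists 1, 1; split; [lra|]; split; [lra|]; intros; unfold prodf; simpl; lra.
destruct IH as [r1 [B1 [r10 [B10 H1]]]]; [intros; apply H; now right|].
destruct (fac_bounded phi p k Q) as [r2 [B2 [r20 [B20 H2]]]]; [apply H; now left|].
exists (Rmin r1 r2), (B2 * B1); split; [now apply Rmin_pos|]; split; [nra|].
intros t z [t0 t1] hz; change (prodf (phi :: l) p k z t) with (fac phi p k z t * prodf l p k z t).
apply Rmult_le_compat; [apply fac_ge0|apply prodf_ge0| |].
- apply H2; auto; split; auto; eapply Rle_trans; [exact t1|apply Rmin_r].
- apply H1; auto; split; auto; eapply Rle_trans; [exact t1|apply Rmin_l].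
Qed.

Lemma prodf_same l p k z t phi0 :
  (forall phi, In phi l -> agree p k phi -> forall j, phi j = phi0 j) ->
  prodf l p k z t = Cmod (Cminus (RtoC z) (pval (sshift k phi0) t)) ^ cnt l p k.
Proof.
intros H; rewrite <- rprod_if_agree; apply rprod_ext; intros phi hphi; unfold fac.
destruct (agreeb p k phi) eqn:E; auto.
apply agreebP in E; rewrite (pval_ext (sshift k phi) (sshift k phi0)); [reflexivity|].
intros j; unfold sshift; now apply H.
Qed.

Lemma cnt0_not_agree l p k phi : cnt l p k = O -> In phi l -> agreeb p k phi = false.
Proof.
intros H hin; destruct (agreeb p k phi) eqn:E; auto; exfalso.
assert (I : In phi (filter (agreeb p k) l)) by (apply filter_In; auto).
unfold cnt in H; destruct (filter (agreeb p k) l); [destruct I|discriminate].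
Qed.

Lemma cnt_pos_ex l p k : (1 <= cnt l p k)%nat -> exists phi, In phi l /\ agree p k phi.
Proof.
unfold cnt; destruct (filter (agreeb p k) l) as [|phi l'] eqn:E; simpl; [lia|]; intros _.
assert (I : In phi (filter (agreeb p k) l)) by (rewrite E; now left).
apply filter_In in I; destruct I as [h1 h2]; apply agreebP in h2; now exists phi.
Qed.

Lemma rpow0_pow x n al : 0 < x -> rpow0 (x ^ n) al = Rpower x (INR n * al).
Proof.
intros hx; rewrite rpow0_pos by now apply pow_lt.
now rewrite <- Rpower_pow, Rpower_mult.
Qed.

Section TreeAnalysis.
Variables (lam : R) (Phi Psi : list (nat -> C)) (K : nat).
Hypothesis lam0 : 0 < lam.
Hypothesis Hheight : forall p k, (k <= K)%nat -> height lam Phi Psi p k <= 0.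
Hypothesis Hleaf : forall p, (1 <= cnt Phi p K)%nat ->
  INR (cnt Phi p K) <= lam * INR (cnt Psi p K).
Hypothesis Hsep : forall phi psi, In phi (Phi ++ Psi) -> In psi (Phi ++ Psi) ->
  (forall j, (j < K)%nat -> phi j = psi j) -> forall j, phi j = psi j.
Hypothesis Hconv : forall phi, In phi (Phi ++ Psi) -> conv1 phi.

(** At the node [f] is, up to constants, [t^(ord f)] times [prodf Phi], and likewise [g]; dividing
    [|f| >= A * |g|^lam] by [t^(ord f)] leaves the factor [t^(-height)]. All [Q] are allowed because
    the parent uses the inequality on a region whose size in the child's coordinate is not known in
    advance. *)
Definition node_ineq p k : Prop := forall Q, 0 <= Q -> exists A del, 0 < A /\ 0 < del /\
  forall t z, 0 < t < del -> Rabs z <= Q ->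
  A * (Rpower t (- height lam Phi Psi p k) * rpow0 (prodf Psi p k z t) lam) <= prodf Phi p k z t.

Let convPhi phi : In phi Phi -> conv1 phi.
Proof. intros H; apply Hconv, in_or_app; auto. Qed.
Let convPsi phi : In phi Psi -> conv1 phi.
Proof. intros H; apply Hconv, in_or_app; auto. Qed.

(** At level [K] all roots through [p] coincide by [Hsep], so the products are [u^m] and [u^n] for
    one bounded [u], and [m <= lam * n] bounds [u^(lam * n)] by a multiple of [u^m]. Without roots
    of [f] it suffices that the product for [g] is bounded. In both cases a height at most 0 gives
    [t^(-height) <= 1]. *)
Lemma node_ineq_leaf p : node_ineq p K.
Proof.
intros Q Q0; pose proof (Hheight p K (le_n _)) as h0.
destruct (prodf_bounded Psi p K Q convPsi) as [rho [B [rho0 [B1 HB]]]].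
destruct (Nat.eq_dec (cnt Phi p K) 0) as [E|ne].
- exists (/ Rpower B lam), (Rmin rho 1).
  assert (bp : 0 < Rpower B lam) by apply exp_pos.
  split; [now apply Rinv_0_lt_compat|]; split; [apply Rmin_pos; lra|].
  intros t z [t0 t1] hz.
  assert (tr : t < rho) by min_bound.
  assert (t1' : t < 1) by min_bound.
  replace (prodf Phi p K z t) with 1.
    2:{ unfold prodf; rewrite <- (pow1 (cnt Phi p K)), <- (rprod_if_agree p K 1 Phi).
        apply rprod_ext; intros phi hphi; unfold fac; now rewrite (cnt0_not_agree Phi p K phi E hphi). }
  assert (P1 : rpow0 (prodf Psi p K z t) lam <= Rpower B lam).
    rewrite <- rpow0_pos by lra; apply rpow0_le; [lra|apply prodf_ge0|apply HB; auto; lra].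
  assert (P2 : Rpower t (- height lam Phi Psi p K) <= 1) by (apply Rpower_le_1; lra).
  apply Rmult_le_reg_l with (Rpower B lam); auto.
  rewrite <- Rmult_assoc, Rinv_r, Rmult_1_l, Rmult_1_r by lra.
  rewrite <- (Rmult_1_l (Rpower B lam)); apply Rmult_le_compat; auto; [left; apply exp_pos|apply rpow0_ge0].
- assert (c1 : (1 <= cnt Phi p K)%nat) by lia.
  destruct (cnt_pos_ex Phi p K c1) as [phi0 [hin hag]].
  pose proof (Hleaf p c1) as hl; set (m := cnt Phi p K) in *; set (n := cnt Psi p K) in *.
  assert (m1 : 1 <= INR m) by (change 1 with (INR 1); now apply le_INR).
  destruct (fac_bounded phi0 p K Q (convPhi _ hin)) as [r2 [D [r20 [D1 HD]]]].
  assert (same : forall l, (forall phi, In phi l -> In phi (Phi ++ Psi)) -> forall phi, In phi l ->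
     agree p K phi -> forall j, phi j = phi0 j).
    intros l hl' phi hphi hag'; apply Hsep; [now apply hl'|apply in_or_app; now left|].
    intros j hj; rewrite (hag' j hj), (hag j hj); reflexivity.
  exists (/ Rpower D (INR n * lam - INR m)), (Rmin r2 1).
  assert (bp : 0 < Rpower D (INR n * lam - INR m)) by apply exp_pos.
  split; [now apply Rinv_0_lt_compat|]; split; [apply Rmin_pos; lra|].
  intros t z [t0 t1] hz.
  assert (tr : t < r2) by min_bound.
  assert (t1' : t < 1) by min_bound.
  rewrite (prodf_same Phi p K z t phi0) by (apply same; intros; apply in_or_app; now left).
  rewrite (prodf_same Psi p K z t phi0) by (apply same; intros; apply in_or_app; now right).
  fold m n.
  assert (hu : fac phi0 p K z t <= D) by (apply HD; auto; lra).
  unfold fac in hu; rewrite (proj2 (agreebP p K phi0) hag) in hu.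
  set (u := Cmod (Cminus (RtoC z) (pval (sshift K phi0) t))) in *.
  assert (P2 : Rpower t (- height lam Phi Psi p K) <= 1) by (apply Rpower_le_1; lra).
  apply Rmult_le_reg_l with (Rpower D (INR n * lam - INR m)); auto.
  rewrite <- Rmult_assoc, Rinv_r, Rmult_1_l by lra.
  apply Rle_trans with (rpow0 (u ^ n) lam).
    rewrite <- (Rmult_1_l (rpow0 (u ^ n) lam)) at 2; apply Rmult_le_compat_r; [apply rpow0_ge0|auto].
  destruct (Rle_lt_or_eq_dec 0 u (Cmod_ge_0 _)) as [hp|hz0].
  + rewrite rpow0_pow, <- Rpower_pow by auto.
    replace (INR n * lam) with ((INR n * lam - INR m) + INR m) at 1 by ring.
    rewrite Rpower_plus; apply Rmult_le_compat_r; [left; apply exp_pos|].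
    apply Rle_Rpower_l; lra.
  (* At [u = 0] both sides vanish: [m <= lam * n] with [m >= 1] excludes [n = 0]. *)
  + rewrite <- hz0, !pow_i, rpow0_0; [lra|lia|].
    destruct n; [simpl in hl; lra|lia].
Qed.

(** Both products are monomials in [w], and what remains is [t^(-H) <= w^s] with [s = f - lam * g].
    For [s <= 0] the right side is at least 1; for [s > 0] it is at least [t^s], as [w >= t], and
    [s <= -H] because the height of the child is at most 0. *)
Lemma outer_estimate e f g N N' H t w :
  0 < e <= 1 -> 0 < t < e -> t / e <= w -> w < e -> H <= 0 -> H + (INR f - lam * INR g) <= 0 ->
  forall X Y, 0 <= Y -> Y <= w ^ g / e ^ N' -> e ^ N * w ^ f <= X ->
  (e ^ N * Rpower (e ^ N') lam) * (Rpower t (- H) * rpow0 Y lam) <= X.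
Proof.
intros [e0 e1] [t0 t1] tw we h0 hc X Y Y0 HY HX.
assert (w0 : 0 < w) by (eapply Rlt_le_trans; [|exact tw]; apply Rdiv_lt_0_compat; lra).
assert (eN : 0 < e ^ N) by now apply pow_lt.
assert (eN' : 0 < e ^ N') by now apply pow_lt.
assert (wg : 0 < w ^ g) by now apply pow_lt.
eapply Rle_trans; [|exact HX].
rewrite Rmult_assoc; apply Rmult_le_compat_l; [lra|].
assert (HYl : Rpower (e ^ N') lam * rpow0 Y lam <= Rpower w (INR g * lam)).
  rewrite <- rpow0_pos, <- rpow0_mult, <- rpow0_pow by lra.
  apply rpow0_le; [lra|apply Rmult_le_pos; lra|].
  apply Rle_trans with (e ^ N' * (w ^ g / e ^ N')); [apply Rmult_le_compat_l; lra|].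
  right; field; lra.
apply Rle_trans with (Rpower t (- H) * Rpower w (INR g * lam)).
  rewrite <- Rmult_assoc, (Rmult_comm (Rpower (e ^ N') lam)), Rmult_assoc.
  apply Rmult_le_compat_l; [left; apply exp_pos|exact HYl].
rewrite <- Rpower_pow by auto.
replace (INR f) with ((INR f - lam * INR g) + INR g * lam) by ring.
rewrite Rpower_plus; apply Rmult_le_compat_r; [left; apply exp_pos|].
set (s := INR f - lam * INR g) in *.
destruct (Rle_lt_dec s 0) as [hs|hs].
  apply Rle_trans with 1; [apply Rpower_le_1; lra|apply Rpower_ge1; lra].
assert (tw' : t <= w).
  eapply Rle_trans; [|exact tw]; replace t with (t * / 1) at 1 by field.
  apply Rmult_le_compat_l; [lra|apply Rinv_le_contravar; lra].
apply Rle_trans with (Rpower t s); [apply Rpower_le1; lra|].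
apply Rle_Rpower_l; lra.
Qed.

(** The powers of [t] split off in passing to the child make up exactly the difference between its
    height and that of the node, so the child's inequality carries over without loss in the
    exponent. *)
Lemma inner_estimate e f g N N' H A t X Y P Q :
  0 < e -> 0 < t -> 0 < A -> 0 <= Y -> 0 <= Q ->
  Y <= t ^ g * Q / e ^ N' -> e ^ N * (t ^ f * P) <= X ->
  A * (Rpower t (- (H + (INR f - lam * INR g))) * rpow0 Q lam) <= P ->
  (e ^ N * A * Rpower (e ^ N') lam) * (Rpower t (- H) * rpow0 Y lam) <= X.
Proof.
intros e0 t0 A0 Y0 Q0 HY HX HP.
assert (eN : 0 < e ^ N) by now apply pow_lt.
assert (eN' : 0 < e ^ N') by now apply pow_lt.
assert (tg : 0 < t ^ g) by now apply pow_lt.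
assert (tf : 0 < t ^ f) by now apply pow_lt.
eapply Rle_trans; [|exact HX].
rewrite !Rmult_assoc; apply Rmult_le_compat_l; [lra|].
assert (HYl : Rpower (e ^ N') lam * rpow0 Y lam <= Rpower t (INR g * lam) * rpow0 Q lam).
  rewrite <- rpow0_pos, <- rpow0_mult, <- rpow0_pow, <- rpow0_mult by lra.
  apply rpow0_le; [lra|apply Rmult_le_pos; lra|].
  apply Rle_trans with (e ^ N' * (t ^ g * Q / e ^ N')); [apply Rmult_le_compat_l; lra|].
  right; field; lra.
apply Rle_trans with (A * (Rpower t (- H) * (Rpower t (INR g * lam) * rpow0 Q lam))).
  apply Rmult_le_compat_l; [lra|].
  rewrite <- Rmult_assoc, (Rmult_comm (Rpower (e ^ N') lam)), Rmult_assoc.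
  apply Rmult_le_compat_l; [left; apply exp_pos|exact HYl].
apply Rle_trans with (t ^ f * (A * (Rpower t (- (H + (INR f - lam * INR g))) * rpow0 Q lam)));
  [|apply Rmult_le_compat_l; lra].
right; rewrite <- Rpower_pow by auto.
replace (Rpower t (INR f) * (A * (Rpower t (- (H + (INR f - lam * INR g))) * rpow0 Q lam))) with
  (A * (Rpower t (INR f) * Rpower t (- (H + (INR f - lam * INR g)))) * rpow0 Q lam) by ring.
rewrite <- Rpower_plus.
replace (A * (Rpower t (- H) * (Rpower t (INR g * lam) * rpow0 Q lam))) with
  (A * (Rpower t (- H) * Rpower t (INR g * lam)) * rpow0 Q lam) by ring.
rewrite <- Rpower_plus; do 3 f_equal; ring.
Qed.

Lemma prodf_outer l p k c : (forall phi, In phi l -> conv1 phi) ->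
  exists e0, 0 < e0 /\ forall e, 0 < e <= e0 -> forall t z,
    0 < t < e -> Rabs (z - c) < e -> t / e <= Rabs (z - c) ->
    e ^ length l * Rabs (z - c) ^ cnt l (upd p k c) (S k) <= prodf l p k z t <=
    Rabs (z - c) ^ cnt l (upd p k c) (S k) / e ^ length l.
Proof.
intros Hl.
destruct (rprod_compare l
  (fun e (x : R * R) => 0 < snd x < e /\ Rabs (fst x - c) < e /\ snd x / e <= Rabs (fst x - c))
  (fun phi x => fac phi p k (fst x) (snd x))
  (fun phi x => if agreeb (upd p k c) (S k) phi then Rabs (fst x - c) else 1)) as [e0 [e00 H]].
  intros phi hphi; apply fac_outer, Hl, hphi.
exists e0; split; auto; intros e he t z h1 h2 h3.
destruct (H e he (z, t)) as [_ B]; [simpl; auto|]; simpl in B.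
rewrite rprod_if_agree in B; exact B.
Qed.

Lemma prodf_inner l p k c Q : (forall phi, In phi l -> conv1 phi) -> 0 <= Q ->
  exists e0, 0 < e0 /\ forall e, 0 < e <= e0 -> forall t z, 0 < t < e -> Rabs z <= Q ->
    e ^ length l * (t ^ cnt l (upd p k c) (S k) * prodf l (upd p k c) (S k) z t)
      <= prodf l p k (c + t * z) t <=
    t ^ cnt l (upd p k c) (S k) * prodf l (upd p k c) (S k) z t / e ^ length l.
Proof.
intros Hl Q0.
destruct (rprod_compare l (fun e (x : R * R) => 0 < snd x < e /\ Rabs (fst x) <= Q)
  (fun phi x => fac phi p k (c + snd x * fst x) (snd x))
  (fun phi x => (if agreeb (upd p k c) (S k) phi then snd x else 1) *
                fac phi (upd p k c) (S k) (fst x) (snd x))) as [e0 [e00 H]].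
  intros phi hphi; apply fac_inner; auto.
exists e0; split; auto; intros e he t z h1 h2.
destruct (H e he (z, t)) as [_ B]; [simpl; auto|]; simpl in B.
rewrite rprod_mult, rprod_if_agree in B; exact B.
Qed.

Lemma node_ineq_local p k c : (k < K)%nat -> node_ineq (upd p k c) (S k) ->
  exists e, 0 < e /\ forall t z, 0 < t < e -> Rabs (z - c) < e ->
  e * (Rpower t (- height lam Phi Psi p k) * rpow0 (prodf Psi p k z t) lam) <= prodf Phi p k z t.
Proof.
intros hk Hchild.
set (f := cnt Phi (upd p k c) (S k)); set (g := cnt Psi (upd p k c) (S k)).
pose proof (Hheight p k ltac:(lia)) as h0; pose proof (Hheight (upd p k c) (S k) hk) as h1.
pose proof (height_upd lam Phi Psi p k c) as Eh; fold f g in Eh.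
set (H := height lam Phi Psi p k) in *.
destruct (prodf_outer Phi p k c convPhi) as [e1 [e10 O1]].
destruct (prodf_outer Psi p k c convPsi) as [e2 [e20 O2]].
set (e := Rmin 1 (Rmin e1 e2)).
assert (e0 : 0 < e) by (repeat apply Rmin_pos; lra).
assert (le1 : e <= 1) by apply Rmin_l.
assert (le2 : e <= e1) by min_bound.
assert (le3 : e <= e2) by min_bound.
assert (ie : 0 < / e) by now apply Rinv_0_lt_compat.
(* The inner region [|z - c| < t / e] lies in [|z'| <= / e] in the coordinate of the child, so the
   child's inequality is needed with [Q = / e]. *)
destruct (prodf_inner Phi p k c (/ e) convPhi) as [d1 [d10 I1]]; [lra|].
destruct (prodf_inner Psi p k c (/ e) convPsi) as [d2 [d20 I2]]; [lra|].
set (d := Rmin d1 d2).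
assert (d0 : 0 < d) by (apply Rmin_pos; auto).
assert (ld1 : d <= d1) by apply Rmin_l; assert (ld2 : d <= d2) by apply Rmin_r.
destruct (Hchild (/ e)) as [A [del [A0 [del0 HA]]]]; [lra|].
rewrite Eh in h1.
set (kap1 := e ^ length Phi * Rpower (e ^ length Psi) lam).
set (kap2 := d ^ length Phi * A * Rpower (d ^ length Psi) lam).
assert (kap10 : 0 < kap1) by (apply Rmult_lt_0_compat; [now apply pow_lt|apply exp_pos]).
assert (kap20 : 0 < kap2).
  apply Rmult_lt_0_compat; [apply Rmult_lt_0_compat; [now apply pow_lt|auto]|apply exp_pos].
set (eps := Rmin (Rmin e (Rmin d del)) (Rmin kap1 kap2)).
exists eps; split; [repeat apply Rmin_pos; auto; lra|].
assert (s1 : eps <= e) by min_bound.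
assert (s2 : eps <= d) by min_bound.
assert (s3 : eps <= del) by min_bound.
assert (s4 : eps <= kap1) by min_bound.
assert (s5 : eps <= kap2) by min_bound.
clearbody eps; intros t z [t0 t1] hz.
assert (X0 : 0 <= Rpower t (- H) * rpow0 (prodf Psi p k z t) lam).
  apply Rmult_le_pos; [left; apply exp_pos|apply rpow0_ge0].
destruct (Rle_lt_dec (t / e) (Rabs (z - c))) as [hw|hw].
- apply Rle_trans with (kap1 * (Rpower t (- H) * rpow0 (prodf Psi p k z t) lam)).
    apply Rmult_le_compat_r; auto.
  destruct (O1 e (conj e0 le2) t z) as [B1 _]; [lra|lra|auto|].
  destruct (O2 e (conj e0 le3) t z) as [_ B2]; [lra|lra|auto|].
  apply (outer_estimate e f g (length Phi) (length Psi) H t (Rabs (z - c))); auto; try lra.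
  apply prodf_ge0.
- apply Rle_trans with (kap2 * (Rpower t (- H) * rpow0 (prodf Psi p k z t) lam)).
    apply Rmult_le_compat_r; auto.
  set (z' := (z - c) / t).
  assert (Ez : z = c + t * z') by (unfold z'; field; lra).
  assert (hz' : Rabs z' <= / e).
    unfold z', Rdiv; rewrite Rabs_mult, (Rabs_pos_eq (/ t)) by (left; now apply Rinv_0_lt_compat).
    apply Rmult_le_reg_r with t; auto; rewrite Rmult_assoc, Rinv_l, Rmult_1_r by lra.
    unfold Rdiv in hw; lra.
  destruct (I1 d (conj d0 ld1) t z') as [B1 _]; [lra|auto|].
  destruct (I2 d (conj d0 ld2) t z') as [_ B2]; [lra|auto|].
  rewrite <- Ez in B1, B2.
  apply (inner_estimate d f g (length Phi) (length Psi) H A t _ _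
     (prodf Phi (upd p k c) (S k) z' t) (prodf Psi (upd p k c) (S k) z' t)); auto;
     try apply prodf_ge0.
  rewrite <- Eh; apply HA; auto; lra.
Qed.

Lemma node_ineq_all n : forall p k, (k + n = K)%nat -> node_ineq p k.
Proof.
induction n; intros p k Hk.
  replace k with K by lia; apply node_ineq_leaf.
intros Q Q0.
assert (loc : forall c, exists e : posreal, forall t z, 0 < t < e -> Rabs (z - c) < e ->
  e * (Rpower t (- height lam Phi Psi p k) * rpow0 (prodf Psi p k z t) lam) <= prodf Phi p k z t).
  intros c; destruct (node_ineq_local p k c) as [e [e0 He]]; [lia|apply IHn; lia|].
  exists (mkposreal e e0); exact He.
set (del := fun c => proj1_sig (constructive_indefinite_description _ (loc c))).
assert (Hdel : forall c t z, 0 < t < del c -> Rabs (z - c) < del c ->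
  del c * (Rpower t (- height lam Phi Psi p k) * rpow0 (prodf Psi p k z t) lam) <= prodf Phi p k z t).
  intros c; unfold del; exact (proj2_sig (constructive_indefinite_description _ (loc c))).
(* Every real [c] is a child, whether or not a root passes through it, so there are infinitely many
   local estimates. Compactness gives a [d] such that each [z] lies in the neighbourhood of some [c]
   with [d <= del c]; this [d] serves both as the constant and as the bound for [t]. Its conclusion
   is doubly negated, hence the detour by contradiction. *)
destruct (compactness_value_1d (- Q) Q del) as [d Hd].
exists d, d; split; [apply cond_pos|]; split; [apply cond_pos|].
intros t z [t0 t1] hz; apply Rabs_le_between in hz.
apply NNPP; intros no; apply (Hd z hz); intros [c [hc [h1 h2]]]; apply no.
eapply Rle_trans; [|apply (Hdel c); [lra|exact h1]].
apply Rmult_le_compat_r; [|exact h2].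
apply Rmult_le_pos; [left; apply exp_pos|apply rpow0_ge0].
Qed.

End TreeAnalysis.

(** * Orders and multiplicities of factored germs *)

Definition factored (a : nat -> nat -> R) (N : nat) (Phi : list (nat -> C)) (U : nat -> nat -> C) : Prop :=
  List.Forall (fun phi => phi 0%nat = RtoC 0 /\ conv1 phi) Phi /\ conv2 Cmod U /\ U 0%nat 0%nat <> RtoC 0 /\
  exists r, 0 < r /\ forall x t, Cmod x < r -> 0 < t -> t < r ->
    eval2 (fun i j => RtoC (a i j)) x (RtoC (t ^ N)) =
    Cmult (eval2 U x (RtoC t)) (lprod (fun phi => Cminus x (pval phi t)) Phi).

Lemma conv2_bound c : conv2 Cmod c <->
  exists M q, 0 <= M /\ 0 < q /\ forall i j, Cmod (c i j) <= M * q ^ (i + j).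
Proof.
split.
- intros [r [M [r0 H]]]; exists M, (/ r); split.
    eapply Rle_trans; [|apply (H 0%nat 0%nat)]; simpl; pose proof (Cmod_ge_0 (c 0%nat 0%nat)); lra.
  split; [now apply Rinv_0_lt_compat|]; intros i j.
  rewrite pow_inv; apply Rmult_le_reg_r with (r ^ (i + j)); [now apply pow_lt|].
  rewrite Rmult_assoc, Rinv_l, Rmult_1_r; [apply H|]; apply pow_nonzero; lra.
- intros [M [q [M0 [q0 H]]]]; exists (/ q), M; split; [now apply Rinv_0_lt_compat|].
  intros i j; rewrite pow_inv; apply Rmult_le_reg_r with (q ^ (i + j)); [now apply pow_lt|].
  rewrite Rmult_assoc, Rinv_l, Rmult_1_r; [apply H|]; apply pow_nonzero; lra.
Qed.

Lemma csum_triangle (G : nat -> nat -> C) n :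
  csum (fun i => csum (fun l => G i l) (n - i)) n = csum (fun l => csum (fun i => G i l) (n - l)) n.
Proof.
assert (S : forall (F : nat -> nat -> C) n, csum (fun i => csum (fun l => F i l) (S n - i)) (S n) =
   Cplus (csum (fun i => csum (fun l => F i l) (n - i)) n) (csum (fun i => F i (S n - i)%nat) (S n))).
  intros F m; change (csum (fun i => csum (fun l => F i l) (S m - i)) (S m)) with
    (Cplus (csum (fun i => csum (fun l => F i l) (S m - i)) m) (csum (fun l => F (S m) l) (S m - S m))).
  rewrite Nat.sub_diag.
  rewrite (csum_ext _ (fun i => Cplus (csum (fun l => F i l) (m - i)) (F i (S m - i)%nat))).
    rewrite csum_plus; simpl; rewrite Nat.sub_diag; ring.
  intros i hi; replace (S m - i)%nat with (S (m - i)) by lia; reflexivity.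
assert (rev : forall (u : nat -> C) n, csum (fun i => u (n - i)%nat) n = csum u n).
  intros u m; assert (E : forall k, (k <= m)%nat -> csum (fun i => u (k - i)%nat) k = csum u k); [|apply E; lia].
  assert (F : forall (v : nat -> C) k, csum v (Datatypes.S k) = Cplus (v 0%nat) (csum (fun i => v (Datatypes.S i)) k)).
    intros v k; induction k; [reflexivity|].
    change (csum v (Datatypes.S (Datatypes.S k))) with (Cplus (csum v (Datatypes.S k)) (v (Datatypes.S (Datatypes.S k)))).
    rewrite IHk; simpl; ring.
  intros k; induction k; intros hk; [reflexivity|].
  rewrite F; simpl Nat.sub; rewrite IHk by lia; simpl; ring.
induction n; [reflexivity|].
rewrite S, IHn, (S (fun l i => G i l)); f_equal.
rewrite <- (rev (fun i => G i (Datatypes.S n - i)%nat)); apply csum_ext; intros i hi.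
f_equal; lia.
Qed.

Lemma hterm_shiftx U x t n :
  hterm (fun i j => match i with O => RtoC 0 | S i => U i j end) x t (S n) = Cmult x (hterm U x t n).
Proof.
assert (F : forall (v : nat -> C) k, csum v (S k) = Cplus (v 0%nat) (csum (fun i => v (S i)) k)).
  intros v k; induction k; [reflexivity|].
  change (csum v (S (S k))) with (Cplus (csum v (S k)) (v (S (S k)))).
  rewrite IHk; simpl; ring.
unfold hterm; rewrite F, <- csum_mult_l.
rewrite Cmult_0_l, Cplus_0_l; apply csum_ext; intros i hi; simpl; ring.
Qed.

Lemma hterm_mulphi U phi x t n :
  hterm (fun i j => csum (fun l => Cmult (phi l) (U i (j - l)%nat)) j) x (RtoC t) n =
  cconv (fun l => Cmult (phi l) (RtoC (t ^ l))) (hterm U x (RtoC t)) n.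
Proof.
unfold cconv, hterm.
rewrite (csum_ext (fun i => Cmult (csum (fun l => Cmult (phi l) (U i (n - i - l)%nat)) (n - i))
   (Cmult (cpow x i) (cpow (RtoC t) (n - i)))) (fun i => csum (fun l =>
     Cmult (Cmult (phi l) (RtoC (t ^ l))) (Cmult (U i (n - l - i)%nat) (Cmult (cpow x i) (cpow (RtoC t) (n - l - i))))) (n - i))).
  rewrite csum_triangle; apply csum_ext; intros l hl; now rewrite csum_mult_l.
intros i hi; rewrite Cmult_comm, <- csum_mult_l; apply csum_ext; intros l hl.
rewrite !cpow_RtoC; replace (n - l - i)%nat with (n - i - l)%nat by lia.
replace (t ^ (n - i)) with (t ^ l * t ^ (n - i - l)) by (rewrite <- pow_add; f_equal; lia).
rewrite RtoC_mult; ring.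
Qed.

(** [mult] wants the cofactor of a root as one convergent series in [x] and [t], so the remaining
    root factors have to be absorbed into the unit. *)
Lemma mul_root_factor phi U : conv1 phi -> conv2 Cmod U -> exists W, conv2 Cmod W /\
  exists r, 0 < r /\ forall x t, Cmod x < r -> 0 < t -> t < r ->
    eval2 W x (RtoC t) = Cmult (Cminus x (pval phi t)) (eval2 U x (RtoC t)).
Proof.
intros Hphi HU.
set (W1 := fun i j => match i with O => RtoC 0 | S i => U i j end).
set (W2 := fun i j => csum (fun l => Cmult (phi l) (U i (j - l)%nat)) j).
destruct (conv1_geo _ Hphi) as [M1 [q1 [M10 [q10 H1]]]].
destruct (proj1 (conv2_bound U) HU) as [M2 [q2 [M20 [q20 H2]]]].
set (q := q1 + q2 + 1).
assert (Cpow : forall s n, 0 < s <= q -> s ^ n <= q ^ n) by (intros; apply pow_incr; lra).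
assert (Hc1 : conv2 Cmod W1).
  apply conv2_bound; exists M2, q; split; auto; split; [unfold q; lra|]; intros i j.
  destruct i; simpl.
    rewrite Cmod_0; apply Rmult_le_pos; auto; apply pow_le; unfold q; lra.
  eapply Rle_trans; [apply H2|]; apply Rmult_le_compat_l; auto.
  apply Rle_trans with (q ^ (i + j)); [apply Cpow; unfold q; lra|].
  assert (0 <= q ^ (i + j)) by (apply pow_le; unfold q; lra).
  rewrite <- (Rmult_1_l (q ^ (i + j))) at 1; apply Rmult_le_compat_r; auto; unfold q; lra.
assert (Hc2 : conv2 Cmod W2).
  apply conv2_bound; exists (M1 * M2), (2 * q); split; [now apply Rmult_le_pos|].
  split; [unfold q; lra|]; intros i j; unfold W2.
  apply Rle_trans with (INR (S j) * (M1 * M2 * q ^ (i + j))).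
    apply Cmod_csum_const; intros l hl; rewrite Cmod_mult.
    replace (q ^ (i + j)) with (q ^ l * q ^ (i + (j - l))) by (rewrite <- pow_add; f_equal; lia).
    replace (M1 * M2 * (q ^ l * q ^ (i + (j - l)))) with
      ((M1 * q ^ l) * (M2 * q ^ (i + (j - l)))) by ring.
    apply Rmult_le_compat; try apply Cmod_ge_0.
      eapply Rle_trans; [apply H1|]; apply Rmult_le_compat_l; auto; apply Cpow; unfold q; lra.
    eapply Rle_trans; [apply H2|]; apply Rmult_le_compat_l; auto; apply Cpow; unfold q; lra.
  rewrite Rpow_mult_distr.
  replace (INR (S j) * (M1 * M2 * q ^ (i + j))) with (M1 * M2 * (INR (S j) * q ^ (i + j))) by ring.
  apply Rmult_le_compat_l; [now apply Rmult_le_pos|].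
  apply Rmult_le_compat_r; [apply pow_le; unfold q; lra|].
  eapply Rle_trans; [apply INR_lt_pow2|]; apply Rle_pow; [lra|lia].
set (W := fun i j => Cminus (W1 i j) (W2 i j)).
assert (Hc : conv2 Cmod W).
  destruct (proj1 (conv2_bound W1) Hc1) as [A [s [A0 [s0 HA]]]].
  destruct (proj1 (conv2_bound W2) Hc2) as [B [u [B0 [u0 HB]]]].
  apply conv2_bound; exists (A + B), (s + u); split; [lra|]; split; [lra|]; intros i j.
  unfold W; eapply Rle_trans; [apply Cmod_triangle|]; rewrite Cmod_opp, Rmult_plus_distr_r.
  apply Rplus_le_compat.
    eapply Rle_trans; [apply HA|]; apply Rmult_le_compat_l; auto; apply pow_incr; lra.
  eapply Rle_trans; [apply HB|]; apply Rmult_le_compat_l; auto; apply pow_incr; lra.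
exists W; split; auto.
destruct (pval_bound phi Hphi) as [r1 [B1 [r10 [_ Hs]]]].
destruct HU as [r2 [B2 [r20 HU]]]; destruct Hc1 as [r3 [B3 [r30 Hc1]]]; destruct Hc2 as [r4 [B4 [r40 Hc2]]].
set (r := Rmin (Rmin r1 (r2 / 8)) (Rmin (r3 / 8) (r4 / 8))).
exists r; split; [repeat apply Rmin_pos; lra|]; intros x t hx t0 ht.
assert (s1 : r <= r1) by min_bound.
assert (s2 : r <= r2 / 8) by min_bound.
assert (s3 : r <= r3 / 8) by min_bound.
assert (s4 : r <= r4 / 8) by min_bound.
assert (ct : Cmod (RtoC t) = t) by (rewrite Cmod_R, Rabs_pos_eq; lra).
destruct (Hs t) as [At _]; [lra|].
pose proof (hterm_asum U r2 B2 HU x (RtoC t) ltac:(lra) ltac:(lra)) as AU.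
pose proof (hterm_asum W1 r3 B3 Hc1 x (RtoC t) ltac:(lra) ltac:(lra)) as AW1.
pose proof (hterm_asum W2 r4 B4 Hc2 x (RtoC t) ltac:(lra) ltac:(lra)) as AW2.
assert (EW : forall n, hterm W x (RtoC t) n = Cminus (hterm W1 x (RtoC t) n) (hterm W2 x (RtoC t) n)).
  intros n; unfold hterm; rewrite <- csum_minus; apply csum_ext; intros i hi; unfold W; ring.
change (eval2 W x (RtoC t)) with (CSeries (hterm W x (RtoC t))).
rewrite (CSeries_ext _ _ EW), (proj2 (CSeries_minus _ _ AW1 AW2)).
assert (E2 : CSeries (hterm W2 x (RtoC t)) = Cmult (pval phi t) (eval2 U x (RtoC t))).
  transitivity (CSeries (cconv (fun l => Cmult (phi l) (RtoC (t ^ l))) (hterm U x (RtoC t)))).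
    apply CSeries_ext; intros n; apply hterm_mulphi.
  now apply CSeries_cconv.
assert (E1 : CSeries (hterm W1 x (RtoC t)) = Cmult x (eval2 U x (RtoC t))).
  rewrite (CSeries_incr_n _ 0) by exact AW1.
  replace (CSeries (fun k => hterm W1 x (RtoC t) (1 + k))) with
    (CSeries (fun k => Cmult x (hterm U x (RtoC t) k))).
    rewrite CSeries_scal by exact AU.
    unfold eval2, hterm; simpl; ring.
  apply CSeries_ext; intros n; symmetry; apply hterm_shiftx.
rewrite E1, E2; ring.
Qed.

Lemma mul_root_factors l U : (forall phi, In phi l -> conv1 phi) -> conv2 Cmod U ->
  exists W, conv2 Cmod W /\
  exists r, 0 < r /\ forall x t, Cmod x < r -> 0 < t -> t < r ->
    eval2 W x (RtoC t) = Cmult (eval2 U x (RtoC t)) (lprod (fun phi => Cminus x (pval phi t)) l).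
Proof.
intros Hl HU; induction l as [|phi l IH].
  exists U; split; auto; exists 1; split; [lra|]; intros; simpl; ring.
destruct IH as [W [HW [r [r0 H]]]]; [intros; apply Hl; now right|].
destruct (mul_root_factor phi W) as [W' [HW' [r' [r0' H']]]]; auto; [apply Hl; now left|].
exists W'; split; auto; exists (Rmin r r'); split; [now apply Rmin_pos|]; intros x t hx t0 ht.
assert (Rmin r r' <= r) by apply Rmin_l; assert (Rmin r r' <= r') by apply Rmin_r.
rewrite H', H by lra; simpl; ring.
Qed.

Lemma unit_bounds U : conv2 Cmod U -> U 0%nat 0%nat <> RtoC 0 ->
  exists r c1 c2, 0 < r /\ 0 < c1 /\ 0 < c2 /\ forall x t, Cmod x < r -> 0 < t -> t < r ->
    c1 <= Cmod (eval2 U x (RtoC t)) <= c2.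
Proof.
intros HU U0; destruct (eval2_lip U HU) as [s [L [s0 [L0 HL]]]].
assert (u0 : 0 < Cmod (U 0%nat 0%nat)) by now apply Cmod_gt_0.
set (u := Cmod (U 0%nat 0%nat)) in *.
set (r := Rmin s (u / 4 / (L + 1))).
assert (r0 : 0 < r) by (apply Rmin_pos; auto; apply Rdiv_lt_0_compat; lra).
exists r, (u / 2), (2 * u); split; auto; split; [lra|]; split; [lra|]; intros x t hx t0 ht.
assert (rs : r <= s) by apply Rmin_l; assert (ru : r <= u / 4 / (L + 1)) by apply Rmin_r.
assert (ct : Cmod (RtoC t) = t) by (rewrite Cmod_R, Rabs_pos_eq; lra).
assert (z0 : Cmod (RtoC 0) = 0) by apply Cmod_0.
pose proof (HL x (RtoC t) (RtoC 0) (RtoC 0) ltac:(lra) ltac:(lra) ltac:(lra) ltac:(lra)) as H.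
rewrite eval2_00 in H.
replace (Cminus x (RtoC 0)) with x in H by ring.
replace (Cminus (RtoC t) (RtoC 0)) with (RtoC t) in H by ring; rewrite ct in H.
assert (B : L * (Cmod x + t) <= u / 2).
  apply Rle_trans with ((L + 1) * (u / 4 / (L + 1) + u / 4 / (L + 1))).
    pose proof (Cmod_ge_0 x); apply Rmult_le_compat; lra.
  right; field; lra.
set (v := eval2 U x (RtoC t)) in *.
pose proof (Cmod_Cminus_tri v (U 0%nat 0%nat)) as T1.
pose proof (Cmod_Cminus_tri (U 0%nat 0%nat) v) as T2.
replace (Cminus (U 0%nat 0%nat) v) with (Copp (Cminus v (U 0%nat 0%nat))) in T2 by ring.
rewrite Cmod_opp in T2; fold u in T1, T2; lra.
Qed.

Lemma Cmod_lprod {A} (f : A -> C) l : Cmod (lprod f l) = rprod (fun v => Cmod (f v)) l.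
Proof. induction l; simpl; [apply Cmod_1|now rewrite Cmod_mult, IHl]. Qed.

Lemma lprod_zero {A} (f : A -> C) l v : In v l -> f v = RtoC 0 -> lprod f l = RtoC 0.
Proof.
induction l as [|w l IH]; simpl; intros [].
- subst w; intros ->; ring.
- intros H0; rewrite IH; auto; ring.
Qed.

Lemma first_index (P : nat -> Prop) : (exists n, P n) -> exists n, P n /\ forall j, (j < n)%nat -> ~ P j.
Proof.
intros [n Hn]; revert Hn; induction n as [n IH] using (well_founded_induction lt_wf); intros Hn.
destruct (classic (exists j, (j < n)%nat /\ P j)) as [[j [hj Pj]]|no]; [now apply (IH j)|].
exists n; split; auto; intros j hj Pj; apply no; now exists j.
Qed.

Definition sdiff (g phi : nat -> C) : nat -> C := fun k => Cminus (g k) (phi k).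

Lemma conv1_sdiff g phi : conv1 g -> conv1 phi -> conv1 (sdiff g phi).
Proof.
intros [r [M [r0 H]]] [r' [M' [r0' H']]]; exists (Rmin r r'), (M + M').
assert (m0 : 0 < Rmin r r') by now apply Rmin_pos.
split; auto; intros k; unfold sdiff.
apply Rle_trans with (Cmod (g k) * Rmin r r' ^ k + Cmod (phi k) * Rmin r r' ^ k).
  rewrite <- Rmult_plus_distr_r; apply Rmult_le_compat_r; [apply pow_le; lra|].
  eapply Rle_trans; [apply Cmod_triangle|]; rewrite Cmod_opp; lra.
apply Rplus_le_compat.
- eapply Rle_trans; [|apply (H k)]; apply Rmult_le_compat_l; [apply Cmod_ge_0|].
  apply pow_incr; split; [lra|apply Rmin_l].
- eapply Rle_trans; [|apply (H' k)]; apply Rmult_le_compat_l; [apply Cmod_ge_0|].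
  apply pow_incr; split; [lra|apply Rmin_r].
Qed.

Lemma pval_sdiff g phi : conv1 g -> conv1 phi -> exists rho, 0 < rho /\ forall t, 0 < t <= rho ->
  Cminus (pval g t) (pval phi t) = pval (sdiff g phi) t.
Proof.
intros Hg Hp; destruct (pval_bound g Hg) as [r1 [B1 [r10 [_ H1]]]].
destruct (pval_bound phi Hp) as [r2 [B2 [r20 [_ H2]]]].
exists (Rmin r1 r2); split; [now apply Rmin_pos|]; intros t [t0 t1].
assert (Rmin r1 r2 <= r1) by apply Rmin_l; assert (Rmin r1 r2 <= r2) by apply Rmin_r.
destruct (H1 t) as [A1 _]; [lra|]; destruct (H2 t) as [A2 _]; [lra|].
unfold pval; rewrite <- (proj2 (CSeries_minus _ _ A1 A2)).
apply CSeries_ext; intros k; unfold sdiff; ring.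
Qed.

Lemma Cminus_eq0 x y : Cminus x y = RtoC 0 -> x = y.
Proof. intros H; replace x with (Cplus (Cminus x y) y) by ring; rewrite H; ring. Qed.

Lemma diff_asymp g phi o : conv1 g -> conv1 phi -> (forall j, (j < o)%nat -> phi j = g j) ->
  phi o <> g o -> exists rho c1 c2, 0 < rho /\ 0 < c1 /\ 0 < c2 /\
  forall t, 0 < t <= rho -> c1 * t ^ o <= Cmod (Cminus (pval g t) (pval phi t)) <= c2 * t ^ o.
Proof.
intros Hg Hp Hj Ho; destruct (pval_sdiff g phi Hg Hp) as [r1 [r10 H1]].
destruct (pval_asymp (sdiff g phi) o (conv1_sdiff _ _ Hg Hp)) as [r2 [c1 [c2 [r20 [c10 [c20 H2]]]]]].
- intros j hj; unfold sdiff; rewrite (Hj j hj); ring.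
- unfold sdiff; intros h; apply Ho; symmetry; now apply Cminus_eq0.
- exists (Rmin r1 r2), c1, c2; split; [now apply Rmin_pos|]; split; auto; split; auto.
  intros t [t0 t1]; assert (Rmin r1 r2 <= r1) by apply Rmin_l; assert (Rmin r1 r2 <= r2) by apply Rmin_r.
  rewrite H1 by lra; apply H2; lra.
Qed.

Lemma osum_cons phi l p k : osum (phi :: l) p k = (osum (phi :: nil) p k + osum l p k)%nat.
Proof.
induction k; [reflexivity|].
change (osum (phi :: l) p k + cnt (phi :: l) p (S k) =
  osum (phi :: nil) p k + cnt (phi :: nil) p (S k) + (osum l p k + cnt l p (S k)))%nat.
rewrite IHk, !cnt_cons; unfold cnt at 2; simpl; lia.
Qed.

Lemma osum_single phi p k : let o := osum (phi :: nil) p k in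
  (o <= k)%nat /\ agree p o phi /\ ((o < k)%nat -> phi o <> RtoC (p o)).
Proof.
induction k as [|k [IH1 [IH2 IH3]]]; simpl.
  split; [lia|]; split; [intros j hj; lia|lia].
set (o := osum (phi :: nil) p k) in *.
rewrite cnt_cons; unfold cnt; simpl; rewrite Nat.add_0_r.
destruct (agreeb p (S k) phi) eqn:E.
- apply agreebP in E.
  assert (o = k).
    destruct (Nat.eq_dec o k) as [|ne]; auto; exfalso; apply IH3; [lia|apply E; lia].
  subst o; rewrite H, Nat.add_1_r; split; [lia|]; split; auto; lia.
- rewrite Nat.add_0_r; split; [lia|]; split; auto; intros ho.
  destruct (Nat.eq_dec o k) as [e|ne]; [|apply IH3; lia].
  intros h; assert (A : agree p (S k) phi).
    intros j hj; destruct (Nat.eq_dec j o) as [->|n2]; auto; apply IH2; lia.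
  apply agreebP in A; congruence.
Qed.

(** Each difference of [g] and a root has the order of contact of the two arcs. A root that agrees
    with [p] below [k] differs from [g] at [k] by the last hypothesis, so its contact is exactly
    [k], as [osum] counts it. *)
Lemma prod_asymp l p k (g : nat -> C) : (forall phi, In phi l -> conv1 phi) -> conv1 g ->
  (forall j, (j < k)%nat -> g j = RtoC (p j)) -> (forall phi, In phi l -> phi k <> g k) ->
  exists rho c1 c2, 0 < rho /\ 0 < c1 /\ 0 < c2 /\ forall t, 0 < t <= rho ->
    c1 * t ^ osum l p k <= Cmod (lprod (fun phi => Cminus (pval g t) (pval phi t)) l) <= c2 * t ^ osum l p k.
Proof.
intros Hl Hg Hp Hk; induction l as [|phi l IH].
  exists 1, 1, 1; split; [lra|]; split; [lra|]; split; [lra|]; intros t ht; simpl.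
  assert (E : osum nil p k = O) by (clear; induction k; simpl; auto; rewrite IHk; reflexivity).
  rewrite E, Cmod_1; simpl; lra.
destruct IH as [r1 [a1 [a2 [r10 [a10 [a20 H1]]]]]].
- intros; apply Hl; now right.
- intros; apply Hk; now right.
- destruct (osum_single phi p k) as [o1 [o2 o3]]; set (o := osum (phi :: nil) p k) in *.
  destruct (diff_asymp g phi o) as [r2 [b1 [b2 [r20 [b10 [b20 H2]]]]]]; auto.
  + apply Hl; now left.
  + intros j hj; rewrite (o2 j hj), Hp; auto; lia.
  + destruct (Nat.eq_dec o k) as [->|ne]; [apply Hk; now left|].
    rewrite Hp by lia; apply o3; lia.
  + exists (Rmin r1 r2), (b1 * a1), (b2 * a2); split; [now apply Rmin_pos|].
    split; [now apply Rmult_lt_0_compat|]; split; [now apply Rmult_lt_0_compat|]; intros t [t0 t1].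
    assert (Rmin r1 r2 <= r1) by apply Rmin_l; assert (Rmin r1 r2 <= r2) by apply Rmin_r.
    destruct (H1 t) as [u1 u2]; [lra|]; destruct (H2 t) as [v1 v2]; [lra|].
    rewrite osum_cons; fold o; simpl lprod; rewrite Cmod_mult, pow_add.
    assert (0 < t ^ o) by now apply pow_lt. assert (0 < t ^ osum l p k) by now apply pow_lt.
    split.
    * replace (b1 * a1 * (t ^ o * t ^ osum l p k)) with ((b1 * t ^ o) * (a1 * t ^ osum l p k)) by ring.
      apply Rmult_le_compat; auto; apply Rmult_le_pos; lra.
    * replace (b2 * a2 * (t ^ o * t ^ osum l p k)) with ((b2 * t ^ o) * (a2 * t ^ osum l p k)) by ring.
      apply Rmult_le_compat; auto; apply Cmod_ge_0.
Qed.

(** [subst_series] gives no formula for the coefficients of [d]; the leading index is recovered by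
    comparing the given growth with that of the first nonzero term. *)
Lemma order_of_asymp d o : conv1 d ->
  (exists rho c1 c2, 0 < rho /\ 0 < c1 /\ 0 < c2 /\
   forall t, 0 < t <= rho -> c1 * t ^ o <= Cmod (pval d t) <= c2 * t ^ o) ->
  d o <> RtoC 0 /\ forall j, (j < o)%nat -> d j = RtoC 0.
Proof.
intros Hd [rho [c1 [c2 [rho0 [c10 [c20 H]]]]]].
destruct (classic (exists k, d k <> RtoC 0)) as [ex|no].
2:{ exfalso; destruct (H rho) as [h _]; [lra|].
    assert (Z : pval d rho = RtoC 0).
      apply CSeries_zero; intros n; replace (d n) with (RtoC 0); [ring|].
      symmetry; apply NNPP; intros h'; apply no; now exists n.
    rewrite Z, Cmod_0 in h; assert (0 < c1 * rho ^ o) by (apply Rmult_lt_0_compat; [auto|now apply pow_lt]); lra. }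
destruct (first_index _ ex) as [k [dk low]].
assert (low' : forall j, (j < k)%nat -> d j = RtoC 0) by (intros j hj; apply NNPP, low, hj).
destruct (pval_asymp d k Hd low' dk) as [r [a1 [a2 [r0 [a10 [a20 H2]]]]]].
assert (N : forall A B u v, 0 < A -> 0 < B -> (forall t, 0 < t <= Rmin rho r -> A * t ^ u <= B * t ^ v) -> (v <= u)%nat).
  intros A B u v hA hB h; apply INR_le, (Rpower_compare A B); auto.
  exists (Rmin rho r); split; [now apply Rmin_pos|]; intros t ht.
  rewrite !Rpower_pow by lra; apply h; lra.
assert (Rmin rho r <= rho) by apply Rmin_l; assert (Rmin rho r <= r) by apply Rmin_r.
assert (E : k = o).
  apply Nat.le_antisymm.
  - apply (N c1 a2); auto; intros t ht; destruct (H t); [lra|]; destruct (H2 t); lra.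
  - apply (N a1 c2); auto; intros t ht; destruct (H t); [lra|]; destruct (H2 t); lra.
subst k; auto.
Qed.

Lemma has_ord_factored a N Phi U p k (g : puiseux) : conv2 Rabs a -> (1 <= N)%nat -> pN g = N ->
  factored a N Phi U -> conv1 (pc g) -> pc g 0 = RtoC 0 ->
  (forall d N, conv2 Cmod (fun i j => RtoC (a i j)) -> conv1 d -> d 0%nat = RtoC 0 -> (1 <= N)%nat ->
    exists e, conv1 e /\ exists r, 0 < r /\ forall t, 0 < t -> t < r ->
     eval2 (fun i j => RtoC (a i j)) (pval d t) (RtoC (t ^ N)) = pval e t) ->
  (forall j, (j < k)%nat -> pc g j = RtoC (p j)) -> (forall phi, In phi Phi -> phi k <> pc g k) ->
  has_ord (fun y => germ_val a (puis_val g y) y) (INR (osum Phi p k) / INR N).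
Proof.
intros Ha HN EN [HPhi [HU [U0 [r [r0 Hf]]]]] Hc H0 Hsub Hp Hk.
destruct (Hsub (pc g) N (conv2_RtoC a Ha) Hc H0 HN) as [d [Hd [r1 [r10 Hr1]]]].
exists N, d; split; auto; split; auto.
destruct (unit_bounds U HU U0) as [r2 [c1 [c2 [r20 [c10 [c20 HU2]]]]]].
destruct (prod_asymp Phi p k (pc g)) as [r3 [b1 [b2 [r30 [b10 [b20 H3]]]]]]; auto.
  intros phi hphi; rewrite List.Forall_forall in HPhi; now apply HPhi.
assert (m0 : 0 < Rmin r r2 / 2) by (apply Rdiv_lt_0_compat; [now apply Rmin_pos|lra]).
destruct (pval_to0 (pc g) (Rmin r r2 / 2) Hc H0 m0) as [r4 [r40 H4]].
split.
- apply near0_imp with (P := fun y => 0 < ypow N y < r1).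
    intros y hy [h1 h2]; unfold germ_val.
    change (puis_val g y) with (pval (pc g) (ypow (pN g) y)); rewrite EN.
    rewrite <- (ypow_pow N y HN hy) at 2; now apply Hr1.
  apply (near0_ypow N (fun t => 0 < t < r1)); auto; exists r1; auto.
- exists (osum Phi p k).
  destruct (order_of_asymp d (osum Phi p k) Hd) as [h1 h2]; [|now split].
  exists (Rmin (Rmin (r1 / 2) r3) (Rmin (Rmin r r2 / 2) r4)), (c1 * b1), (c2 * b2).
  split; [repeat apply Rmin_pos; auto; lra|].
  split; [now apply Rmult_lt_0_compat|]; split; [now apply Rmult_lt_0_compat|]; intros t [t0 t1].
  assert (s1 : t <= r1 / 2) by min_bound.
  assert (s2 : t <= r3) by min_bound.
  assert (s3 : t <= Rmin r r2 / 2) by min_bound.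
  assert (s4 : t <= r4) by min_bound.
  assert (Rmin r r2 <= r) by apply Rmin_l; assert (Rmin r r2 <= r2) by apply Rmin_r.
  pose proof (H4 t ltac:(lra)) as hx.
  rewrite <- Hr1, Hf, Cmod_mult by lra.
  destruct (HU2 (pval (pc g) t) t) as [u1 u2]; [lra|lra|lra|].
  destruct (H3 t) as [v1 v2]; [lra|].
  assert (0 < t ^ osum Phi p k) by now apply pow_lt.
  split.
  + rewrite Rmult_assoc; apply Rmult_le_compat; auto; [lra|apply Rmult_le_pos; lra].
  + rewrite Rmult_assoc; apply Rmult_le_compat; auto; apply Cmod_ge_0.
Qed.

Lemma is_root_factored a N Phi U phi : (1 <= N)%nat -> factored a N Phi U -> In phi Phi ->
  is_root a (Puis N phi).
Proof.
intros HN [HPhi [_ [_ [r [r0 Hf]]]]] Hin; rewrite List.Forall_forall in HPhi.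
destruct (HPhi phi Hin) as [h0 hc]; split; [split; auto|].
assert (hr : 0 < r / 2) by lra.
pose proof (near0_puis_small (Puis N phi) _ HN hc h0 hr) as N1.
assert (N2 : near0 (fun y => ypow N y < r)).
  apply (near0_ypow N (fun t => t < r)); auto; exists r; split; auto; intros; lra.
apply near0_imp with (2 := near0_and _ _ N1 N2); intros y hy [h1 h2].
unfold germ_val; rewrite <- (ypow_pow N y HN hy) at 2.
rewrite Hf; [|lra|apply ypow_pos|auto].
rewrite (lprod_zero _ Phi phi Hin); [ring|].
change (puis_val (Puis N phi) y) with (pval phi (ypow N y)); ring.
Qed.

Lemma lprod_partition p K phi l z t :
  (forall psi, In psi l -> agree p K psi -> forall j, psi j = phi j) ->
  lprod (fun psi => Cminus z (pval psi t)) l =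
  Cmult (cpow (Cminus z (pval phi t)) (cnt l p K))
    (lprod (fun psi => Cminus z (pval psi t)) (filter (fun psi => negb (agreeb p K psi)) l)).
Proof.
induction l as [|psi l IH]; intros H; [simpl; ring|].
rewrite cnt_cons; simpl; rewrite IH by (intros; apply H; auto; now right).
destruct (agreeb p K psi) eqn:E; simpl.
- apply agreebP in E; rewrite (pval_ext psi phi) by (intros j; apply H; auto; now left); ring.
- ring.
Qed.

(** Roots in [Phi] agreeing with [phi] below [K] are equal to it, so their number is the exponent;
    each of the others differs from [phi] in some coefficient, which keeps the cofactor nonzero on
    the root. *)
Lemma mult_factored a N Phi U phi p K : (1 <= N)%nat -> factored a N Phi U ->
  conv1 phi -> is_root a (Puis N phi) ->
  (forall j, phi j = RtoC (p j)) ->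
  (forall psi, In psi Phi -> agree p K psi -> forall j, psi j = phi j) ->
  mult a (Puis N phi) (cnt Phi p K).
Proof.
intros HN [HPhi [HU [U0 [r [r0 Hf]]]]] hc Hroot Hp Hsep; split; auto.
rewrite List.Forall_forall in HPhi.
set (rest := filter (fun psi => negb (agreeb p K psi)) Phi).
assert (Hrest : forall psi, In psi rest -> In psi Phi /\ ~ agree p K psi).
  intros psi h; apply filter_In in h; destruct h as [h1 h2]; split; auto.
  intros h3; apply agreebP in h3; rewrite h3 in h2; discriminate.
destruct (mul_root_factors rest U) as [W [HW [r1 [r10 HW1]]]]; auto.
  intros psi h; apply HPhi, Hrest, h.
exists N, W; split; auto; split; auto.
assert (h0 : phi 0%nat = RtoC 0) by apply Hroot.
split.
- exists (Rmin (Rmin r r1) (Rmin (r ^ N) (r1 ^ N))).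
  assert (0 < r ^ N) by now apply pow_lt. assert (0 < r1 ^ N) by now apply pow_lt.
  split; [repeat apply Rmin_pos; auto|]; intros y x [y0 y1] hx.
  assert (Rmin (Rmin r r1) (Rmin (r ^ N) (r1 ^ N)) <= r) by min_bound.
  assert (Rmin (Rmin r r1) (Rmin (r ^ N) (r1 ^ N)) <= r1) by min_bound.
  assert (Rmin (Rmin r r1) (Rmin (r ^ N) (r1 ^ N)) <= r ^ N) by min_bound.
  assert (Rmin (Rmin r r1) (Rmin (r ^ N) (r1 ^ N)) <= r1 ^ N) by min_bound.
  assert (t1 : ypow N y < r) by (apply ypow_lt; auto; lra).
  assert (t2 : ypow N y < r1) by (apply ypow_lt; auto; lra).
  unfold germ_val; rewrite <- (ypow_pow N y HN y0) at 1.
  rewrite Hf, HW1 by (auto; try apply ypow_pos; lra).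
  rewrite (lprod_partition p K phi Phi _ _ Hsep); fold rest.
  change (puis_val (Puis N phi) y) with (pval phi (ypow N y)); ring.
- destruct (unit_bounds U HU U0) as [r2 [c1 [c2 [r20 [c10 [_ HU2]]]]]].
  assert (NZ : exists rho, 0 < rho /\ forall t, 0 < t <= rho ->
     lprod (fun psi => Cminus (pval phi t) (pval psi t)) rest <> RtoC 0).
    clear HW1; induction rest as [|psi l IH].
      exists 1; split; [lra|]; intros t ht; simpl; intros h; injection h; lra.
    destruct IH as [q1 [q10 Q1]]; [intros; apply Hrest; now right|].
    destruct (Hrest psi (or_introl eq_refl)) as [hin hna].
    assert (ex : exists j, psi j <> phi j).
      apply NNPP; intros no; apply hna; intros j _; rewrite <- Hp.
      apply NNPP; intros h; apply no; now exists j.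
    destruct (first_index _ ex) as [o [ho low]].
    destruct (diff_asymp phi psi o) as [q2 [b1 [b2 [q20 [b10 [_ Q2]]]]]]; auto.
      now apply HPhi.
      intros j hj; apply NNPP, low, hj.
    exists (Rmin q1 q2); split; [now apply Rmin_pos|]; intros t [t0 t1]; simpl.
    assert (Rmin q1 q2 <= q1) by apply Rmin_l; assert (Rmin q1 q2 <= q2) by apply Rmin_r.
    apply Cmult_neq_0; [|apply Q1; lra].
    intros h; destruct (Q2 t) as [b _]; [lra|]; rewrite h, Cmod_0 in b.
    assert (0 < b1 * t ^ o) by (apply Rmult_lt_0_compat; [auto|now apply pow_lt]); lra.
  destruct NZ as [q [q0 NZ]].
  intros Hz.
  assert (m0 : 0 < Rmin r1 r2 / 2) by (apply Rdiv_lt_0_compat; [now apply Rmin_pos|lra]).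
  pose proof (near0_puis_small (Puis N phi) _ HN hc h0 m0) as N1.
  assert (m1 : 0 < Rmin (Rmin r1 r2) q) by (repeat apply Rmin_pos; auto).
  assert (N2 : near0 (fun y => ypow N y < Rmin (Rmin r1 r2) q)).
    apply (near0_ypow N (fun t => t < Rmin (Rmin r1 r2) q)); auto; exists (Rmin (Rmin r1 r2) q); split; auto; intros; lra.
  destruct (near0_ex _ (near0_and _ _ Hz (near0_and _ _ N1 N2))) as [y [y0 [z1 [z2 z3]]]].
  change (puis_val (Puis N phi) y) with (pval phi (ypow N y)) in z1, z2.
  pose proof (ypow_pos N y) as tp; set (t := ypow N y) in *.
  assert (Rmin (Rmin r1 r2) q <= Rmin r1 r2) by apply Rmin_l; assert (Rmin (Rmin r1 r2) q <= q) by apply Rmin_r.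
  assert (Rmin r1 r2 <= r1) by apply Rmin_l; assert (Rmin r1 r2 <= r2) by apply Rmin_r.
  rewrite HW1 in z1 by lra.
  destruct (HU2 (pval phi t) t) as [b _]; [lra|lra|lra|].
  revert z1; apply Cmult_neq_0; [|apply NZ; lra].
  intros h; rewrite h, Cmod_0 in b; lra.
Qed.

(** * The exponent *)

(** Each property that fails at all fails at a definite index, and the list is finite. This is what
    makes the first [K] coefficients decide both the equality of two roots and the reality of
    one. *)
Lemma uniform_bound {A : Type} (P : A -> nat -> Prop) (l : list A) :
  exists K, forall v, In v l -> (forall j, (j < K)%nat -> P v j) -> forall j, P v j.
Proof.
induction l as [|v l [K HK]]; [exists O; intros v []|].
assert (H : exists K', (forall j, (j < K')%nat -> P v j) -> forall j, P v j).
  destruct (classic (exists j, ~ P v j)) as [[j hj]|no].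
    exists (S j); intros h; exfalso; apply hj, h; lia.
  exists O; intros _ j; apply NNPP; intros h; apply no; now exists j.
destruct H as [K' HK']; exists (Nat.max K K'); intros w [->|hw] h j.
- apply HK'; intros i hi; apply h; lia.
- apply HK; auto; intros i hi; apply h; lia.
Qed.

Lemma separation (l : list (nat -> C)) : exists K,
  (forall phi psi, In phi l -> In psi l -> (forall j, (j < K)%nat -> phi j = psi j) ->
     forall j, phi j = psi j) /\
  (forall phi, In phi l -> (forall j, (j < K)%nat -> snd (phi j) = 0) -> forall j, snd (phi j) = 0).
Proof.
destruct (uniform_bound (fun (v : (nat -> C) * (nat -> C)) j => fst v j = snd v j) (list_prod l l)) as [K1 H1].
destruct (uniform_bound (fun (v : nat -> C) j => snd (v j) = 0) l) as [K2 H2].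
exists (Nat.max K1 K2); split.
- intros phi psi h1 h2 h; apply (H1 (phi, psi)); [now apply in_prod|].
  intros j hj; apply h; lia.
- intros phi h1 h; apply H2; auto; intros j hj; apply h; lia.
Qed.

(** Roots without constant term all agree at level 1; this makes the orders of [f] and [g] positive,
    and with them the quotients in [L^+]. *)
Lemma osum_ge l p k : (1 <= k)%nat -> (forall psi, In psi l -> psi 0%nat = RtoC (p 0%nat)) ->
  (length l <= osum l p k)%nat.
Proof.
intros hk H; assert (E : cnt l p 1 = length l).
  unfold cnt; clear hk; induction l as [|psi l IH]; auto; simpl.
  assert (A : agreeb p 1 psi = true).
    apply agreebP; intros j hj; replace j with O by lia; apply H; now left.
  rewrite A; simpl; rewrite IH; auto; intros; apply H; now right.
induction k; [lia|]; simpl; destruct (Nat.eq_dec k 0) as [->|ne]; [simpl; lia|].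
specialize (IHk ltac:(lia)); lia.
Qed.

Definition pref (phi : nat -> C) : nat -> R := fun j => fst (phi j).

Lemma pref_real phi j : snd (phi j) = 0 -> phi j = RtoC (pref phi j).
Proof. intros H; apply injective_projections; auto. Qed.

Lemma rval_zero_germ a x y : rval a x y = 0 -> germ_val a (RtoC x) y = RtoC 0.
Proof. intros H; now rewrite germ_val_real, H. Qed.

Section Half.
Variables (a b : nat -> nat -> R) (N K : nat) (Phi Psi : list (nat -> C)) (U V : nat -> nat -> C).
Hypotheses (Ha : conv2 Rabs a) (Hb : conv2 Rabs b) (HN : (1 <= N)%nat).
Hypotheses (Fa : factored a N Phi U) (Fb : factored b N Psi V).
Hypotheses (Phi0 : Phi <> nil) (Psi0 : Psi <> nil).
Hypothesis Hincl : exists r, 0 < r /\ forall x y, sqrt (x ^ 2 + y ^ 2) < r ->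
      rval a x y = 0 -> rval b x y = 0.
Hypothesis Hsep : forall phi psi, In phi (Phi ++ Psi) -> In psi (Phi ++ Psi) ->
  (forall j, (j < K)%nat -> phi j = psi j) -> forall j, phi j = psi j.
Hypothesis Hreal : forall phi, In phi (Phi ++ Psi) ->
  (forall j, (j < K)%nat -> snd (phi j) = 0) -> forall j, snd (phi j) = 0.

Let PhiP phi : In phi Phi -> phi 0%nat = RtoC 0 /\ conv1 phi.
Proof. destruct Fa as [H _]; rewrite List.Forall_forall in H; apply H. Qed.
Let PsiP phi : In phi Psi -> phi 0%nat = RtoC 0 /\ conv1 phi.
Proof. destruct Fb as [H _]; rewrite List.Forall_forall in H; apply H. Qed.

(** What the tree argument extracts from one element of [L^+]: the clause for a root that leaves the
    real tree at [k] comes from [ell], the clause for a real root from the quotient of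
    multiplicities. For each root exactly one of them has content. *)
Definition dominated phi lam : Prop :=
  (forall k, snd (phi k) <> 0 -> (forall j, (j < k)%nat -> snd (phi j) = 0) ->
     INR (osum Phi (pref phi) k) <= lam * INR (osum Psi (pref phi) k)) /\
  ((forall k, snd (phi k) = 0) -> INR (cnt Phi (pref phi) K) <= lam * INR (cnt Psi (pref phi) K)).

Lemma dominated_le phi lam lam' : lam <= lam' -> dominated phi lam -> dominated phi lam'.
Proof.
intros h [H1 H2]; split.
- intros k h1 h2; eapply Rle_trans; [now apply H1|]; apply Rmult_le_compat_r; auto; apply pos_INR.
- intros h1; eapply Rle_trans; [now apply H2|]; apply Rmult_le_compat_r; auto; apply pos_INR.
Qed.

Lemma osum_pos l phi k : l <> nil -> (1 <= k)%nat -> (forall psi, In psi l -> psi 0%nat = RtoC 0) ->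
  phi 0%nat = RtoC 0 -> 0 < INR (osum l (pref phi) k).
Proof.
intros hl hk H0 hp; apply lt_0_INR.
pose proof (osum_ge l (pref phi) k hk) as h; destruct l as [|psi l]; [contradiction|].
assert (length (psi :: l) <= osum (psi :: l) (pref phi) k)%nat.
  apply h; intros psi' hin; rewrite H0 by auto; unfold pref; now rewrite hp.
simpl length in H; lia.
Qed.

Lemma has_ord_subst c l W p k g : conv2 Rabs c -> factored c N l W -> pN g = N -> conv1 (pc g) ->
  pc g 0 = RtoC 0 -> (forall j, (j < k)%nat -> pc g j = RtoC (p j)) ->
  (forall phi, In phi l -> phi k <> pc g k) ->
  has_ord (fun y => germ_val c (puis_val g y) y) (INR (osum l p k) / INR N).
Proof.
intros Hc Fc HgN Hg1 Hg0 Hp Hk.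
apply (has_ord_factored c N l W p k g); auto.
intros d M h1 h2 h3 h4; apply Puiseux.subst_series; auto.
destruct M; [lia|reflexivity].
Qed.

Lemma candidate_nonreal phi k0 : In phi Phi -> snd (phi k0) <> 0 ->
  (forall j, (j < k0)%nat -> snd (phi j) = 0) ->
  exists l, 0 < l /\ Lplus_set a b l /\ dominated phi l.
Proof.
intros hin h1 h2; destruct (PhiP phi hin) as [z0 hc].
assert (k1 : (1 <= k0)%nat) by (destruct k0; [rewrite z0 in h1; simpl in h1; lra|lia]).
pose proof (osum_pos Phi phi k0 Phi0 k1 (fun psi h => proj1 (PhiP psi h)) z0) as p1.
pose proof (osum_pos Psi phi k0 Psi0 k1 (fun psi h => proj1 (PsiP psi h)) z0) as p2.
pose proof (INR_pos N HN) as n0.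
exists (INR (osum Phi (pref phi) k0) / INR (osum Psi (pref phi) k0)).
split; [now apply Rdiv_lt_0_compat|]; split.
- left; exists (Puis N phi), k0; split; [now apply (is_root_factored a N Phi U)|].
  assert (fn : first_nonreal (Puis N phi) k0) by (split; auto).
  (* Generic means here: different from the real parts of the coefficients at [k0] of all roots of
     [f] and [g]. *)
  split; auto; exists (map (fun psi => fst (psi k0)) (Phi ++ Psi)); intros c hcF.
  assert (ne : forall psi, In psi (Phi ++ Psi) -> psi k0 <> pc (real_approx (Puis N phi) k0 c) k0).
    intros psi h E; apply hcF, in_map_iff; exists psi; split; auto; rewrite E; simpl.
    rewrite Nat.ltb_irrefl, Nat.eqb_refl; reflexivity.
  assert (eqp : forall j, (j < k0)%nat -> pc (real_approx (Puis N phi) k0 c) j = RtoC (pref phi j)).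
    intros j hj; simpl; destruct (Nat.ltb_spec j k0); [|lia]; apply pref_real, h2, hj.
  exists (INR (osum Phi (pref phi) k0) / INR N), (INR (osum Psi (pref phi) k0) / INR N).
  split; [|split].
  + apply (has_ord_subst a Phi U); auto.
    * apply real_approx_conv.
    * now apply real_approx_0.
    * intros psi h; apply ne, in_or_app; now left.
  + apply (has_ord_subst b Psi V); auto.
    * apply real_approx_conv.
    * now apply real_approx_0.
    * intros psi h; apply ne, in_or_app; now right.
  + field; lra.
- split.
  + intros k h3 h4; assert (k = k0).
      destruct (Nat.lt_trichotomy k k0) as [h|[h|h]]; auto.
        exfalso; apply h3, h2, h.
      exfalso; apply h1, h4, h.
    subst k; right; field; lra.
  + intros h; exfalso; apply h1, h.
Qed.

Lemma candidate_real phi : In phi Phi -> (forall k, snd (phi k) = 0) ->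
  exists l, 0 < l /\ Lplus_set a b l /\ dominated phi l.
Proof.
intros hin hre; destruct (PhiP phi hin) as [z0 hc].
pose proof (is_root_factored a N Phi U phi HN Fa hin) as Ra.
(* [f] vanishes on the real arc of [phi], so the inclusion of the zero sets makes [phi] a root of
   [g] and its multiplicity there positive. *)
assert (Rb : is_root b (Puis N phi)).
  split; [apply Ra|]; destruct Ra as [_ Hz]; destruct Hincl as [r [r0 Hr]].
  assert (hr : 0 < r / 2) by lra.
  pose proof (near0_puis_small (Puis N phi) _ HN hc z0 hr) as N1.
  apply near0_imp with (2 := near0_and _ _ Hz (near0_and _ _ N1 (near0_lt _ hr))).
  intros y hy [g1 [g2 g3]].
  assert (Ex : puis_val (Puis N phi) y = RtoC (fst (puis_val (Puis N phi) y))) by (apply pval_real; exact hre).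
  rewrite Ex in g1, g2 |- *; set (x := fst (puis_val (Puis N phi) y)) in *.
  rewrite Cmod_R in g2; apply rval_zero_germ, Hr.
    eapply Rle_lt_trans; [apply sqrt_sum_le|]; rewrite (Rabs_pos_eq y); lra.
  unfold rval; rewrite g1; reflexivity.
assert (hp : forall j, phi j = RtoC (pref phi j)) by (intros j; apply pref_real, hre).
assert (same : forall psi, In psi (Phi ++ Psi) -> agree (pref phi) K psi -> forall j, psi j = phi j).
  intros psi h1 h2; apply Hsep; auto; [apply in_or_app; now left|].
  intros j hj; rewrite (h2 j hj); symmetry; apply hp.
assert (Ma : mult a (Puis N phi) (cnt Phi (pref phi) K)).
  apply (mult_factored a N Phi U phi (pref phi) K); auto.
  intros psi h; apply same, in_or_app; now left.
assert (Mb : mult b (Puis N phi) (cnt Psi (pref phi) K)).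
  apply (mult_factored b N Psi V phi (pref phi) K); auto.
  intros psi h; apply same, in_or_app; now right.
pose proof (INR_pos _ (mult_pos _ _ _ Ma)) as m0; pose proof (INR_pos _ (mult_pos _ _ _ Mb)) as n0.
exists (INR (cnt Phi (pref phi) K) / INR (cnt Psi (pref phi) K)).
split; [now apply Rdiv_lt_0_compat|]; split.
- right; exists (Puis N phi), (cnt Phi (pref phi) K), (cnt Psi (pref phi) K); split; auto.
- split.
  + intros k h; exfalso; apply h, hre.
  + intros _; right; field; lra.
Qed.

Lemma candidate phi : In phi Phi -> exists l, 0 < l /\ Lplus_set a b l /\ dominated phi l.
Proof.
intros hin; destruct (classic (exists k, snd (phi k) <> 0)) as [ex|no].
- destruct (first_index _ ex) as [k0 [h1 h2]]; apply (candidate_nonreal phi k0); auto.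
  intros j hj; apply NNPP, h2, hj.
- apply candidate_real; auto; intros k; apply NNPP; intros h; apply no; now exists k.
Qed.

(** One element of [L^+] per root of [f] suffices, because only these roots impose conditions on the
    tree. Nothing is claimed yet about the other elements of [L^+]. *)
Lemma max_candidate : exists l, 0 < l /\ Lplus_set a b l /\ forall phi, In phi Phi -> dominated phi l.
Proof.
assert (G : forall L : list (nat -> C), (forall phi, In phi L -> In phi Phi) -> L <> nil ->
   exists l, 0 < l /\ Lplus_set a b l /\ forall phi, In phi L -> dominated phi l).
  intros L; induction L as [|phi L IH]; intros HL hne; [contradiction|].
  destruct (candidate phi (HL phi (or_introl eq_refl))) as [l1 [p1 [S1 D1]]].
  destruct L as [|psi L].
    exists l1; split; auto; split; auto; intros w [<-|[]]; auto.
  destruct IH as [l2 [p2 [S2 D2]]]; [intros w h; apply HL; now right|discriminate|].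
  destruct (Rle_lt_dec l1 l2) as [h|h].
    exists l2; split; auto; split; auto; intros w [<-|hw]; [now apply (dominated_le phi l1)|auto].
  exists l1; split; auto; split; auto; intros w [<-|hw]; auto.
  apply (dominated_le w l2); [lra|auto].
apply G; auto.
Qed.

Lemma half_inequality lam : 0 < lam -> (forall phi, In phi Phi -> dominated phi lam) ->
  exists A r, 0 < A /\ 0 < r /\ forall x y, 0 < y < r -> Rabs x < r ->
    A * rpow0 (Rabs (rval b x y)) lam <= Rabs (rval a x y).
Proof.
intros lam0 HD.
(* The tree lemmas speak of arbitrary truncations [p]; a root through the node identifies [p] with
   its own real prefix, to which [dominated] applies. *)
assert (H1 : forall p k phi, In phi Phi -> agree p k phi -> snd (phi k) <> 0 ->
    height lam Phi Psi p k <= 0).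
  intros p k phi hin hag hk.
  assert (h2 : forall j, (j < k)%nat -> p j = pref phi j).
    intros j hj; unfold pref; now rewrite (hag j hj).
  rewrite (height_ext lam Phi Psi p (pref phi) k h2); unfold height.
  destruct (HD phi hin) as [D _]; specialize (D k hk).
  assert (INR (osum Phi (pref phi) k) <= lam * INR (osum Psi (pref phi) k)); [|lra].
  apply D; intros j hj; rewrite (hag j hj); reflexivity.
assert (H2 : forall p, (1 <= cnt Phi p K)%nat -> INR (cnt Phi p K) <= lam * INR (cnt Psi p K)).
  intros p hp; destruct (cnt_pos_ex Phi p K hp) as [phi [hin hag]].
  assert (h2 : forall j, (j < K)%nat -> p j = pref phi j).
    intros j hj; unfold pref; now rewrite (hag j hj).
  rewrite (cnt_ext Phi p (pref phi) K h2), (cnt_ext Psi p (pref phi) K h2).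
  apply (HD phi hin), Hreal; [apply in_or_app; now left|].
  intros j hj; rewrite (hag j hj); reflexivity.
assert (H3 : forall phi, In phi (Phi ++ Psi) -> conv1 phi).
  intros phi h; apply in_app_or in h; destruct h as [h|h]; [apply (PhiP phi h)|apply (PsiP phi h)].
(* At the root of the tree the height is 0 and every factor is present, so the inequality there is
   the desired one up to units. *)
assert (T : node_ineq lam Phi Psi (fun _ => 0) 0).
  apply (node_ineq_all lam Phi Psi K) with (n := K); auto.
  intros p k hk; now apply (height_le0 lam Phi Psi K lam0 H1 H2).
destruct (T 1) as [A [del [A0 [del0 HT]]]]; [lra|].
destruct Fa as [_ [HU [U0 [r1 [r10 Hfa]]]]]; destruct Fb as [_ [HV [V0 [r2 [r20 Hfb]]]]].
destruct (unit_bounds U HU U0) as [r3 [c1 [c2 [r30 [c10 [_ HUb]]]]]].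
destruct (unit_bounds V HV V0) as [r4 [d1 [d2 [r40 [_ [d20 HVb]]]]]].
assert (E0 : forall l z t, Cmod (lprod (fun phi => Cminus (RtoC z) (pval phi t)) l) = prodf l (fun _ => 0) 0 z t).
  intros l z t; rewrite Cmod_lprod; apply rprod_ext; intros phi _; unfold fac.
  rewrite (proj2 (agreebP (fun _ => 0) 0 phi)); [reflexivity|]; intros j hj; lia.
set (r := Rmin (Rmin 1 del) (Rmin (Rmin r1 r2) (Rmin r3 r4))).
assert (r0 : 0 < r) by (repeat apply Rmin_pos; auto; lra).
assert (s1 : r <= 1) by min_bound.
assert (s2 : r <= del) by min_bound.
assert (s3 : r <= r1) by min_bound.
assert (s4 : r <= r2) by min_bound.
assert (s5 : r <= r3) by min_bound.
assert (s6 : r <= r4) by min_bound.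
clearbody r.
assert (dp : 0 < Rpower (/ d2) lam) by apply exp_pos.
assert (id : 0 < / d2) by now apply Rinv_0_lt_compat.
exists (c1 * A * Rpower (/ d2) lam), (Rmin r (r ^ N)).
split; [repeat apply Rmult_lt_0_compat; auto|].
split; [apply Rmin_pos; auto; now apply pow_lt|]; intros x y [y0 y1] hx.
assert (hx' : Rabs x < r) by min_bound.
assert (hyN : y < r ^ N) by min_bound.
pose proof (ypow_lt N y r HN y0 r0 hyN) as t1; pose proof (ypow_pos N y) as t0.
pose proof (ypow_pow N y HN y0) as Ey; set (t := ypow N y) in *.
assert (cx : Cmod (RtoC x) = Rabs x) by apply Cmod_R.
rewrite <- !Cmod_germ_real; unfold germ_val; rewrite <- Ey.
rewrite Hfa, Hfb by lra; rewrite !Cmod_mult, !E0.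
destruct (HUb (RtoC x) t) as [u1 _]; [lra|lra|lra|].
destruct (HVb (RtoC x) t) as [_ v2]; [lra|lra|lra|].
specialize (HT t x ltac:(lra) ltac:(lra)).
assert (height0 : height lam Phi Psi (fun _ => 0) 0 = 0) by (unfold height; simpl; ring).
rewrite height0, Ropp_0, Rpower_O, Rmult_1_l in HT by auto.
pose proof (prodf_ge0 Psi (fun _ => 0) 0 x t) as q0; pose proof (prodf_ge0 Phi (fun _ => 0) 0 x t) as q1.
set (Q := prodf Psi (fun _ => 0) 0 x t) in *; set (P := prodf Phi (fun _ => 0) 0 x t) in *.
apply Rle_trans with (c1 * P); [|apply Rmult_le_compat_r; lra].
rewrite !Rmult_assoc; apply Rmult_le_compat_l; [lra|].
eapply Rle_trans; [|exact HT]; apply Rmult_le_compat_l; [lra|].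
rewrite <- rpow0_pos by auto.
pose proof (Cmod_ge_0 (eval2 V (RtoC x) (RtoC t))) as w0.
rewrite <- rpow0_mult; [|lra|now apply Rmult_le_pos].
apply rpow0_le; [lra|apply Rmult_le_pos; [lra|now apply Rmult_le_pos]|].
rewrite <- Rmult_assoc; rewrite <- (Rmult_1_l Q) at 2; apply Rmult_le_compat_r; auto.
apply Rle_trans with (/ d2 * d2); [apply Rmult_le_compat_l; lra|right; field; lra].
Qed.

End Half.

(** All [lam >= l] are covered, not only [l], because the two half planes have different maxima and
    the larger one must work on both. *)
Theorem half_plane (a b : nat -> nat -> R) :
  conv2 Rabs a -> conv2 Rabs b -> regular_x a -> regular_x b ->
  a O O = 0 -> b O O = 0 ->
  (exists r, 0 < r /\ forall x y, sqrt (x ^ 2 + y ^ 2) < r ->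
      rval a x y = 0 -> rval b x y = 0) ->
  exists l, 0 < l /\ Lplus_set a b l /\ forall lam, l <= lam ->
    exists A r, 0 < A /\ 0 < r /\ forall x y, 0 < y < r -> Rabs x < r ->
    A * rpow0 (Rabs (rval b x y)) lam <= Rabs (rval a x y).
Proof.
intros Ha Hb Ra Rb a0 b0 Hincl.
destruct (@Puiseux.puiseux_factorization a Ha Ra a0) as [Na Fa].
destruct (@Puiseux.puiseux_factorization b Hb Rb b0) as [Nb Fb].
(* Each germ is ramified further by the index of the other, so that both become series in the same
   [t]. *)
destruct (Fa Nb) as [Phi [U [Phi0 FPhi]]]; destruct (Fb Na) as [Psi [V [Psi0 FPsi]]].
set (N := (S Na * S Nb)%nat).
assert (HN : (1 <= N)%nat) by (unfold N; simpl; lia).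
assert (FA : factored a N Phi U) by exact FPhi.
assert (FB : factored b N Psi V).
  replace N with (S Nb * S Na)%nat by (unfold N; ring); exact FPsi.
destruct (separation (Phi ++ Psi)) as [K [S1 S2]].
destruct (max_candidate a b N K Phi Psi U V Ha Hb HN FA FB Phi0 Psi0 Hincl S1) as [l [l0 [Hl HD]]].
exists l; split; auto; split; auto; intros lam hlam.
apply (half_inequality a b N K Phi Psi U V HN FA FB S1 S2); [lra|].
intros phi h; apply (dominated_le K Phi Psi phi l); auto.
Qed.

(** * Reflection in [y], and the axis [y = 0] *)

Lemma conv2_bar a : conv2 Rabs a -> conv2 Rabs (bar a).
Proof.
intros [r [M [r0 H]]]; exists r, M; split; auto; intros i j; unfold bar.
rewrite Rabs_mult, pow_1_abs, Rmult_1_l; apply H.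
Qed.

Lemma regular_bar a : regular_x a -> regular_x (bar a).
Proof.
intros [m [h1 h2]]; exists m; unfold bar; split; [simpl; lra|].
intros i j h; rewrite h2 by auto; ring.
Qed.

Lemma bar00 a : a O O = 0 -> bar a O O = 0.
Proof. unfold bar; intros ->; ring. Qed.

Lemma rval_bar a x y : rval (bar a) x y = rval a x (- y).
Proof.
unfold rval, germ_val, eval2; f_equal; apply CSeries_ext; intros n; apply csum_ext; intros i hi.
unfold bar; rewrite !cpow_RtoC, <- !RtoC_mult; f_equal.
replace (- y) with (-1 * y) by ring; rewrite Rpow_mult_distr; ring.
Qed.

Lemma rval_to_axis a : conv2 Rabs a -> exists s L, 0 < s /\ 0 <= L /\
  forall x y, Rabs x <= s -> 0 <= y <= s -> Rabs (rval a x 0 - rval a x y) <= L * y.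
Proof.
intros Ha; destruct (germ_lip a Ha) as [s [L [s0 [L0 H]]]]; exists s, L; split; auto; split; auto.
intros x y hx hy; specialize (H (RtoC x) 0 (RtoC x) y).
rewrite !germ_val_real, <- !RtoC_minus, !Cmod_R, Rabs_R0, Rminus_0_l, Rabs_Ropp in H.
rewrite (Rabs_pos_eq y) in H by lra.
replace (x - x) with 0 in H by ring; rewrite Rabs_R0, Rplus_0_l in H; apply H; lra.
Qed.

Lemma Rle_of_small u v L s : 0 < s -> 0 <= L -> (forall y, 0 < y < s -> u <= v + L * y) -> u <= v.
Proof.
intros s0 L0 H; apply Rnot_lt_le; intros h.
set (y := Rmin (s / 2) ((u - v) / 2 / (L + 1))).
assert (y0 : 0 < y) by (apply Rmin_pos; [lra|apply Rdiv_lt_0_compat; lra]).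
assert (y1 : y <= s / 2) by apply Rmin_l; assert (y2 : y <= (u - v) / 2 / (L + 1)) by apply Rmin_r.
specialize (H y ltac:(lra)).
assert (L * y <= (u - v) / 2); [|lra].
apply Rle_trans with ((L + 1) * ((u - v) / 2 / (L + 1))); [apply Rmult_le_compat; lra|].
right; field; lra.
Qed.

(* The inequality on the axis [y = 0] follows by continuity; the loss of the factor
   [(1/2)^lam] makes a lower bound of [g] near [(x, 0)] sufficient. *)
Lemma axis_inequality a b lam A r : conv2 Rabs a -> conv2 Rabs b -> 0 < lam -> 0 < A -> 0 < r ->
  (forall x y, 0 < y < r -> Rabs x < r -> A * rpow0 (Rabs (rval b x y)) lam <= Rabs (rval a x y)) ->
  exists s, 0 < s /\ forall x, Rabs x < s ->
    A * Rpower (/ 2) lam * rpow0 (Rabs (rval b x 0)) lam <= Rabs (rval a x 0).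
Proof.
intros Ha Hb lam0 A0 r0 H.
destruct (rval_to_axis a Ha) as [s1 [L1 [s10 [L10 H1]]]].
destruct (rval_to_axis b Hb) as [s2 [L2 [s20 [L20 H2]]]].
exists (Rmin r (Rmin s1 s2)); split; [repeat apply Rmin_pos; auto|]; intros x hx.
assert (x1 : Rabs x < r) by min_bound.
assert (x2 : Rabs x < s1) by min_bound.
assert (x3 : Rabs x < s2) by min_bound.
set (g := Rabs (rval b x 0)).
assert (g0 : 0 <= g) by apply Rabs_pos.
destruct (Rle_lt_or_eq_dec 0 g g0) as [gp|E].
2:{ rewrite <- E, rpow0_0, Rmult_0_r; apply Rabs_pos. }
set (s := Rmin (Rmin r s1) (Rmin s2 (g / 2 / (L2 + 1)))).
assert (s0 : 0 < s) by (repeat apply Rmin_pos; auto; apply Rdiv_lt_0_compat; lra).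
apply (Rle_of_small _ _ L1 s s0 L10); intros y [y0 y1].
assert (t1 : s <= r) by min_bound.
assert (t2 : s <= s1) by min_bound.
assert (t3 : s <= s2) by min_bound.
assert (t4 : s <= g / 2 / (L2 + 1)) by min_bound.
specialize (H x y ltac:(lra) x1); specialize (H1 x y ltac:(lra) ltac:(lra)); specialize (H2 x y ltac:(lra) ltac:(lra)).
assert (B2 : L2 * y <= g / 2).
  apply Rle_trans with ((L2 + 1) * (g / 2 / (L2 + 1))); [apply Rmult_le_compat; lra|right; field; lra].
assert (G : g / 2 <= Rabs (rval b x y)).
  pose proof (Rabs_triang (rval b x 0 - rval b x y) (rval b x y)) as T.
  replace (rval b x 0 - rval b x y + rval b x y) with (rval b x 0) in T by ring; fold g in T; lra.
assert (F : Rabs (rval a x y) <= Rabs (rval a x 0) + L1 * y).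
  pose proof (Rabs_triang (rval a x 0) (- (rval a x 0 - rval a x y))) as T.
  replace (rval a x 0 + - (rval a x 0 - rval a x y)) with (rval a x y) in T by ring.
  rewrite Rabs_Ropp in T; lra.
apply Rle_trans with (A * rpow0 (Rabs (rval b x y)) lam); [|lra].
rewrite Rmult_assoc; apply Rmult_le_compat_l; [lra|].
rewrite <- rpow0_pos, <- rpow0_mult by lra; apply rpow0_le; lra.
Qed.

Theorem theorem3p2 (a b : nat -> nat -> R) :
  conv2 Rabs a -> conv2 Rabs b ->
  regular_x a -> regular_x b ->
  a O O = 0 -> b O O = 0 ->
  (exists r, 0 < r /\ forall x y, sqrt (x ^ 2 + y ^ 2) < r ->
      rval a x y = 0 -> rval b x y = 0) ->
  exists L, is_inf (loj_adm a b) L /\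
    (Lplus_set a b L \/ Lminus_set a b L) /\
    (forall l, Lplus_set a b l \/ Lminus_set a b l -> l <= L).
Proof.
intros Ha Hb Ra Rb a0 b0 Hincl.
assert (Hincl' : exists r, 0 < r /\ forall x y, sqrt (x ^ 2 + y ^ 2) < r ->
      rval (bar a) x y = 0 -> rval (bar b) x y = 0).
  destruct Hincl as [r [r0 H]]; exists r; split; auto; intros x y hxy.
  rewrite !rval_bar; apply H; replace ((- y) ^ 2) with (y ^ 2) by ring; auto.
destruct (half_plane a b) as [l1 [l10 [S1 I1]]]; auto.
destruct (half_plane (bar a) (bar b)) as [l2 [l20 [S2 I2]]];
  auto using conv2_bar, regular_bar, bar00.
set (L := Rmax l1 l2).
assert (L1 : l1 <= L) by apply Rmax_l; assert (L2 : l2 <= L) by apply Rmax_r.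
assert (SL : Lplus_set a b L \/ Lminus_set a b L).
  unfold L, Rmax; destruct (Rle_dec l1 l2); [right|left]; auto.
(* The disc is symmetric in [y], so admissible exponents stay admissible under reflection and
   [lower_bound] also covers [L^-]. *)
assert (adm_bar : forall al, loj_adm a b al -> loj_adm (bar a) (bar b) al).
  intros al [al0 [Cc [r [Cc0 [r0 H]]]]]; split; auto; exists Cc, r; split; auto; split; auto.
  intros x y hxy; rewrite !rval_bar; apply H; replace ((- y) ^ 2) with (y ^ 2) by ring; auto.
assert (low : forall al l, loj_adm a b al -> Lplus_set a b l \/ Lminus_set a b l -> l <= al).
  intros al l Hal [h|h]; [now apply (lower_bound a b)|].
  apply (lower_bound (bar a) (bar b)); auto using conv2_bar, bar00.
(* The infimum is attained: the two half planes and the axis are glued with the smallest of their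
   constants. *)
assert (adm : loj_adm a b L).
  destruct (I1 L L1) as [A1 [r1 [A10 [r10 J1]]]]; destruct (I2 L L2) as [A2 [r2 [A20 [r20 J2]]]].
  assert (L0 : 0 < L) by lra.
  destruct (axis_inequality a b L A1 r1) as [r3 [r30 J3]]; auto.
  split; auto.
  set (A := Rmin (Rmin A1 A2) (A1 * Rpower (/ 2) L)).
  assert (p2 : 0 < Rpower (/ 2) L) by apply exp_pos.
  assert (A0 : 0 < A) by (repeat apply Rmin_pos; auto; now apply Rmult_lt_0_compat).
  assert (B1 : A <= A1) by min_bound.
  assert (B2 : A <= A2) by min_bound.
  assert (B3 : A <= A1 * Rpower (/ 2) L) by apply Rmin_r.
  set (r := Rmin (Rmin r1 r2) r3 / 2).
  assert (r0 : 0 < r) by (unfold r; apply Rdiv_lt_0_compat; [repeat apply Rmin_pos; auto|lra]).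
  assert (R1 : r < r1) by (assert (Rmin (Rmin r1 r2) r3 <= r1) by min_bound; unfold r; lra).
  assert (R2 : r < r2) by (assert (Rmin (Rmin r1 r2) r3 <= r2) by min_bound; unfold r; lra).
  assert (R3 : r < r3) by (assert (Rmin (Rmin r1 r2) r3 <= r3) by apply Rmin_r; unfold r; lra).
  exists A, r; split; auto; split; auto; intros x y hxy; apply Rle_ge.
  assert (hx : Rabs x <= r).
    eapply Rle_trans; [|exact hxy]; rewrite <- sqrt_Rsqr_abs; apply sqrt_le_1_alt.
    unfold Rsqr; pose proof (pow2_ge_0 y); nra.
  assert (hy : Rabs y <= r).
    eapply Rle_trans; [|exact hxy]; rewrite <- sqrt_Rsqr_abs; apply sqrt_le_1_alt.
    unfold Rsqr; pose proof (pow2_ge_0 x); nra.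
  pose proof (rpow0_ge0 (Rabs (rval b x y)) L) as q0.
  apply Rabs_le_between in hy.
  destruct (Rtotal_order y 0) as [h|[h|h]].
  - specialize (J2 x (- y) ltac:(lra) ltac:(lra)); rewrite !rval_bar, Ropp_involutive in J2.
    eapply Rle_trans; [|exact J2]; now apply Rmult_le_compat_r.
  - subst y; eapply Rle_trans; [|apply J3; lra]; now apply Rmult_le_compat_r.
  - eapply Rle_trans; [|apply J1; lra]; now apply Rmult_le_compat_r.
(* As an element of one of the two sets, [L] is at most every admissible exponent; being admissible
   itself, it is the infimum and, by [low], an upper bound of both sets. *)
exists L; split; [|split; auto].
split.
- intros al Hal; now apply low.
- intros L' HL'; now apply HL'.
Qed.
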